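(* Let $A, B \subset \mathbb{F}_q\setminus\{0\}$ with $|A|,|B|\ge 2$. Consider the condition that \[ (\ast)\qquad |(A+B)^{-1} \cap (cG+d)| \ll \max\{|G|^{1/2}, |A+B|^{51/52}\} \] for all proper subfields $G$ of $\mathbb{F}_q$ and all elements $c, d$ in $\mathbb{F}_q$. (1) If $(\ast)$ holds, then \[ E_{+}(1/A, 1/B) \ll \Big(|A + B|^{173/104} + q^{-1/285}|A+B|^{476/285}\Big) |B|^{4/3}. \] (2) If $(\ast)$ holds with $B=A$, then \[ \max\{|A+A|, |1/A + 1/A|\} \gg \min\{|A|^{1+1/831},\ q^{1/761}|A|^{1-1/761}\}. \] (3) If $(\ast)$ holds with $B = A^{-1}$, then \[ |A + 1/A| \gg \min\{|A|^{1+1/831},\ q^{1/761}|A|^{1-1/761}\}. \] (4) Alternatively (i.e. without assuming $(\ast)$), the conclusions of both (2) and (3) hold if, for every proper subfield $G$ of $\mathbb{F}_q$, the cardinality $|A|$ does not lie in the interval $(|G|^{1/2 - 1/1664}, |G|^{1+1/51})$.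
   Context: $q$ is a power of a prime and $\mathbb{F}_q$ is the finite field with $q$ elements. For $X\subset\mathbb{F}_q$, $X^{-1}=1/X=\{1/x: x\in X,\ x\neq 0\}$. $X+Y=\{x+y:x\in X,y\in Y\}$ and $cG+d=\{cg+d: g\in G\}$. For $X,Y\subset\mathbb{F}_q$ the additive energy is $E_+(X,Y)=|\{(x_1,x_2,y_1,y_2)\in X^2\times Y^2: x_1+y_1=x_2+y_2\}|$. $X\ll Y$ (equivalently $Y\gg X$) means $X\le CY$ for an absolute constant $C>0$; where $\ll$ occurs in a hypothesis it is assumed with some fixed absolute constant, uniformly in $G,c,d$, and the implied constants in the conclusions may depend on that constant only. *)

(* Defs.v *)
From HB Require Import structures.
From mathcomp Require Import all_boot all_order all_algebra.
From mathcomp Require Import reals exp.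

Set Implicit Arguments.
Unset Strict Implicit.
Unset Printing Implicit Defensive.

Import Order.TTheory GRing.Theory Num.Theory.

Local Open Scope ring_scope.

Section SetOperations.
Variable F : finFieldType.
Implicit Types X Y G : {set F}.

Definition sumset X Y : {set F} := [set x + y | x in X, y in Y].

(* The condition matters: in MathComp 0^-1 = 0. *)
Definition invset X : {set F} := [set x^-1 | x in X & x != 0].

Definition affine_image (c d : F) G : {set F} := [set c * g + d | g in G].

(* Quadruples (x1, x2, y1, y2) are encoded as ((x1, x2), (y1, y2)). *)
Definition additive_energy X Y : nat :=
  #|[set t : (F * F) * (F * F) |
      [&& t.1.1 \in X, t.1.2 \in X, t.2.1 \in Y, t.2.2 \in Y
        & t.1.1 + t.2.1 == t.1.2 + t.2.2]]|.

Definition proper_subfield G : Prop :=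
  GRing.divring_closed G /\ G \proper [set: F].

End SetOperations.

(* The subfield condition on (A + B)^-1, with its implied constant K
   made explicit. *)
Definition subfield_sparse (R : realType) (K : R) (F : finFieldType)
    (A B : {set F}) : Prop :=
  forall G : {set F}, proper_subfield G -> forall c d : F,
    #|invset (sumset A B) :&: affine_image c d G|%:R
    <= K * Num.max (#|G|%:R `^ (1 / 2)) (#|sumset A B|%:R `^ (51 / 52)).

Definition growth_bound (R : realType) (F : finFieldType) (A : {set F}) : R :=
  Num.min (#|A|%:R `^ (1 + 1 / 831))
          (#|F|%:R `^ (1 / 761) * #|A|%:R `^ (1 - 1 / 761)).

(* Main.v *)
Require Import Defs.
From HB Require Import structures.
From mathcomp Require Import all_boot all_order all_algebra.
From mathcomp Require Import reals sequences exp.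
From mathcomp Require Import zify ring lra.

Set Implicit Arguments.
Unset Strict Implicit.
Unset Printing Implicit Defensive.

Import Order.TTheory GRing.Theory Num.Theory.

Local Open Scope ring_scope.

(** Write U = (A + B)^-1 and n = |U|.  With x = 1/a and y = 1/b one has
    1/(a + b) = y - y^2/(x + y), so a coincidence x1 + y1 = x2 + y2 places the
    point (1/(a2 + b2), 1/(a1 + b1)) of U x U on the line obtained by eliminating
    w from u1 = y1 - y1^2 w and u2 = y2 - y2^2 w.  The energy of 1/A and 1/B is
    therefore at most the number I of incidences between U x U and the |B|^2
    lines indexed by the pairs (y1, y2), up to 2|A||B| degenerate coincidences
    ([energy_le_incidences]), and it remains to bound I.

    Suppose that I is large.  By convexity there are two columns t0, t1 such that
    many lines, each meeting U x U often, pass through U in both columns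
    ([two_rich_columns]).  Such a line is recorded by its values (p, q) there; in
    the column t its value is (p + z q)/(1 + z) with z = (t - t0)/(t1 - t).  So for
    many z there is a dense graph of pairs (p, q) in U x U along which p + z q
    takes at most n values.  The method of Balog-Szemeredi-Gowers turns such a
    graph into sets with a small sumset.  Here one pair of sets P, Q has to serve
    all z: P and Q are neighbourhoods in the graph of the lines which also meet U
    in one further column ([exists_neighbourhoods]), and a mean value argument
    shows that |P' + z Q'| is small for many z, where P' and Q' are almost all of
    P and Q and may depend on z ([popular_multipliers], [card_sumset_dilate]).

    Next comes a sum-product pivot.  Dividing by one of the parameters z1, put
    X = {z/z1} and Y = z1 Q; then P + x Y is small for all x in X.  Let R be the
    set of ratios (x1 - x2)/(x3 - x4) in X.  If R is not a field, some r + 1 or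
    x r with r in R and x in X lies outside of R; a linear form with such a slope
    is injective on X x X, so it yields |X|^2 different multipliers w, and for one
    of them Y + w Y is nearly as large as |Y|^2.  If R is a field G, the same is
    true for a w in G, with |Y|^2 replaced by min(|Y|^2, |G|).  In both cases w is
    a short expression in elements of X and Plunnecke's inequality bounds Y + w Y
    from above ([pivot]).

    If G is the whole field, this gives the term with a negative power of q.
    Suppose that G is a proper subfield.  If z1 is in G, then the columns t lie
    in t0 + (t1 - t0) G, and the hypothesis on the affine copies of subfields
    applies.  If not, the columns lie on a projective line over G which misses the
    point at infinity; then three values of a line and one of the parameters
    determine the other two parameters and the line, so that there are few lines
    unless |G| is nearly n^2 ([few_lines_off_affine]).

    The outcome ([incidence_bound]) is I^280 << |B|^382 n^457 or
    q I^97 << |B|^132 n^160, or else an affine copy of a proper subfield meets U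
    in a large set.  As |B| and n are at most |A + B|, which is at most q, these
    bounds imply the energy estimate.  The growth estimates follow from it by the
    Cauchy-Schwarz inequality.  For the last statement, either A + B is already
    large, or the assumption on |A| makes the subfield condition hold with the
    constant 1, trivially in each case ([gap_dichotomy]). *)

(** * Double counting and Cauchy-Schwarz *)

Lemma sum_card_swap (S T : finType) (A : {set S}) (B : {set T}) (r : S -> T -> bool) :
  (\sum_(x in A) #|[set y in B | r x y]| = \sum_(y in B) #|[set x in A | r x y]|)%N.
Proof.
under eq_bigr do rewrite -sum1dep_card big_mkcondr.
rewrite exchange_big /=; apply: eq_bigr => y _.
by rewrite -sum1dep_card big_mkcondr.
Qed.

Lemma card_pairs (S T : finType) (r : S -> T -> bool) :
  (#|[set xy : S * T | r xy.1 xy.2]| = \sum_(x : S) #|[set y | r x y]|)%N.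
Proof.
rewrite -sum1dep_card -(pair_big_dep predT r (fun _ _ => 1%N)) /=.
by apply: eq_bigr => x _; rewrite sum1dep_card.
Qed.

Lemma card_fibres (S T : finType) (A : {set S}) (f : S -> T) :
  (#|A| = \sum_(y : T) #|[set x in A | f x == y]|)%N.
Proof.
rewrite -sum1_card (partition_big f predT) //=; apply: eq_bigr => y _.
by rewrite sum1dep_card.
Qed.

Lemma sum_sqr_le (S : finType) (A : {set S}) (m : S -> nat) :
  ((\sum_(i in A) m i) ^ 2 <= #|A| * \sum_(i in A) m i ^ 2)%N.
Proof.
rewrite -(leq_pmul2l (isT : 0 < 2)%N) expnS expn1 big_distrlr /=.
have -> : (2 * (#|A| * \sum_(i in A) m i ^ 2) =
   \sum_(i in A) \sum_(j in A) (m i ^ 2 + m j ^ 2))%N.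
  under [RHS]eq_bigr do rewrite big_split /= sum_nat_const.
  rewrite big_split /= sum_nat_const -big_distrr /=; lia.
rewrite big_distrr /=; apply: leq_sum => i _.
rewrite big_distrr /=; apply: leq_sum => j _.
exact: (nat_Cauchy (m i) (m j)).
Qed.

(** The sum of the squares of the fibre sizes counts the collisions of f. *)
Lemma card_sqr_le_collisions (S T : finType) (f : S -> T) (A : {set S}) :
  (#|A| ^ 2 <= #|f @: A| *
     #|[set xy : S * S | [&& xy.1 \in A, xy.2 \in A & f xy.1 == f xy.2]]|)%N.
Proof.
have -> : #|A| = (\sum_(y in f @: A) #|[set x in A | f x == y]|)%N.
  rewrite -sum1_card (partition_big f (mem (f @: A))) /=; last first.
    by move=> x xA; apply: imset_f.
  by apply: eq_bigr => y _; rewrite sum1dep_card.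
apply: leq_trans (sum_sqr_le _ _) _; rewrite leq_mul2l; apply/orP; right.
rewrite (card_pairs (fun x y => [&& x \in A, y \in A & f x == f y])).
have -> : (\sum_x #|[set y | [&& x \in A, y \in A & f x == f y]]| =
  \sum_(x in A) #|[set y in A | f y == f x]|)%N.
  rewrite [RHS]big_mkcond; apply: eq_bigr => x _.
  case: (x \in A) => /=; last first.
    by apply: eq_card0 => y; rewrite inE.
  by apply: eq_card => y; rewrite !inE eq_sym.
rewrite [leqRHS](partition_big f (mem (f @: A))) /=; last first.
  by move=> x xA; apply: imset_f.
apply: leq_sum => y _.
rewrite (eq_bigr (fun=> #|[set x in A | f x == y]|)); last first.
  by move=> x /andP[_ /eqP->].
rewrite sum_nat_cond_const /= expnS expn1.
by rewrite leq_mul2r; apply/orP; right; apply: eq_leq; apply: eq_card => x; rewrite !inE.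
Qed.

(** * Sumsets: the triangle inequality and Plunnecke's inequality *)

Definition dilate (F : finFieldType) (c : F) (Y : {set F}) : {set F} :=
  [set c * y | y in Y].

Definition diffset (F : finFieldType) (X Y : {set F}) : {set F} :=
  [set x - y | x in X, y in Y].

Definition nfold_sum (F : finFieldType) (k : nat) (B : {set F}) : {set F} :=
  iter k (sumset B) [set 0].

Section Sumsets.
Variable F : finFieldType.
Implicit Types A B C P X Y : {set F}.

Lemma mem_sumset A B a b : a \in A -> b \in B -> a + b \in sumset A B.
Proof. exact: imset2_f. Qed.

Lemma mem_diffset A B a b : a \in A -> b \in B -> a - b \in diffset A B.
Proof. exact: imset2_f. Qed.

Lemma mem_dilate c A a : a \in A -> c * a \in dilate c A.
Proof. exact: imset_f. Qed.

Lemma sumsetS A B A' B' : A \subset A' -> B \subset B' ->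
  sumset A B \subset sumset A' B'.
Proof. exact: imset2S. Qed.

Lemma card_translate c A : #|[set a + c | a in A]| = #|A|.
Proof. by apply: card_imset => x y /addIr. Qed.

Lemma card_dilate c A : c != 0 -> #|dilate c A| = #|A|.
Proof. by move=> c0; apply: card_imset; apply: mulfI. Qed.

Lemma card_sumset_ge A B : B != set0 -> (#|A| <= #|sumset A B|)%N.
Proof.
move=> /set0Pn[b bB]; rewrite -(card_translate b A); apply: subset_leq_card.
by apply/subsetP=> _ /imsetP[a aA ->]; apply: mem_sumset.
Qed.

(** For a difference a - b with a chosen representation and for c in C, the pair
    (a + c, c + b) determines first the difference, hence a and b, and then c. *)
Lemma ruzsa_triangle A B C :
  (#|diffset A B| * #|C| <= #|sumset A C| * #|sumset C B|)%N.
Proof.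
pose rep d := odflt (0, 0) [pick u : F * F | [&& u.1 \in A, u.2 \in B & u.1 - u.2 == d]].
have repP d : d \in diffset A B ->
    [/\ (rep d).1 \in A, (rep d).2 \in B & (rep d).1 - (rep d).2 = d].
  move=> /imset2P[a b aA bB ->]; rewrite /rep; case: pickP => [u /and3P[? ? /eqP]//|].
  by move=> /(_ (a, b)) /=; rewrite aA bB eqxx.
pose f (w : F * F) := ((rep w.1).1 + w.2, w.2 + (rep w.1).2).
rewrite -!cardsX -(@card_in_imset _ _ f (setX (diffset A B) C)).
  apply: subset_leq_card; apply/subsetP=> _ /imsetP[[d c] /setXP[/repP[r1 r2 _] cC] ->].
  by rewrite !inE /=; apply/andP; split; apply: mem_sumset.
move=> [d c] [d' c'] /setXP[/repP[_ _ e1] _] /setXP[/repP[_ _ e2] _] [].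
rewrite /= => h1 h2; have ed : d = d'.
  have E x y : x - y = (x + c) - (c + y) by ring.
  by rewrite -e1 -e2 E h1 h2; ring.
by rewrite -ed in h1 *; move/addrI: h1 => ->.
Qed.

(** [ruzsa_triangle] for - C in place of C. *)
Lemma ruzsa_triangle_diff A B C :
  (#|diffset A B| * #|C| <= #|diffset A C| * #|diffset C B|)%N.
Proof.
pose N X := [set - x | x in X].
have sN X Y : sumset X (N Y) = diffset X Y.
  apply/setP=> z; apply/imset2P/imset2P => [[x _ xX /imsetP[y yY ->] ->]|[x y xX yY ->]].
    by exists x y.
  by exists x (- y) => //; apply: imset_f.
have NN X : N (N X) = X.
  by rewrite /N -imset_comp -[RHS]imset_id; apply: eq_imset => x /=; rewrite opprK.
have cN X : #|N X| = #|X| by apply: card_imset; apply: oppr_inj.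
have h := ruzsa_triangle A B (N C); rewrite cN sN in h.
apply: leq_trans h _; rewrite leq_mul2l; apply/orP; right.
rewrite -(cN (sumset _ _)); apply: eq_leq; congr #|pred_of_set _|.
apply/setP=> z; apply/imsetP/imset2P.
  by case=> _ /imset2P[_ b /imsetP[c cC ->] bB ->] ->; exists c b => //; rewrite opprD opprK.
case=> c b cC bB ->; exists (- c + b); last by rewrite opprD opprK.
by apply: mem_sumset => //; apply: imset_f.
Qed.

(** Petridis' lemma, by induction on C.  When c is added to C, let Z collect the p for
    which p + B + c is already covered: Z + B + c adds nothing new, and the hypothesis
    bounds |Z + B| from below. *)
Lemma petridis P B C :
  (forall Z : {set F}, Z \subset P ->
     (#|sumset P B| * #|Z| <= #|sumset Z B| * #|P|)%N) ->
  (#|sumset (sumset P B) C| * #|P| <= #|sumset P B| * #|sumset P C|)%N.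
Proof.
move=> minP; have [m] := ubnP #|C|; elim: m C => // m IH C leC.
have [->|/set0Pn[c cC]] := eqVneq C set0.
  suff -> : sumset (sumset P B) set0 = set0 by rewrite cards0.
  by apply/setP=> z; rewrite inE; apply/negP=> /imset2P[? ? _]; rewrite inE.
set C' := C :\ c.
set S := sumset (sumset P B) C'; set S1 := sumset P C'.
pose Z := [set p in P | [set x + c | x in sumset [set p] B] \subset S].
have ZP : Z \subset P by apply/subsetP=> p; rewrite inE => /andP[].
have minZ := minP _ ZP.
have h1 : (#|sumset (sumset P B) C| + #|sumset Z B| <= #|S| + #|sumset P B|)%N.
  have sub : sumset Z B \subset sumset P B by apply: sumsetS.
  rewrite -(cardsID (sumset Z B) (sumset P B)) (setIidPr sub).
  rewrite -(card_translate c (_ :\: _)) addnCA addnC leq_add2l.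
  apply: leq_trans (leq_card_setU _ _); apply: subset_leq_card.
  apply/subsetP=> _ /imset2P[s c' sS c'C ->]; rewrite inE.
  have [-> {c' c'C}|nc] := eqVneq c' c; last first.
    by rewrite mem_sumset // in_setD1 nc.
  have [sZ|nsZ] := boolP (s \in sumset Z B); last first.
    by apply/orP; right; apply: imset_f; rewrite inE nsZ.
  apply/orP; left; case/imset2P: sZ => p b; rewrite inE => /andP[_ /subsetP sub1] bB ->.
  by apply: sub1; apply: imset_f; apply: mem_sumset; rewrite ?set11.
have h2 : (#|S1| + #|P| <= #|sumset P C| + #|Z|)%N.
  rewrite -(cardsID Z P) (setIidPr ZP) addnCA addnC leq_add2r.
  rewrite -(card_translate c (_ :\: _)) -cardsUI.
  have -> : S1 :&: [set x + c | x in P :\: Z] = set0.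
    apply/setP=> z; rewrite !inE; apply/negP=> /andP[zS /imsetP[p]].
    rewrite inE => /andP[npZ pP] ez; case/negP: npZ; rewrite inE pP /=.
    apply/subsetP=> _ /imsetP[_ /imset2P[_ b /set1P-> bB ->] ->].
    rewrite -addrA [b + c]addrC addrA -ez; move: zS => /imset2P[p1 c1 p1P c1C ->].
    by rewrite addrAC; apply: mem_sumset => //; apply: mem_sumset.
  rewrite cards0 addn0; apply: subset_leq_card; apply/subsetP=> z; rewrite inE.
  case/orP => [|/imsetP[p]]; first by apply/subsetP/sumsetS => //; apply: subD1set.
  by rewrite inE => /andP[_ pP] ->; apply: mem_sumset.
have: (#|S| * #|P| <= #|sumset P B| * #|S1|)%N.
  by apply: IH; move: leC; rewrite (cardsD1 c C) cC.
nia.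
Qed.

Lemma sumsetC A B : sumset A B = sumset B A.
Proof.
by apply/setP=> z; apply/imset2P/imset2P => -[x y ? ? ->]; exists y x; rewrite // addrC.
Qed.

Lemma sumsetA A B C : sumset A (sumset B C) = sumset (sumset A B) C.
Proof.
apply/setP=> z; apply/imset2P/imset2P.
  case=> a _ aA /imset2P[b c bB cC ->] ->.
  by exists (a + b) c; rewrite ?mem_sumset // addrA.
case=> _ c /imset2P[a b aA bB ->] cC ->.
by exists a (b + c); rewrite ?mem_sumset // addrA.
Qed.

Lemma sumset0r A : sumset A [set 0] = A.
Proof.
apply/setP=> z; apply/imset2P/idP => [[a b aA /set1P-> ->]|zA]; first by rewrite addr0.
by exists z 0; rewrite ?set11 ?addr0.
Qed.

Lemma nfold_sumS k B : nfold_sum k.+1 B = sumset B (nfold_sum k B).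
Proof. by []. Qed.

Lemma petridis_minimizer P B : P != set0 ->
  exists Z : {set F}, [/\ Z \subset P, Z != set0,
    (#|sumset Z B| * #|P| <= #|sumset P B| * #|Z|)%N &
    forall W : {set F}, W \subset Z -> (#|sumset Z B| * #|W| <= #|sumset W B| * #|Z|)%N].
Proof.
move=> P0; pose r (Z : {set F}) : rat := #|sumset Z B|%:R / #|Z|%:R.
pose ok (Z : {set F}) := (Z \subset P) && (Z != set0).
have okP : ok P by rewrite /ok subxx.
case: (@arg_minP _ _ _ P ok r okP) => Z /andP[ZP Z0] minZ.
have pos (W : {set F}) : W != set0 -> (0 : rat) < #|W|%:R by rewrite ltr0n card_gt0.
have cross (W : {set F}) : W != set0 -> r Z <= r W ->
    (#|sumset Z B| * #|W| <= #|sumset W B| * #|Z|)%N.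
  move=> W0; rewrite /r ler_pdivrMr ?pos // mulrAC ler_pdivlMr ?pos //.
  by rewrite -!natrM ler_nat.
exists Z; split=> //; first exact: cross (minZ _ okP).
move=> W WZ; have [->|W0] := eqVneq W set0; first by rewrite cards0 muln0.
apply: cross => //; apply: minZ; apply/andP; split=> //; exact: subset_trans WZ ZP.
Qed.

(** The same Z serves every k.  This allows two sums of different length to be
    compared through Z in the next lemma. *)
Lemma plunnecke P B : P != set0 ->
  exists Z : {set F}, [/\ Z \subset P, Z != set0 & forall k,
    (#|sumset Z (nfold_sum k B)| * #|P| ^ k <= #|sumset P B| ^ k * #|Z|)%N].
Proof.
move=> P0; have [Z [ZP Z0 hP minZ]] := petridis_minimizer B P0.
exists Z; split=> //; elim=> [|k IH]; first by rewrite sumset0r !expn0 muln1 mul1n.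
have := petridis (nfold_sum k B) minZ.
rewrite -sumsetA -nfold_sumS => h.
rewrite -(@leq_pmul2r #|Z|) ?card_gt0 // !expnS.
move: h IH hP; set a := #|sumset Z _|; set b := #|sumset Z _|; set c := #|sumset Z _|.
move=> h IH hP.
have h1 := leq_mul h (leqnn (#|P| * #|P| ^ k)).
have h2 := leq_mul hP IH; lia.
Qed.

Lemma card_nfold_diff i j P B : P != set0 ->
  (#|diffset (nfold_sum i B) (nfold_sum j B)| * #|P| ^ (i + j)
     <= #|sumset P B| ^ (i + j) * #|P|)%N.
Proof.
move=> P0; have [Z [ZP Z0 hZ]] := plunnecke B P0.
have := ruzsa_triangle (nfold_sum i B) (nfold_sum j B) Z.
rewrite [sumset _ Z]sumsetC => h.
have cZ : (0 < #|Z|)%N by rewrite card_gt0.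
have h1 := leq_mul (hZ i) (hZ j).
have h2 := leq_mul h (leqnn (#|P| ^ i * #|P| ^ j)).
have h3 := leq_mul (leqnn (#|sumset P B| ^ (i + j))) (subset_leq_card ZP).
apply: leq_trans h3; rewrite -(@leq_pmul2r #|Z|) // !expnD.
lia.
Qed.
End Sumsets.

(** * Ratios of differences and subfields *)

Definition ratio_set (F : finFieldType) (X : {set F}) : {set F} :=
  [set u / v | u in diffset X X, v in diffset X X :\ 0].

Section Ratios.
Variable F : finFieldType.
Implicit Types X S : {set F}.

(** A stable finite set is permuted by the dilation. *)
Lemma dilate_stable_inv a S : a != 0 -> (forall s, s \in S -> a * s \in S) ->
  forall s, s \in S -> a^-1 * s \in S.
Proof.
move=> a0 aS s sS; have e : dilate a S = S.
  apply/eqP; rewrite eqEcard card_dilate // leqnn andbT.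
  by apply/subsetP=> _ /imsetP[x xS ->]; apply: aS.
by move: sS; rewrite -{1}e => /imsetP[x xS ->]; rewrite mulKf.
Qed.

Lemma translate_stable_opp a S : (forall s, s \in S -> s + a \in S) ->
  forall s, s \in S -> s - a \in S.
Proof.
move=> aS s sS; have e : [set x + a | x in S] = S.
  apply/eqP; rewrite eqEcard card_translate leqnn andbT.
  by apply/subsetP=> _ /imsetP[x xS ->]; apply: aS.
by move: sS; rewrite -{1}e => /imsetP[x xS ->]; rewrite addrK.
Qed.

(** Let S consist of the s with R + s contained in R, and A of the a with a S
    contained in S.  Finiteness makes S a group and A a field.  The two closure
    hypotheses give 1 in S and X in A, so A is contained in S, hence in R, while
    every ratio of differences of elements of X belongs to the field A. *)
Lemma ratio_set_field X : 0 \in X -> 1 \in X ->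
  (forall r, r \in ratio_set X -> r + 1 \in ratio_set X) ->
  (forall x r, x \in X -> r \in ratio_set X -> x * r \in ratio_set X) ->
  GRing.divring_closed (ratio_set X) /\ X \subset ratio_set X.
Proof.
move=> X0 X1; set R := ratio_set X => Radd Rmul.
have D1 : (1 : F) \in diffset X X :\ 0.
  by rewrite !inE oner_neq0 -[1 in X in X \in _]subr0 mem_diffset.
have XR x : x \in X -> x \in R.
  move=> xX; rewrite -[x]divr1; apply: imset2_f => //.
  by rewrite -[x]subr0 mem_diffset.
pose S := [set s | [forall r in R, r + s \in R]].
have SP s : reflect (forall r, r \in R -> r + s \in R) (s \in S).
  by rewrite inE; apply: (iffP forall_inP).
pose A := [set a | [forall s in S, a * s \in S]].
have AP a : reflect (forall s, s \in S -> a * s \in S) (a \in A).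
  by rewrite inE; apply: (iffP forall_inP).
have S0 : 0 \in S by apply/SP=> r; rewrite addr0.
have SB s t : s \in S -> t \in S -> s - t \in S.
  move=> /SP sS /SP tS; apply/SP=> r rR; rewrite addrA.
  by apply: translate_stable_opp (sS _ rR).
have XA x : x \in X -> x \in A.
  move=> xX; apply/AP=> s /SP sS; have [->|x0] := eqVneq x 0; first by rewrite mul0r.
  apply/SP=> r rR; rewrite -[r](mulVKf x0) -mulrDr.
  apply: (Rmul _ _ xX); apply: sS.
  by apply: dilate_stable_inv rR => // y; apply: Rmul.
have AB a b : a \in A -> b \in A -> a - b \in A.
  move=> /AP aA /AP bA; apply/AP=> s sS; rewrite mulrBl.
  by apply: SB; [apply: aA | apply: bA].
have AV a : a \in A -> a^-1 \in A.
  have [->|a0] := eqVneq a 0; first by rewrite invr0.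
  by move=> /AP aA; apply/AP; apply: dilate_stable_inv.
have AM a b : a \in A -> b \in A -> a * b \in A.
  by move=> /AP aA /AP bA; apply/AP=> s sS; rewrite -mulrA; apply: aA; apply: bA.
have AR : A = R.
  apply/eqP; rewrite eqEsubset; apply/andP; split; apply/subsetP=> a.
    move=> /AP aA; have /SP/(_ 0 (XR _ X0)) : a * 1 \in S.
      by apply: aA; apply/SP.
    by rewrite add0r mulr1.
  move=> /imset2P[u v /imset2P[x1 x2 x1X x2X ->]].
  rewrite in_setD1 => /andP[_ /imset2P[x3 x4 x3X x4X ->]] ->.
  by apply: AM; [|apply: AV]; apply: AB; apply: XA.
split; last by apply/subsetP.
rewrite -AR; split; first by rewrite XA.
- by move=> a b; apply: AB.
- by move=> a b aA bA; apply: AM => //; apply: AV.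
Qed.

Lemma ratio_setP X r : r \in ratio_set X -> exists x1 x2 x3 x4,
  [/\ [/\ x1 \in X, x2 \in X, x3 \in X & x4 \in X], x3 != x4 &
      r = (x1 - x2) / (x3 - x4)].
Proof.
move=> /imset2P[_ v /imset2P[x1 x2 x1X x2X ->]].
rewrite in_setD1 => /andP[v0 /imset2P[x3 x4 x3X x4X ev]] ->.
by exists x1, x2, x3, x4; rewrite -ev -subr_eq0 -ev.
Qed.

(** Otherwise two coinciding values would exhibit the slope u / v as a ratio of
    differences. *)
Lemma linear_form_inj X u v : v != 0 -> u / v \notin ratio_set X ->
  {in setX X X &, injective (fun w : F * F => w.1 * v + w.2 * u)}.
Proof.
move=> v0 nR [x y] [x' y'] /setXP[xX yX] /setXP[x'X y'X] /= e.
have [ey|ny] := eqVneq y y'.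
  by rewrite ey in e *; move/addIr: e => /(mulIf v0) ->.
case/negP: nR; have -> : u / v = (x - x') / (y' - y).
  have d0 : y' - y != 0 by rewrite subr_eq0 eq_sym.
  apply/eqP; rewrite eqr_div // -subr_eq0.
  have -> : u * (y' - y) - (x - x') * v = (x' * v + y' * u) - (x * v + y * u) by ring.
  by rewrite e subrr.
apply: imset2_f; first exact: mem_diffset.
by rewrite in_setD1 subr_eq0 eq_sym ny mem_diffset.
Qed.

End Ratios.

(** * Additive energy of a set and its dilates *)

Definition quads (F : finFieldType) (Y : {set F}) : {set (F * F) * (F * F)} :=
  setX (setX Y Y) (setX Y Y).

Definition dilate_energy (F : finFieldType) (w : F) (Y : {set F}) : nat :=
  #|[set t in quads Y | t.1.1 - t.1.2 == w * (t.2.1 - t.2.2)]|.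

(** Each quadruple counted here determines w, unlike the diagonal ones. *)
Definition proper_energy (F : finFieldType) (w : F) (Y : {set F}) : nat :=
  #|[set t in quads Y | (t.2.1 != t.2.2) &&
                        (t.1.1 - t.1.2 == w * (t.2.1 - t.2.2))]|.

Section Energies.
Variable F : finFieldType.
Implicit Types (Y : {set F}) (w : F).

Lemma card_quads Y : #|quads Y| = (#|Y| ^ 4)%N.
Proof. by rewrite !cardsX !expnS expn0 muln1 !mulnA. Qed.

Lemma quadsS Y Y' : Y \subset Y' -> quads Y \subset quads Y'.
Proof. by move=> s; rewrite /quads !setXS. Qed.

Lemma proper_energyS w Y Y' : Y \subset Y' ->
  (proper_energy w Y <= proper_energy w Y')%N.
Proof.
move=> s; apply: subset_leq_card; apply/subsetP=> t.
by rewrite !inE => /andP[h ->]; rewrite andbT; move: t h => t h;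
  have := subsetP (quadsS s) t; rewrite !inE; apply.
Qed.

Lemma dilate_energy_split w Y :
  (dilate_energy w Y <= #|Y| ^ 2 + proper_energy w Y)%N.
Proof.
pose h (u : F * F) := ((u.1, u.1), (u.2, u.2)).
have ch : #|h @: setX Y Y| = (#|Y| ^ 2)%N.
  by rewrite card_imset ?cardsX ?mulnn // => -[a b] [c d] [-> _ -> _].
rewrite -ch; apply: leq_trans (leq_card_setU _ _); apply: subset_leq_card.
apply/subsetP=> -[[a b] [c d]]; rewrite !inE /= => /andP[/andP[/andP[aY bY] /andP[cY dY]] /eqP e].
rewrite aY bY cY dY /=; have [ecd|] := eqVneq c d; last by rewrite e eqxx orbT.
move: e; rewrite ecd subrr mulr0 => /subr0_eq eab; rewrite orbF.
apply/imsetP; exists (b, d); last by rewrite /h /= eab.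
by rewrite inE /= bY dY.
Qed.

(** A quadruple is proper for at most one value of the multiplier, so the proper
    energies of different multipliers add up to at most |Y|^4. *)
Lemma low_proper_energy (T : finType) (I : {set T}) (f : T -> F) Y :
  I != set0 -> {in I &, injective f} ->
  exists2 i, i \in I & (proper_energy (f i) Y * #|I| <= #|Y| ^ 4)%N.
Proof.
move=> I0 f_inj; apply/exists_inP; apply: contraT; rewrite negb_exists_in => /forall_inP h.
have: (\sum_(i in I) #|Y| ^ 4 < \sum_(i in I) proper_energy (f i) Y * #|I|)%N.
  have /set0Pn[i0 iI] := I0.
  rewrite (bigD1 i0) //= [X in (_ < X)%N](bigD1 i0) //=.
  rewrite -addSn leq_add //; first by rewrite ltnNge h.
  by apply: leq_sum => i /andP[iI' _]; apply: ltnW; rewrite ltnNge h.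
rewrite sum_nat_const -big_distrl /= mulnC ltn_pmul2r ?card_gt0 // ltnNge => /negP[].
rewrite (sum_card_swap I (quads Y)) -card_quads -sum1_card; apply: leq_sum => t _.
have [e|ne] := eqVneq t.2.1 t.2.2; first by rewrite eq_card0 // => i; rewrite !inE andbF.
set D := [set i in I | _].
have f_injD : {in D &, injective f}.
  move=> i j iD jD; apply: f_inj; first by case/setIdP: iD.
  by case/setIdP: jD.
rewrite -(card_in_imset f_injD) -(cards1 ((t.1.1 - t.1.2) / (t.2.1 - t.2.2))).
apply: subset_leq_card; apply/subsetP=> _ /imsetP[i /setIdP[_ /andP[_ /eqP e]] ->].
by rewrite inE e mulfK // subr_eq0.
Qed.

Lemma dilate_sum_lower w Y :
  (#|Y| ^ 4 <= #|sumset Y (dilate w Y)| * dilate_energy w Y)%N.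
Proof.
pose f (u : F * F) := u.1 + w * u.2.
have := card_sqr_le_collisions f (setX Y Y).
rewrite cardsX mulnn -expnM => /leq_trans; apply; apply: leq_mul.
  apply: subset_leq_card.
  by apply/subsetP=> _ /imsetP[[a b] /setXP[aY bY] ->]; rewrite mem_sumset // mem_dilate.
pose g (x : (F * F) * (F * F)) := ((x.1.1, x.2.1), (x.2.2, x.1.2)).
rewrite -(@card_imset _ _ g); last by move=> [[a b] [c d]] [[a' b'] [c' d']] [-> -> -> ->].
apply: subset_leq_card; apply/subsetP=> _ /imsetP[[[a b] [c d]] h ->].
move: h; rewrite !inE /= => /and3P[/andP[aY bY] /andP[cY dY] /eqP e].
rewrite aY bY cY dY /=; apply/eqP.
have -> : a - c = (a + w * b) - c - w * b by ring.
by move: e; rewrite /f /= => ->; ring.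
Qed.

(** Cauchy-Schwarz for the map (y0, y, y2, y3) |-> (al y - y2, be y - y3,
    y0 + la y2 + mu y3): a collision forces a coincidence of y0 + w y with
    w = la al + mu be, and y2, y3 are then free.  This replaces w y by sums of
    la Y and mu Y at the price of covering al Y and be Y by translates of Y, which
    is cheaper than applying Plunnecke's inequality to products of multipliers. *)
Lemma covered_sum_lower al be la mu Y :
  (#|Y| ^ 8 <= #|diffset (dilate al Y) Y| * #|diffset (dilate be Y) Y| *
     #|sumset (sumset Y (dilate la Y)) (dilate mu Y)| *
     (#|Y| ^ 2 * dilate_energy (la * al + mu * be)%R Y))%N.
Proof.
pose f (u : (F * F) * (F * F)) :=
  (al * u.1.2 - u.2.1, be * u.1.2 - u.2.2, u.1.1 + la * u.2.1 + mu * u.2.2).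
have := card_sqr_le_collisions f (quads Y).
rewrite card_quads -expnM => /leq_trans; apply; apply: leq_mul.
  rewrite -!cardsX; apply: subset_leq_card.
  apply/subsetP=> _ /imsetP[[[a b] [c d]] /setXP[/setXP[aY bY] /setXP[cY dY]] ->] /=.
  by rewrite !inE /= !(mem_diffset, mem_sumset) ?mem_dilate.
pose g (x : ((F * F) * (F * F)) * ((F * F) * (F * F))) :=
  (x.1.2, ((x.1.1.1, x.2.1.1), (x.2.1.2, x.1.1.2))).
rewrite -mulnn -cardsX -cardsX -(@card_in_imset _ _ g).
  apply: subset_leq_card; apply/subsetP=> _ /imsetP[[[[a b] [c d]] [[a' b'] [c' d']]] h ->].
  move: h; rewrite !inE /= => /and3P[/andP[/andP[aY bY] /andP[cY dY]]].
  move=> /andP[/andP[a'Y b'Y] /andP[c'Y d'Y]] /eqP[e1 e2 e3].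
  rewrite aY bY cY dY a'Y b'Y /=; apply/eqP.
  have ec : c = al * b - al * b' + c' by rewrite -[LHS](subKr (al * b)) e1; ring.
  have ed : d = be * b - be * b' + d' by rewrite -[LHS](subKr (be * b)) e2; ring.
  have -> : a - a' = (a + la * c + mu * d) - a' - la * c - mu * d by ring.
  by rewrite e3 ec ed; ring.
move=> [[[a b] [c d]] [[a' b'] [c' d']]] [[[x y] [z t]] [[x' y'] [z' t']]].
rewrite !inE /= => /and3P[_ _ /eqP[e1 e2 e3]] /and3P[_ _ /eqP[h1 h2 h3]].
move=> [ec ed ea ea' eb' eb]; move: h1 h2 h3 e1 e2.
rewrite -ec -ed -ea -ea' -eb' -eb => h1 h2 _.
by rewrite h1 h2 => /addrI/oppr_inj -> /addrI/oppr_inj ->.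
Qed.

End Energies.

(** * The pivot *)

(** The sizes P, Y and |X|^2 appear as a, b and x2, those of the parts common to
    the relations in use as p and y. *)
Lemma pivot_add_size (c a b p y x2 Pe E D1 D2 N M : nat) :
  (0 < p)%N -> (0 < y)%N -> (a <= 2 * p)%N -> (b <= 2 * y)%N ->
  (y ^ 8 <= D1 * D2 * N * (y ^ 2 * E))%N -> (E <= y ^ 2 + Pe)%N ->
  (Pe * x2 <= b ^ 4)%N -> (D1 * p <= M ^ 2)%N -> (D2 * p <= M ^ 2)%N ->
  (N * p ^ 7 <= c * M ^ 7 * p)%N ->
  (a ^ 8 * b ^ 4 * x2 <= 2 ^ 14 * c * (M ^ 11 * (x2 + b ^ 2)))%N.
Proof.
move=> p0 y0 ap by2 H0 HE HP HD1 HD2 HN.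
have hb := leq_mul (leq_mul by2 by2) (leqnn (b ^ 2)).
have h1 : (y ^ 2 * E * x2 <= 4 * y ^ 4 * (x2 + b ^ 2))%N.
  have := leq_mul (leqnn (y ^ 2)) (leq_mul HE (leqnn x2)).
  have := leq_mul (leqnn (y ^ 2)) HP.
  have := leq_mul (leqnn (y ^ 2)) hb.
  lia.
have h2 := leq_mul (leq_mul (leq_mul HD1 HD2) HN) h1.
have h3 := leq_mul H0 (leqnn (p ^ 9 * x2)).
have h4 : (y ^ 8 * p ^ 9 * x2 <= 4 * c * (M ^ 11 * (x2 + b ^ 2)) * (p * y ^ 4))%N.
  apply: leq_trans (leq_trans _ h2) _; last by apply: eq_leq; ring.
  by apply: leq_trans (leq_trans _ h3) _; apply: eq_leq; ring.
have h5 : (y ^ 4 * p ^ 8 * x2 <= 4 * c * (M ^ 11 * (x2 + b ^ 2)))%N.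
  rewrite -(@leq_pmul2r (p * y ^ 4)%N) ?muln_gt0 ?expn_gt0 ?p0 ?y0 //.
  by apply: leq_trans h4; apply: eq_leq; ring.
have ha : (a ^ 8 <= (2 * p) ^ 8)%N by rewrite leq_exp2r.
have hb4 : (b ^ 4 <= (2 * y) ^ 4)%N by rewrite leq_exp2r.
apply: leq_trans (leq_mul (leq_mul ha hb4) (leqnn x2)) _.
apply: (@leq_trans (2 ^ 12 * (y ^ 4 * p ^ 8 * x2))%N).
  by rewrite !expnMn; apply: eq_leq; ring.
apply: leq_trans (leq_mul (leqnn _) h5) _.
by rewrite (expnD 2 12 2); apply: eq_leq; ring.
Qed.

Lemma pivot_mul_size (c a b p y x2 Pe E D1 D2 N M : nat) :
  (0 < p)%N -> (0 < y)%N -> (a <= 2 * p)%N -> (b <= 2 * y)%N ->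
  (y ^ 8 <= D1 * D2 * N * (y ^ 2 * E))%N -> (E <= y ^ 2 + Pe)%N ->
  (Pe * x2 <= b ^ 4)%N -> (D1 * p <= M ^ 2)%N -> (D2 * y * p ^ 2 <= M ^ 4)%N ->
  (N * p ^ 5 <= c * M ^ 5 * p)%N ->
  (a ^ 7 * b ^ 5 * x2 <= 2 ^ 14 * c * (M ^ 11 * (x2 + b ^ 2)))%N.
Proof.
move=> p0 y0 ap by2 H0 HE HP HD1 HD2 HN.
have hb := leq_mul (leq_mul by2 by2) (leqnn (b ^ 2)).
have h1 : (y ^ 2 * E * x2 <= 4 * y ^ 4 * (x2 + b ^ 2))%N.
  have := leq_mul (leqnn (y ^ 2)) (leq_mul HE (leqnn x2)).
  have := leq_mul (leqnn (y ^ 2)) HP.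
  have := leq_mul (leqnn (y ^ 2)) hb.
  lia.
have h2 := leq_mul (leq_mul (leq_mul HD1 HD2) HN) h1.
have h3 := leq_mul H0 (leqnn (y * p ^ 8 * x2)).
have h4 : (y ^ 9 * p ^ 8 * x2 <= 4 * c * (M ^ 11 * (x2 + b ^ 2)) * (p * y ^ 4))%N.
  apply: leq_trans (leq_trans _ h2) _; last by apply: eq_leq; ring.
  by apply: leq_trans (leq_trans _ h3) _; apply: eq_leq; ring.
have h5 : (y ^ 5 * p ^ 7 * x2 <= 4 * c * (M ^ 11 * (x2 + b ^ 2)))%N.
  rewrite -(@leq_pmul2r (p * y ^ 4)%N) ?muln_gt0 ?expn_gt0 ?p0 ?y0 //.
  by apply: leq_trans h4; apply: eq_leq; ring.
have ha : (a ^ 7 <= (2 * p) ^ 7)%N by rewrite leq_exp2r.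
have hb4 : (b ^ 5 <= (2 * y) ^ 5)%N by rewrite leq_exp2r.
apply: leq_trans (leq_mul (leq_mul ha hb4) (leqnn x2)) _.
apply: (@leq_trans (2 ^ 12 * (y ^ 5 * p ^ 7 * x2))%N).
  by rewrite !expnMn (expnD 2 7 5); apply: eq_leq; ring.
apply: leq_trans (leq_mul (leqnn _) h5) _.
by rewrite (expnD 2 12 2); apply: eq_leq; ring.
Qed.

Lemma pivot_field_size (c a b p y g Pe E N M : nat) :
  (0 < p)%N -> (0 < y)%N -> (a <= 2 * p)%N -> (b <= 2 * y)%N ->
  (y ^ 4 <= N * E)%N -> (E <= y ^ 2 + Pe)%N ->
  (Pe * g <= b ^ 4)%N -> (N * p ^ 4 <= c * M ^ 4 * p)%N ->
  (a ^ 3 * b ^ 2 * g <= 2 ^ 7 * c * (M ^ 4 * (g + b ^ 2)))%N.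
Proof.
move=> p0 y0 ap by2 H0 HE HP HN.
have hb := leq_mul (leq_mul by2 by2) (leqnn (b ^ 2)).
have h1 : (E * g <= 4 * y ^ 2 * (g + b ^ 2))%N.
  have := leq_mul HE (leqnn g); lia.
have h2 := leq_mul HN h1.
have h3 := leq_mul H0 (leqnn (p ^ 4 * g)).
have h4 : (y ^ 4 * p ^ 4 * g <= 4 * c * (M ^ 4 * (g + b ^ 2)) * (p * y ^ 2))%N.
  apply: leq_trans (leq_trans _ h2) _; last by apply: eq_leq; ring.
  by apply: leq_trans (leq_trans _ h3) _; apply: eq_leq; ring.
have h5 : (y ^ 2 * p ^ 3 * g <= 4 * c * (M ^ 4 * (g + b ^ 2)))%N.
  rewrite -(@leq_pmul2r (p * y ^ 2)%N) ?muln_gt0 ?expn_gt0 ?p0 ?y0 //.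
  by apply: leq_trans h4; apply: eq_leq; ring.
have ha : (a ^ 3 <= (2 * p) ^ 3)%N by rewrite leq_exp2r.
have hb4 : (b ^ 2 <= (2 * y) ^ 2)%N by rewrite leq_exp2r.
apply: leq_trans (leq_mul (leq_mul ha hb4) (leqnn g)) _.
apply: (@leq_trans (2 ^ 5 * (y ^ 2 * p ^ 3 * g))%N).
  by rewrite !expnMn (expnD 2 3 2); apply: eq_leq; ring.
apply: leq_trans (leq_mul (leqnn _) h5) _.
by rewrite (expnD 2 5 2); apply: eq_leq; ring.
Qed.

Lemma half_gt0 (a b : nat) : (a <= 2 * b)%N -> (0 < a)%N -> (0 < b)%N.
Proof. by case: b => //; rewrite muln0 leqn0 => /eqP->. Qed.

Section Pivot.
Variables (F : finFieldType) (P Y X : {set F}) (Pf Yf : F -> {set F}) (M : nat).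
Hypotheses (P0 : P != set0) (Y0 : Y != set0) (X0 : 0 \in X) (X1 : 1 \in X).
Hypothesis PfP : forall x, x \in X -> (16 * #|P :\: Pf x| <= #|P|)%N.
Hypothesis YfY : forall x, x \in X -> (16 * #|Y :\: Yf x| <= #|Y|)%N.
Hypothesis PYM : forall x, x \in X -> (#|sumset (Pf x) (dilate x (Yf x))| <= M)%N.

Definition common (S : {set F}) (f : F -> {set F}) (xs : seq F) : {set F} :=
  foldr (fun x T => f x :&: T) S xs.

Lemma common_sub S f xs : common S f xs \subset S.
Proof. by elim: xs => //= x xs IH; apply: subset_trans (subsetIr _ _) IH. Qed.

Lemma common_sub_mem S f xs x : x \in xs -> common S f xs \subset f x.
Proof.
elim: xs => //= y xs IH; rewrite inE => /predU1P[->|/IH]; first exact: subsetIl.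
exact: subset_trans (subsetIr _ _).
Qed.

(** Eight exceptional sets, each of relative size 1/16, leave half of S. *)
Lemma card_common S f xs : (forall x, x \in X -> (16 * #|S :\: f x| <= #|S|)%N) ->
  {subset xs <= X} -> (size xs <= 8)%N -> (#|S| <= 2 * #|common S f xs|)%N.
Proof.
move=> hf xsX szxs.
suff: (16 * #|S :\: common S f xs| <= size xs * #|S|)%N.
  rewrite -(cardsID (common S f xs) S) (setIidPr (common_sub _ _ _)).
  move: #|_ :\: _| #|common _ _ _| => u v h.
  have := leq_mul szxs (leqnn (v + u)); lia.
elim: xs xsX {szxs} => [|x xs IH] xsX /=; first by rewrite setDv cards0.
rewrite setDIr [leqRHS]mulSn; apply: (@leq_trans (16 * (#|S :\: f x| + #|S :\: common S f xs|))%N).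
  by rewrite leq_mul2l leq_card_setU orbT.
rewrite mulnDr leq_add ?hf ?xsX ?mem_head //.
by apply: IH => y ys; apply: xsX; rewrite inE ys orbT.
Qed.

Section CommonPart.
Variable xs : seq F.
Hypotheses (xsX : {subset xs <= X}) (szxs : (size xs <= 8)%N).
Let P' := common P Pf xs.
Let Y' := common Y Yf xs.
Let B := \bigcup_(x <- xs) dilate x Y'.

Let cP' : (#|P| <= 2 * #|P'|)%N.
Proof. exact: card_common. Qed.
Let cY' : (#|Y| <= 2 * #|Y'|)%N.
Proof. exact: card_common. Qed.
Let P'0 : P' != set0.
Proof. by have := P0; rewrite -!card_gt0; move: cP'; lia. Qed.
Let Y'0 : Y' != set0.
Proof. by have := Y0; rewrite -!card_gt0; move: cY'; lia. Qed.

Lemma common_sumset x : x \in xs -> (#|sumset P' (dilate x Y')| <= M)%N.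
Proof.
move=> xxs; apply: leq_trans (PYM (xsX xxs)); apply: subset_leq_card.
by apply: sumsetS; [|apply: imsetS]; apply: common_sub_mem.
Qed.

Lemma card_common_union : (#|sumset P' B| <= 8 * M)%N.
Proof.
apply: (@leq_trans (size xs * M)%N); last by rewrite leq_mul2r szxs orbT.
suff aux s : {subset s <= xs} ->
    (#|sumset P' (\bigcup_(x <- s) dilate x Y')| <= size s * M)%N by apply: aux.
elim: s => [|x s IH] sub.
  rewrite big_nil (eq_card0 (_ : _ =i pred0)) // => z.
  by apply/negbTE/negP=> /imset2P[? ? _]; rewrite inE.
rewrite big_cons /= mulSn.
have -> : sumset P' (dilate x Y' :|: \bigcup_(j <- s) dilate j Y') =
   sumset P' (dilate x Y') :|: sumset P' (\bigcup_(j <- s) dilate j Y').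
  exact: imset2Ur.
apply: leq_trans (leq_card_setU _ _) _; apply: leq_add.
  by apply: common_sumset; apply: sub; rewrite mem_head.
by apply: IH => y ys; apply: sub; rewrite inE ys orbT.
Qed.

Lemma mem_common_union x y : x \in xs -> y \in Y' -> x * y \in B.
Proof.
move=> xxs yY; suff aux s : x \in s -> x * y \in \bigcup_(z <- s) dilate z Y' by apply: aux.
elim: s => // z s IH; rewrite big_cons !inE => /predU1P[->|/IH ->]; last by rewrite orbT.
by rewrite mem_dilate.
Qed.

(** All the terms come from one set B, so Plunnecke's inequality gives a bound that
    depends on the number of summands only. *)
Lemma card_combination i j (S : {set F}) :
  S \subset diffset (nfold_sum i B) (nfold_sum j B) ->
  (#|S| * #|P'| ^ (i + j) <= (8 * M) ^ (i + j) * #|P'|)%N.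
Proof.
move=> /subset_leq_card h; apply: leq_trans (leq_mul h (leqnn _)) _.
apply: leq_trans (card_nfold_diff i j B P'0) _; apply: leq_mul => //.
by case: (i + j)%N => // k; rewrite leq_exp2r // card_common_union.
Qed.

Lemma card_diff_dilate x : 1 \in xs -> x \in xs ->
  (#|diffset (dilate x Y') Y'| * #|P'| <= M ^ 2)%N.
Proof.
move=> h1 hx; apply: leq_trans (ruzsa_triangle _ _ _) _; rewrite -mulnn; apply: leq_mul.
  by rewrite sumsetC; apply: common_sumset.
suff -> : Y' = dilate 1 Y' by apply: common_sumset.
by rewrite -[LHS]imset_id; apply: eq_imset => z; rewrite /= mul1r.
Qed.

End CommonPart.

(** The escaping slope is u / v with u = (x1 - x2) + (x3 - x4) and v = x3 - x4.  A
    multiplier v x + u x' is reduced by [covered_sum_lower] to v Y + u Y, that is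
    to seven dilates of Y. *)
Lemma pivot_add x1 x2 x3 x4 : x1 \in X -> x2 \in X -> x3 \in X -> x4 \in X ->
  x3 != x4 -> (x1 - x2) / (x3 - x4) + 1 \notin ratio_set X ->
  (#|P| ^ 8 * #|Y| ^ 4 * #|X| ^ 2 <=
     2 ^ 14 * 8 ^ 7 * (M ^ 11 * (#|X| ^ 2 + #|Y| ^ 2)))%N.
Proof.
move=> x1X x2X x3X x4X n34; set u := (x1 - x2) + (x3 - x4); set v := x3 - x4.
have v0 : v != 0 by rewrite subr_eq0.
rewrite -[1](divff v0) -mulrDl => nR.
have XX0 : setX X X != set0 by apply/set0Pn; exists (0, 0); rewrite inE X0.
have [[x x'] /setXP[xX x'X] /= low] := low_proper_energy Y XX0 (linear_form_inj v0 nR).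
rewrite cardsX mulnn in low.
pose xs := [:: 1; x1; x2; x3; x4; x; x'].
have xsX : {subset xs <= X} by apply/allP; rewrite /= X1 x1X x2X x3X x4X xX x'X.
have sz : (size xs <= 8)%N by [].
set P' := common P Pf xs; set Y' := common Y Yf xs.
have cP : (#|P| <= 2 * #|P'|)%N by apply: card_common.
have cY : (#|Y| <= 2 * #|Y'|)%N by apply: card_common.
have P'0 : (0 < #|P'|)%N by apply: (half_gt0 cP); rewrite card_gt0.
have Y'0 : (0 < #|Y'|)%N by apply: (half_gt0 cY); rewrite card_gt0.
have i1 : 1 \in xs by rewrite !inE eqxx.
have ix : x \in xs by rewrite !inE eqxx !orbT.
have ix' : x' \in xs by rewrite !inE eqxx !orbT.
have cov := covered_sum_lower x x' v u Y'.
have split := dilate_energy_split (v * x + u * x') Y'.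
have PE : (proper_energy (v * x + u * x')%R Y' * #|X| ^ 2 <= #|Y| ^ 4)%N.
  apply: leq_trans low; rewrite leq_mul2r; apply/orP; right.
  by rewrite (mulrC v) (mulrC u); apply: proper_energyS; apply: common_sub.
have comb : (#|sumset (sumset Y' (dilate v Y')) (dilate u Y')| * #|P'| ^ 7
    <= 8 ^ 7 * M ^ 7 * #|P'|)%N.
  rewrite -expnMn; apply: (@card_combination xs xsX sz 4 3) => //; apply/subsetP=> _ /imset2P[_ _ /imset2P[y _ yY /imsetP[y2 y2Y ->] ->] /imsetP[y3 y3Y ->] ->].
  have -> : y + v * y2 + u * y3 =
    (1 * y + (x3 * y2 + (x1 * y3 + (x3 * y3 + 0)))) - (x4 * y2 + (x2 * y3 + (x4 * y3 + 0))).
    by rewrite /u /v; ring.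
  by apply: mem_diffset; rewrite !nfold_sumS; repeat (apply: mem_sumset);
    rewrite ?set11 ?mem_common_union // !inE eqxx ?orbT.
exact: (pivot_add_size P'0 Y'0 cP cY cov split PE (card_diff_dilate xsX i1 ix)
  (card_diff_dilate xsX i1 ix') comb).
Qed.

(** As for [pivot_add], with the slope x5 (x1 - x2)/(x3 - x4); the factor x5 is
    moved to x', so that only the cover of x' x5 Y becomes more expensive. *)
Lemma pivot_mul x1 x2 x3 x4 x5 :
  x1 \in X -> x2 \in X -> x3 \in X -> x4 \in X -> x5 \in X ->
  x3 != x4 -> x5 * ((x1 - x2) / (x3 - x4)) \notin ratio_set X ->
  (#|P| ^ 7 * #|Y| ^ 5 * #|X| ^ 2 <=
     2 ^ 14 * 8 ^ 5 * (M ^ 11 * (#|X| ^ 2 + #|Y| ^ 2)))%N.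
Proof.
move=> x1X x2X x3X x4X x5X n34; set u := x1 - x2; set v := x3 - x4.
have v0 : v != 0 by rewrite subr_eq0.
rewrite mulrA => nR.
have XX0 : setX X X != set0 by apply/set0Pn; exists (0, 0); rewrite inE X0.
have [[x x'] /setXP[xX x'X] /= low] := low_proper_energy Y XX0 (linear_form_inj v0 nR).
rewrite cardsX mulnn in low.
pose xs := [:: 1; x1; x2; x3; x4; x5; x; x'].
have xsX : {subset xs <= X} by apply/allP; rewrite /= X1 x1X x2X x3X x4X x5X xX x'X.
have sz : (size xs <= 8)%N by [].
set P' := common P Pf xs; set Y' := common Y Yf xs.
have cP : (#|P| <= 2 * #|P'|)%N by apply: card_common.
have cY : (#|Y| <= 2 * #|Y'|)%N by apply: card_common.
have P'0 : (0 < #|P'|)%N by apply: (half_gt0 cP); rewrite card_gt0.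
have Y'0 : (0 < #|Y'|)%N by apply: (half_gt0 cY); rewrite card_gt0.
have i1 : 1 \in xs by rewrite !inE eqxx.
have i5 : x5 \in xs by rewrite !inE eqxx !orbT.
have ix : x \in xs by rewrite !inE eqxx !orbT.
have ix' : x' \in xs by rewrite !inE eqxx !orbT.
have cov := covered_sum_lower x (x' * x5) v u Y'.
have split := dilate_energy_split (v * x + u * (x' * x5)) Y'.
have PE : (proper_energy (v * x + u * (x' * x5))%R Y' * #|X| ^ 2 <= #|Y| ^ 4)%N.
  apply: leq_trans low; rewrite leq_mul2r; apply/orP; right.
  have -> : v * x + u * (x' * x5) = x * v + x' * (x5 * u) by ring.
  by apply: proper_energyS; apply: common_sub.
have comb : (#|sumset (sumset Y' (dilate v Y')) (dilate u Y')| * #|P'| ^ 5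
    <= 8 ^ 5 * M ^ 5 * #|P'|)%N.
  rewrite -expnMn; apply: (@card_combination xs xsX sz 3 2) => //; apply/subsetP=> _ /imset2P[_ _ /imset2P[y _ yY /imsetP[y2 y2Y ->] ->] /imsetP[y3 y3Y ->] ->].
  have -> : y + v * y2 + u * y3 =
    (1 * y + (x3 * y2 + (x1 * y3 + 0))) - (x4 * y2 + (x2 * y3 + 0)).
    by rewrite /u /v; ring.
  by apply: mem_diffset; rewrite !nfold_sumS; repeat (apply: mem_sumset);
    rewrite ?set11 ?mem_common_union // !inE eqxx ?orbT.
(* The triangle inequality through x' Y'; if x' = 0 both dilates are {0}. *)
have cov2 : (#|diffset (dilate (x' * x5)%R Y') Y'| * #|Y'| * #|P'| ^ 2 <= M ^ 4)%N.
  have tri := ruzsa_triangle_diff (dilate (x' * x5)%R Y') Y' (dilate x' Y').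
  have c5 := card_diff_dilate xsX i1 i5; have c' := card_diff_dilate xsX i1 ix'.
  rewrite -/Y' -/P' in c5 c'.
  have [e|x'0] := eqVneq x' 0.
    have e1 : x' * x5 = x' by rewrite e mul0r.
    rewrite e1.
    have YM : (#|Y'| * #|P'| <= M ^ 2)%N.
      apply: leq_trans c'; rewrite leq_mul2r; apply/orP; right.
      rewrite -(@card_imset _ _ (fun y => 0 - y)); last by move=> y z /addrI/oppr_inj.
      apply: subset_leq_card; apply/subsetP=> _ /imsetP[y yY ->]; apply: mem_diffset => //.
      by rewrite e; apply/imsetP; exists y; rewrite ?mul0r.
    apply: leq_trans (leq_trans _ (leq_mul c' YM)) _; apply: eq_leq; ring.
  rewrite card_dilate // in tri.
  have t1 : (#|diffset (dilate (x' * x5)%R Y') (dilate x' Y')| <= #|diffset (dilate x5 Y') Y'|)%N.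
    rewrite -(card_dilate (diffset (dilate x5 Y') Y') x'0); apply: subset_leq_card.
    apply/subsetP=> _ /imset2P[_ _ /imsetP[y yY ->] /imsetP[z zY ->] ->].
    by rewrite -mulrA -mulrBr mem_dilate // mem_diffset // mem_dilate.
  apply: leq_trans (leq_mul tri (leqnn (#|P'| ^ 2))) _.
  apply: leq_trans (leq_mul (leq_mul t1 (leqnn _)) (leqnn _)) _.
  apply: leq_trans (leq_trans _ (leq_mul c5 c')) _; apply: eq_leq; ring.
exact: (pivot_mul_size P'0 Y'0 cP cY cov split PE (card_diff_dilate xsX i1 ix) cov2 comb).
Qed.

(** When the ratios form a field, a multiplier of low energy is itself a ratio. *)
Lemma pivot_field : GRing.divring_closed (ratio_set X) ->
  (#|P| ^ 3 * #|Y| ^ 2 * #|ratio_set X| <=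
     2 ^ 7 * 8 ^ 4 * (M ^ 4 * (#|ratio_set X| + #|Y| ^ 2)))%N.
Proof.
move=> [R1 _ _].
have R0 : ratio_set X != set0 by apply/set0Pn; exists 1.
have [z zR low] := low_proper_energy (f := id) Y R0 (fun x y _ _ e => e).
have [x1 [x2 [x3 [x4 [[x1X x2X x3X x4X] n34 ez]]]]] := ratio_setP zR.
set u := x1 - x2 in ez; set v := x3 - x4 in ez.
have v0 : v != 0 by rewrite subr_eq0.
pose xs := [:: x1; x2; x3; x4].
have xsX : {subset xs <= X} by apply/allP; rewrite /= x1X x2X x3X x4X.
have sz : (size xs <= 8)%N by [].
set P' := common P Pf xs; set Y' := common Y Yf xs.
have cP : (#|P| <= 2 * #|P'|)%N by apply: card_common.
have cY : (#|Y| <= 2 * #|Y'|)%N by apply: card_common.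
have P'0 : (0 < #|P'|)%N by apply: (half_gt0 cP); rewrite card_gt0.
have Y'0 : (0 < #|Y'|)%N by apply: (half_gt0 cY); rewrite card_gt0.
have cov := dilate_sum_lower z Y'.
have split := dilate_energy_split z Y'.
have PE : (proper_energy z Y' * #|ratio_set X| <= #|Y| ^ 4)%N.
  apply: leq_trans low; rewrite leq_mul2r; apply/orP; right.
  by apply: proper_energyS; apply: common_sub.
have comb : (#|sumset Y' (dilate z Y')| * #|P'| ^ 4
    <= 8 ^ 4 * M ^ 4 * #|P'|)%N.
  rewrite -(card_dilate (sumset Y' (dilate z Y')) v0).
  rewrite -expnMn; apply: (@card_combination xs xsX sz 2 2) => //; apply/subsetP=> _ /imsetP[_ /imset2P[y _ yY /imsetP[y2 y2Y ->] ->] ->].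
  have -> : v * (y + z * y2) = v * y + u * y2 by rewrite ez; field.
  have -> : v * y + u * y2 = (x3 * y + (x1 * y2 + 0)) - (x4 * y + (x2 * y2 + 0)).
    by rewrite /u /v; ring.
  by apply: mem_diffset; rewrite !nfold_sumS; repeat (apply: mem_sumset);
    rewrite ?set11 ?mem_common_union // !inE eqxx ?orbT.
exact: (pivot_field_size P'0 Y'0 cP cY cov split PE comb).
Qed.

(** The multipliers x in X keep P + x Y small, up to exceptional subsets which may
    depend on x.  Either the ratios of X form a field, or one of the two
    operations r + 1 and x r leaves them. *)
Lemma pivot :
  [\/ (#|P| ^ 8 * #|Y| ^ 4 * #|X| ^ 2 <=
         2 ^ 14 * 8 ^ 7 * (M ^ 11 * (#|X| ^ 2 + #|Y| ^ 2)))%N,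
      (#|P| ^ 7 * #|Y| ^ 5 * #|X| ^ 2 <=
         2 ^ 14 * 8 ^ 5 * (M ^ 11 * (#|X| ^ 2 + #|Y| ^ 2)))%N
    | exists G : {set F}, [/\ GRing.divring_closed G, X \subset G &
        (#|P| ^ 3 * #|Y| ^ 2 * #|G| <= 2 ^ 7 * 8 ^ 4 * (M ^ 4 * (#|G| + #|Y| ^ 2)))%N]].
Proof.
have [/exists_inP[r rR nR]|] := boolP [exists r in ratio_set X, r + 1 \notin ratio_set X].
  constructor 1; have [x1 [x2 [x3 [x4 [[x1X x2X x3X x4X] n34 e]]]]] := ratio_setP rR.
  by rewrite e in nR; apply: pivot_add nR.
rewrite negb_exists_in => /forall_inP addR.
have [/exists_inP[x5 x5X /exists_inP[r rR nR]]|] :=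
  boolP [exists x in X, [exists r in ratio_set X, x * r \notin ratio_set X]].
  constructor 2; have [x1 [x2 [x3 [x4 [[x1X x2X x3X x4X] n34 e]]]]] := ratio_setP rR.
  by rewrite e in nR; apply: pivot_mul nR.
rewrite negb_exists_in => /forall_inP mulR; constructor 3.
have [fR XR] : GRing.divring_closed (ratio_set X) /\ X \subset ratio_set X.
  apply: ratio_set_field => // [r rR|x r xX rR]; first by have := addR _ rR; rewrite negbK.
  by have := mulR _ xX; rewrite negb_exists_in => /forall_inP/(_ _ rR); rewrite negbK.
by exists (ratio_set X); split=> //; apply: pivot_field.
Qed.

End Pivot.

(** * Dense neighbourhoods in a bipartite graph *)

Section Bipartite.
Variables V W : finType.
Implicit Types (H E : {set V * W}) (p : V) (q : W).

Definition lnbr H q : {set V} := [set p | (p, q) \in H].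
Definition rnbr H p : {set W} := [set q | (p, q) \in H].

Lemma card_edges_r H : (\sum_p #|rnbr H p| = #|H|)%N.
Proof.
rewrite -(card_pairs (fun p q => (p, q) \in H)).
by apply: eq_card => -[p q]; rewrite !inE.
Qed.

Lemma card_edges_l H : (\sum_q #|lnbr H q| = #|H|)%N.
Proof.
rewrite -card_edges_r; under eq_bigr do rewrite -sum1_card big_mkcond.
rewrite exchange_big; apply: eq_bigr => p _; rewrite -sum1_card [RHS]big_mkcond.
by apply: eq_bigr => q _; rewrite !inE.
Qed.

(** Delete the vertices of small degree.  The subgraph is found as a maximum of
    4n|edges| - |H| |vertices|, stated with the complements of the vertex sets to
    stay within the natural numbers: deleting one vertex cannot improve it. *)
Lemma prune (n : nat) (U : {set V}) (U' : {set W}) H :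
  (#|U| <= n)%N -> (#|U'| <= n)%N -> H \subset setX U U' -> H != set0 ->
  exists H', [/\ H' \subset H, H' != set0,
    forall p q, (p, q) \in H' -> (#|H| <= 4 * n * #|rnbr H' p|)%N &
    forall p q, (p, q) \in H' -> (#|H| <= 4 * n * #|lnbr H' q|)%N].
Proof.
move=> leU leU' HU H0; pose R (AB : {set V} * {set W}) := H :&: setX AB.1 AB.2.
pose f (AB : {set V} * {set W}) :=
  (4 * n * #|R AB| + #|H| * (#|U :\: AB.1| + #|U' :\: AB.2|))%N.
case: (@arg_maxnP _ (U, U') predT f isT) => -[A B] _ /= maxAB.
have e0 : (0 < #|H|)%N by rewrite card_gt0.
have n0 : (0 < n)%N.
  have /set0Pn[[p q]] := H0; move/(subsetP HU); rewrite inE => /andP[pU _].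
  by apply: leq_trans leU; apply/card_gt0P; exists p.
have memU p q : (p, q) \in R (A, B) -> [/\ p \in U, q \in U', p \in A & q \in B].
  by rewrite !inE /= => /andP[/(subsetP HU)]; rewrite inE => /andP[-> ->] /andP[-> ->].
exists (R (A, B)); split; first exact: subsetIl.
- apply/eqP=> R0; have := maxAB (U, U') isT; rewrite /f R0 cards0 /= !setDv !cards0.
  rewrite /R /= (setIidPl HU) !(muln0, add0n, addn0).
  have h1 := subset_leq_card (subsetDl U A); have h2 := subset_leq_card (subsetDl U' B).
  rewrite mulnC leq_pmul2l //; apply/negP; rewrite -ltnNge; lia.
- move=> p q pqR; have [pU _ pA _] := memU _ _ pqR; rewrite leqNgt; apply/negP=> lt.
  have := maxAB (A :\ p, B) isT; apply/negP; rewrite -ltnNge /f /=.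
  have eR : (#|R (A, B)| = #|rnbr (R (A, B)) p| + #|R (A :\ p, B)|)%N.
    rewrite -(cardsID [set l | l.1 == p] (R (A, B))); congr (_ + _)%N.
      rewrite -(@card_imset _ _ (fun q => (p, q))); last by move=> ? ? [].
      apply: eq_card => -[p' q']; rewrite !inE /=.
      apply/andP/imsetP => [[h /eqP e]|[q'' h [-> ->]]].
        by rewrite e in h *; exists q'; rewrite // !inE.
      by move: h; rewrite !inE.
    by apply: eq_card => -[p' q']; rewrite !inE /=; case: eqP; rewrite ?andbT ?andbF.
  have eU : #|U :\: (A :\ p)| = #|U :\: A|.+1.
    rewrite (cardsD1 p (U :\: (A :\ p))) !inE eqxx pU; congr _.+1.
    apply: eq_card => x; rewrite !inE; case: eqP => [->|//]; by rewrite pA.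
  rewrite eR eU; move: lt; rewrite mulnDr addSn mulnS => lt.
  by rewrite addnAC [ltnRHS]addnC ltn_add2r ltn_add2r.
- move=> p q pqR; have [_ qU _ qB] := memU _ _ pqR; rewrite leqNgt; apply/negP=> lt.
  have := maxAB (A, B :\ q) isT; apply/negP; rewrite -ltnNge /f /=.
  have eR : (#|R (A, B)| = #|lnbr (R (A, B)) q| + #|R (A, B :\ q)|)%N.
    rewrite -(cardsID [set l | l.2 == q] (R (A, B))); congr (_ + _)%N.
      rewrite -(@card_imset _ _ (fun p => (p, q))); last by move=> ? ? [].
      apply: eq_card => -[p' q']; rewrite !inE /=.
      apply/andP/imsetP => [[h /eqP e]|[q'' h [-> ->]]].
        by rewrite e in h *; exists p'; rewrite // !inE.
      by move: h; rewrite !inE.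
    by apply: eq_card => -[p' q']; rewrite !inE /=; case: eqP; rewrite ?andbT ?andbF.
  have eU : #|U' :\: (B :\ q)| = #|U' :\: B|.+1.
    rewrite (cardsD1 q (U' :\: (B :\ q))) !inE eqxx qU; congr _.+1.
    apply: eq_card => x; rewrite !inE; case: eqP => [->|//]; by rewrite qB.
  rewrite eR eU; move: lt; rewrite addnS mulnDr mulnS => lt.
  by rewrite addnAC [ltnRHS]addnC ltn_add2r ltn_add2r.
Qed.

(** The edges between the neighbours of q0 and those of p0, that is the middle edges
    of the paths of length three from q0 to p0. *)
Definition middle_edges H p0 q0 : {set V * W} :=
  [set l in H | (l.1 \in lnbr H q0) && (l.2 \in rnbr H p0)].

Lemma sum_paths H (g : V -> W -> V * W -> nat) :
  (\sum_p0 \sum_q0 \sum_(l in middle_edges H p0 q0) g p0 q0 l =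
   \sum_(l in H) \sum_(p0 in lnbr H l.2) \sum_(q0 in rnbr H l.1) g p0 q0 l)%N.
Proof.
rewrite pair_bigA /= (exchange_big_dep (mem H)) /=; last first.
  by move=> [p0 q0] l _; rewrite inE => /andP[].
apply: eq_bigr => l lH; rewrite pair_big_dep /=; apply: eq_big => [[p0 q0]|//].
by rewrite !inE lH /= andbC.
Qed.


Definition rcodeg H p p' := #|rnbr H p :&: rnbr H p'|.
Definition lcodeg H q q' := #|lnbr H q :&: lnbr H q'|.

Lemma sum_rcodeg H p1 (P : pred V) :
  (\sum_(q0 in rnbr H p1) #|[set p in lnbr H q0 | P p]| =
   \sum_(p | P p) rcodeg H p p1)%N.
Proof.
transitivity (\sum_(q0 in rnbr H p1) \sum_(p | P p) (p \in lnbr H q0))%N.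
  apply: eq_bigr => q0 _; rewrite -sum1dep_card big_mkcondl /=.
  by rewrite [RHS]big_mkcond [LHS]big_mkcond; apply: eq_bigr => p _; case: (P p); case: (p \in lnbr H q0).
rewrite exchange_big; apply: eq_bigr => p _; rewrite /rcodeg -sum1_card.
rewrite big_mkcond [RHS]big_mkcond; apply: eq_bigr => q _; rewrite !inE.
by case: ((p1, q) \in H); case: ((p, q) \in H).
Qed.

Lemma sum_lcodeg H q1 (P : pred W) :
  (\sum_(p0 in lnbr H q1) #|[set q in rnbr H p0 | P q]| =
   \sum_(q | P q) lcodeg H q q1)%N.
Proof.
transitivity (\sum_(p0 in lnbr H q1) \sum_(q | P q) (q \in rnbr H p0))%N.
  apply: eq_bigr => p0 _; rewrite -sum1dep_card big_mkcondl /=.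
  by rewrite [RHS]big_mkcond [LHS]big_mkcond; apply: eq_bigr => q _; case: (P q); case: (q \in rnbr H p0).
rewrite exchange_big; apply: eq_bigr => q _; rewrite /lcodeg -sum1_card.
rewrite big_mkcond [RHS]big_mkcond; apply: eq_bigr => p _; rewrite !inE.
by case: ((p, q1) \in H); case: ((p, q) \in H).
Qed.

(** Pairs whose codegree is far below the value e^2/n^3 expected for e edges on
    n + n vertices. *)
Definition rrare (K n e : nat) H p p1 := (K * n ^ 3 * rcodeg H p p1 < e ^ 2)%N.
Definition lrare (K n e : nat) H q q1 := (K * n ^ 3 * lcodeg H q q1 < e ^ 2)%N.

Lemma sum_rcodeg_rare K n e (U : {set V}) (U' : {set W}) H p1 :
  (#|U| <= n)%N -> H \subset setX U U' ->
  (K * n ^ 3 * \sum_(p | rrare K n e H p p1) rcodeg H p p1 <= n * e ^ 2)%N.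
Proof.
move=> leU HU; rewrite (bigID (mem U)) /= [X in (_ + X)%N]big1 ?addn0.
  rewrite big_distrr /=; apply: leq_trans (leq_mul leU (leqnn (e ^ 2))).
  rewrite -sum_nat_const [leqRHS](bigID (fun p => rrare K n e H p p1)) /=.
  apply: leq_trans (leq_addr _ _); rewrite (eq_bigl (fun p => (p \in U) && rrare K n e H p p1)).
    by apply: leq_sum => p /andP[_ /ltnW].
  by move=> p; rewrite andbC.
move=> p /andP[_ npU]; apply: eq_card0 => q; rewrite !inE; apply/negP=> /andP[/(subsetP HU)].
by rewrite inE /= (negbTE npU).
Qed.

Lemma sum_lcodeg_rare K n e (U : {set V}) (U' : {set W}) H q1 :
  (#|U'| <= n)%N -> H \subset setX U U' ->
  (K * n ^ 3 * \sum_(q | lrare K n e H q q1) lcodeg H q q1 <= n * e ^ 2)%N.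
Proof.
move=> leU HU; rewrite (bigID (mem U')) /= [X in (_ + X)%N]big1 ?addn0.
  rewrite big_distrr /=; apply: leq_trans (leq_mul leU (leqnn (e ^ 2))).
  rewrite -sum_nat_const [leqRHS](bigID (fun q => lrare K n e H q q1)) /=.
  apply: leq_trans (leq_addr _ _); rewrite (eq_bigl (fun q => (q \in U') && lrare K n e H q q1)).
    by apply: leq_sum => p /andP[_ /ltnW].
  by move=> p; rewrite andbC.
move=> p /andP[_ npU]; apply: eq_card0 => q; rewrite !inE; apply/negP=> /andP[/(subsetP HU)].
by rewrite inE /= (negbTE npU) andbF.
Qed.

(** Choose (p0, q0) at random.  A rare pair has few common neighbours, so it seldom
    falls into the neighbourhood of q0; weighted by the middle edges, rare pairs
    are a small proportion of all pairs on average.  The last summand of the bound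
    keeps the density of the middle edges.  The minimum degrees compare all three
    sums with the number of paths of length three. *)
Lemma exists_neighbourhoods (K n e : nat) (U : {set V}) (U' : {set W}) H :
  (#|U| <= n)%N -> (#|U'| <= n)%N -> H \subset setX U U' -> H != set0 ->
  (0 < e)%N -> (#|H| <= e)%N ->
  (forall p q, (p, q) \in H -> (e <= 4 * n * #|rnbr H p|)%N) ->
  (forall p q, (p, q) \in H -> (e <= 4 * n * #|lnbr H q|)%N) ->
  exists p0 q0, let E := middle_edges H p0 q0 in
    (16 * n ^ 3 * K * \sum_(l in E) #|[set p in lnbr H q0 | rrare K n e H p l.1]|
     + 16 * n ^ 3 * K * \sum_(l in E) #|[set q in rnbr H p0 | lrare K n e H q l.2]|
     + 4 * e ^ 2 * (#|lnbr H q0| * #|rnbr H p0|) < 256 * n ^ 2 * e * #|E|)%N.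
Proof.
move=> leU leU' HU H0 e0 leH degr degl.
pose bp p0 q0 := (\sum_(l in middle_edges H p0 q0) #|[set p in lnbr H q0 | rrare K n e H p l.1]|)%N.
pose bq p0 q0 := (\sum_(l in middle_edges H p0 q0) #|[set q in rnbr H p0 | lrare K n e H q l.2]|)%N.
pose good p0 q0 := (16 * n ^ 3 * K * bp p0 q0 + 16 * n ^ 3 * K * bq p0 q0
   + 4 * e ^ 2 * (#|lnbr H q0| * #|rnbr H p0|) < 256 * n ^ 2 * e * #|middle_edges H p0 q0|)%N.
suff /existsP[p0 /existsP[q0 h]] : [exists p0, [exists q0, good p0 q0]] by exists p0, q0.
apply: contraT; rewrite negb_exists => /forallP none.
have {none} none p0 q0 : ~~ good p0 q0.
  by have := none p0; rewrite negb_exists => /forallP.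
pose S1 := (\sum_(l in H) #|rnbr H l.1| * #|lnbr H l.2|)%N.
have sumE : (\sum_p0 \sum_q0 #|middle_edges H p0 q0| = S1)%N.
  under eq_bigr do under eq_bigr do rewrite -sum1_card.
  rewrite (sum_paths H (fun _ _ _ => 1%N)); apply: eq_bigr => l _.
  by under eq_bigr do rewrite sum1_card; rewrite sum_nat_const mulnC.
have sumab : (\sum_p0 \sum_q0 #|lnbr H q0| * #|rnbr H p0| = #|H| * #|H|)%N.
  under eq_bigr do rewrite -big_distrl /= card_edges_l.
  by rewrite -big_distrr /= card_edges_r.
have sumbp : (K * n ^ 3 * (\sum_p0 \sum_q0 bp p0 q0) <=
    \sum_(l in H) #|lnbr H l.2| * (n * e ^ 2))%N.
  rewrite (sum_paths H (fun p0 q0 l => #|[set p in lnbr H q0 | rrare K n e H p l.1]|)).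
  rewrite big_distrr /=; apply: leq_sum => l _.
  under eq_bigr do rewrite sum_rcodeg.
  rewrite sum_nat_const mulnCA leq_mul2l; apply/orP; right.
  exact: sum_rcodeg_rare HU.
have sumbq : (K * n ^ 3 * (\sum_p0 \sum_q0 bq p0 q0) <=
    \sum_(l in H) #|rnbr H l.1| * (n * e ^ 2))%N.
  rewrite (sum_paths H (fun p0 q0 l => #|[set q in rnbr H p0 | lrare K n e H q l.2]|)).
  rewrite big_distrr /=; apply: leq_sum => l _; rewrite exchange_big /=.
  under eq_bigr do rewrite sum_lcodeg.
  rewrite sum_nat_const mulnCA leq_mul2l; apply/orP; right.
  exact: sum_lcodeg_rare HU.
have eD1 : (\sum_(l in H) #|lnbr H l.2| * (n * e ^ 2) <= 4 * n ^ 2 * e * S1)%N.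
  rewrite /S1 big_distrr /=; apply: leq_sum => -[p q] /degr h /=.
  have := leq_mul h (leqnn (#|lnbr H q| * n * e)); lia.
have eD2 : (\sum_(l in H) #|rnbr H l.1| * (n * e ^ 2) <= 4 * n ^ 2 * e * S1)%N.
  rewrite /S1 big_distrr /=; apply: leq_sum => -[p q] /degl h /=.
  have := leq_mul h (leqnn (#|rnbr H p| * n * e)); lia.
have eS : (#|H| * e ^ 2 <= 16 * n ^ 2 * S1)%N.
  rewrite /S1 big_distrr /= -sum_nat_const; apply: leq_sum => -[p q] pqH /=.
  have := leq_mul (degr _ _ pqH) (degl _ _ pqH); lia.
have S1_gt0 : (0 < n ^ 2 * S1)%N.
  have h : (0 < #|H| * e ^ 2)%N by rewrite muln_gt0 card_gt0 H0 expn_gt0 e0.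
  by have := leq_trans h eS; rewrite !muln_gt0.
have : (\sum_p0 \sum_q0 256 * n ^ 2 * e * #|middle_edges H p0 q0| <=
  \sum_p0 \sum_q0 (16 * n ^ 3 * K * bp p0 q0 + 16 * n ^ 3 * K * bq p0 q0
   + 4 * e ^ 2 * (#|lnbr H q0| * #|rnbr H p0|)))%N.
  by apply: leq_sum => p0 _; apply: leq_sum => q0 _; have := none p0 q0; rewrite -leqNgt.
under eq_bigr do rewrite -big_distrr /=.
rewrite -big_distrr /= sumE {sumE}.
under [leqRHS]eq_bigr do rewrite !big_split /= -!big_distrr /=.
rewrite !big_split /= -!big_distrr /= sumab.
move: sumbp sumbq eD1 eD2 eS S1_gt0.
move: (\sum_p0 \sum_q0 bp p0 q0)%N (\sum_p0 \sum_q0 bq p0 q0)%N => X1 X2.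
clearbody S1.
move: (\sum_(l in H) _)%N (\sum_(l in H) _)%N S1 => D1 D2 S h1 h2 h3 h4 h5 h6 h7.
have h8 := leq_mul h5 leH.
have h9 : (0 < n ^ 2 * S * e)%N by rewrite muln_gt0 h6.
clear -h1 h2 h3 h4 h7 h8 h9.
lia.
Qed.

End Bipartite.

(** * Multipliers shared by many edges *)

Section Popular.
Variables (V W D : finType) (E : {set V * W}) (P : {set V}) (Q : {set W}).
Variables (badP : rel V) (badQ : rel W) (sel : V * W -> {set D}).

Definition fibre z : {set V * W} := [set l in E | z \in sel l].
Definition bad_countP (A : {set V * W}) := (\sum_(l in A) #|[set p in P | badP p l.1]|)%N.
Definition bad_countQ (A : {set V * W}) := (\sum_(l in A) #|[set q in Q | badQ q l.2]|)%N.

Lemma sum_fibres (Z : {set D}) k (g : V * W -> nat) :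
  (forall l, l \in E -> sel l \subset Z /\ #|sel l| = k) ->
  (\sum_(z in Z) \sum_(l in fibre z) g l = k * \sum_(l in E) g l)%N.
Proof.
move=> selZ; rewrite (exchange_big_dep (mem E)) /=; last first.
  by move=> z l _; rewrite inE => /andP[].
rewrite big_distrr /=; apply: eq_bigr => l lE; have [/subsetP sZ <-] := selZ l lE.
rewrite (eq_bigl (mem (sel l))) ?sum_nat_const // => z; rewrite !inE lE /=.
by apply/andP/idP => [[]//|zs]; split=> //; apply: sZ.
Qed.

(** The multipliers with a small fibre carry at most a quarter of all incidences,
    those with too many bad pairs at most an eighth on each side. *)
Lemma popular_multipliers (Z : {set D}) (n k : nat) : (0 < n)%N ->
  (0 < #|E|)%N -> (0 < #|P|)%N -> (0 < #|Q|)%N -> (#|Z| <= n)%N ->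
  (forall l, l \in E -> sel l \subset Z /\ #|sel l| = k) ->
  (512 * bad_countP E <= #|P| * #|E|)%N -> (512 * bad_countQ E <= #|Q| * #|E|)%N ->
  exists X : {set D}, [/\ X \subset Z, (k <= 2 * #|X|)%N,
    (k * #|E| <= 2 * \sum_(z in X) #|fibre z|)%N &
    forall z, z \in X -> [/\ (k * #|E| <= 4 * n * #|fibre z|)%N,
      (64 * bad_countP (fibre z) <= #|P| * #|fibre z|)%N &
      (64 * bad_countQ (fibre z) <= #|Q| * #|fibre z|)%N]].
Proof.
move=> n0 E0 P0 Q0 Zn selZ hP hQ.
pose c1 z := (k * #|E| <= 4 * n * #|fibre z|)%N.
pose c2 z := (64 * bad_countP (fibre z) <= #|P| * #|fibre z|)%N.
pose c3 z := (64 * bad_countQ (fibre z) <= #|Q| * #|fibre z|)%N.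
pose X := [set z in Z | [&& c1 z, c2 z & c3 z]].
have XZ : X \subset Z by apply/subsetP=> z; rewrite inE => /andP[].
have tot : (\sum_(z in Z) #|fibre z| = k * #|E|)%N.
  by rewrite -sum1_card -(sum_fibres _ selZ); apply: eq_bigr => z _; rewrite sum1_card.
have s1 : (4 * \sum_(z in Z | ~~ c1 z) #|fibre z| <= k * #|E|)%N.
  rewrite -(leq_pmul2l n0) mulnA big_distrr /=.
  apply: leq_trans (leq_mul Zn (leqnn _)); rewrite -sum_nat_const.
  rewrite [leqRHS](bigID (fun z => ~~ c1 z)) /=; apply: leq_trans (leq_addr _ _).
  by apply: leq_sum => z /andP[_]; rewrite -ltnNge mulnC (mulnC n) => /ltnW; rewrite mulnC.
have s2 : (8 * \sum_(z in Z | ~~ c2 z) #|fibre z| <= k * #|E|)%N.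
  rewrite -(leq_pmul2l P0) mulnCA.
  have : (#|P| * \sum_(z in Z | ~~ c2 z) #|fibre z| <= 64 * (k * bad_countP E))%N.
    rewrite -(sum_fibres _ selZ) !big_distrr /= [leqRHS](bigID (fun z => ~~ c2 z)) /=.
    apply: leq_trans (leq_addr _ _); apply: leq_sum => z /andP[_].
    by rewrite -ltnNge => /ltnW.
  by have := leq_mul (leqnn k) hP; lia.
have s3 : (8 * \sum_(z in Z | ~~ c3 z) #|fibre z| <= k * #|E|)%N.
  rewrite -(leq_pmul2l Q0) mulnCA.
  have : (#|Q| * \sum_(z in Z | ~~ c3 z) #|fibre z| <= 64 * (k * bad_countQ E))%N.
    rewrite -(sum_fibres _ selZ) !big_distrr /= [leqRHS](bigID (fun z => ~~ c3 z)) /=.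
    apply: leq_trans (leq_addr _ _); apply: leq_sum => z /andP[_].
    by rewrite -ltnNge => /ltnW.
  by have := leq_mul (leqnn k) hQ; lia.
have sX : (k * #|E| <= 2 * \sum_(z in X) #|fibre z|)%N.
  have : (\sum_(z in Z) #|fibre z| <= \sum_(z in X) #|fibre z| +
    (\sum_(z in Z | ~~ c1 z) #|fibre z| + (\sum_(z in Z | ~~ c2 z) #|fibre z| +
     \sum_(z in Z | ~~ c3 z) #|fibre z|)))%N.
    have mk c : (\sum_(z in Z | c z) #|fibre z| =
        \sum_(z in Z) if c z then #|fibre z| else 0)%N by rewrite big_mkcondr.
    have -> : (\sum_(z in X) #|fibre z| = \sum_(z in Z | z \in X) #|fibre z|)%N.
      apply: eq_bigl => z.
      by apply/idP/andP => [zX|[]//]; split=> //; apply: (subsetP XZ).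
    rewrite !mk.
    rewrite -!big_split /=; apply: leq_sum => z zZ; rewrite inE zZ /=.
    by case: (c1 z); case: (c2 z); case: (c3 z); rewrite ?addn0 ?add0n // ?leq_addr ?leq_addl.
  rewrite tot; lia.
exists X; split=> //; last by move=> z; rewrite inE => /andP[_ /and3P[]].
rewrite -(leq_pmul2r E0); apply: leq_trans sX _; rewrite -mulnA leq_mul2l /=.
rewrite -sum_nat_const; apply: leq_sum => z _; apply: subset_leq_card.
by apply/subsetP=> l; rewrite inE => /andP[].
Qed.

Definition goodP z := [set p in P | (4 * #|[set l in fibre z | badP p l.1]| <= #|fibre z|)%N].
Definition goodQ z := [set q in Q | (4 * #|[set l in fibre z | badQ q l.2]| <= #|fibre z|)%N].

Lemma card_goodP z : (0 < #|fibre z|)%N ->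
  (64 * bad_countP (fibre z) <= #|P| * #|fibre z|)%N -> (16 * #|P :\: goodP z| <= #|P|)%N.
Proof.
move=> f0 h; rewrite -(leq_pmul2r f0); apply: leq_trans h.
suff: (#|P :\: goodP z| * #|fibre z| <= 4 * bad_countP (fibre z))%N by lia.
rewrite /bad_countP (sum_card_swap (fibre z) P (fun l p => badP p l.1)).
rewrite big_distrr /= -sum_nat_const [leqRHS](bigID (fun p => p \in P :\: goodP z)) /=.
apply: leq_trans (leq_addr _ _); rewrite [leqRHS](eq_bigl (mem (P :\: goodP z))).
  apply: leq_sum => p; rewrite !inE => /andP[]; rewrite negb_and -ltnNge.
  by case/orP => [/negbTE->//|/ltnW].
by move=> p; rewrite !inE; case: (p \in P); rewrite ?andbF ?andbT.
Qed.

Lemma card_goodQ z : (0 < #|fibre z|)%N ->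
  (64 * bad_countQ (fibre z) <= #|Q| * #|fibre z|)%N -> (16 * #|Q :\: goodQ z| <= #|Q|)%N.
Proof.
move=> f0 h; rewrite -(leq_pmul2r f0); apply: leq_trans h.
suff: (#|Q :\: goodQ z| * #|fibre z| <= 4 * bad_countQ (fibre z))%N by lia.
rewrite /bad_countQ (sum_card_swap (fibre z) Q (fun l p => badQ p l.2)).
rewrite big_distrr /= -sum_nat_const [leqRHS](bigID (fun p => p \in Q :\: goodQ z)) /=.
apply: leq_trans (leq_addr _ _); rewrite [leqRHS](eq_bigl (mem (Q :\: goodQ z))).
  apply: leq_sum => p; rewrite !inE => /andP[]; rewrite negb_and -ltnNge.
  by case/orP => [/negbTE->//|/ltnW].
by move=> p; rewrite !inE; case: (p \in Q); rewrite ?andbF ?andbT.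
Qed.

Lemma card_good_edges z p q : p \in goodP z -> q \in goodQ z ->
  (#|fibre z| <= 2 * #|[set l in fibre z | ~~ badP p l.1 & ~~ badQ q l.2]|)%N.
Proof.
rewrite !inE => /andP[_ hp] /andP[_ hq].
have : (#|fibre z| <= #|[set l in fibre z | badP p l.1]| + (#|[set l in fibre z | badQ q l.2]|
   + #|[set l in fibre z | ~~ badP p l.1 & ~~ badQ q l.2]|))%N.
  apply: leq_trans (leq_trans (leq_card_setU _ _) (leq_add (leqnn _) (leq_card_setU _ _))).
  apply: subset_leq_card; apply/subsetP=> l lf; rewrite !inE.
  by move: lf; rewrite inE => ->; case: badP; case: badQ.
lia.
Qed.
End Popular.

(** * From edges to small sumsets *)

Section Relation.
Variable F : finFieldType.
Implicit Types (U A B : {set F}).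

(** The value in the column of parameter z of the line with the values l.1 and l.2 in
    the two base columns. *)
Definition line_value (z : F) (l : F * F) : F := (l.1 + z * l.2) / (1 + z).

Definition popular_diffs (K n e : nat) (c : F) U : {set F} :=
  [set d | (e ^ 2 <= K * n ^ 3 * #|[set u in setX U U | (u.1 - u.2 == c * d)%R]|)%N].

Lemma card_popular_diffs K n e c U : c != 0 -> (#|U| <= n)%N ->
  (#|popular_diffs K n e c U| * e ^ 2 <= K * n ^ 5)%N.
Proof.
move=> c0 Un; rewrite -sum_nat_const.
apply: (@leq_trans (\sum_d K * n ^ 3 * #|[set u in setX U U | (u.1 - u.2 == c * d)%R]|)%N).
  rewrite [leqRHS](bigID (mem (popular_diffs K n e c U))) /=.
  by apply: leq_trans (leq_addr _ _); apply: leq_sum => d; rewrite inE.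
rewrite -big_distrr /= (expnD n 3 2) mulnA leq_mul2l; apply/orP; right.
apply: (@leq_trans #|setX U U|); last by rewrite cardsX -mulnn leq_mul.
rewrite (card_fibres _ (fun u : F * F => (u.1 - u.2) / c)).
apply: leq_sum => d _; apply: subset_leq_card; apply/subsetP=> u.
rewrite !inE => /andP[-> /eqP->] /=; by rewrite mulrC mulKf.
Qed.

(** A common neighbour q writes p - p1 as a multiple of the difference of the values
    of the lines (p, q) and (p1, q). *)
Lemma common_right_popular K n e U (H : {set F * F}) z p p1 : 1 + z != 0 -> z != 0 ->
  (forall l, l \in H -> line_value z l \in U) ->
  ~~ rrare K n e H p p1 -> p - p1 \in popular_diffs K n e (1 + z)^-1 U.
Proof.
move=> z1 z0 HU; rewrite /rrare -leqNgt inE => /leq_trans; apply.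
rewrite leq_mul2l; apply/orP; right.
pose f q := (line_value z (p, q), line_value z (p1, q)).
have f_inj : injective f.
  by move=> q q' [/(mulIf (invr_neq0 z1))/addrI/(mulfI z0)].
rewrite /rcodeg -(card_imset _ f_inj); apply: subset_leq_card.
apply/subsetP=> _ /imsetP[q h0 ->]; move: h0; rewrite !inE => /andP[h h1].
rewrite !HU //= /line_value /= -mulrBl mulrC; apply/eqP; congr (_ * _); ring.
Qed.

Lemma common_left_popular K n e U (H : {set F * F}) z q q1 : 1 + z != 0 -> z != 0 ->
  (forall l, l \in H -> line_value z l \in U) ->
  ~~ lrare K n e H q q1 -> q - q1 \in popular_diffs K n e (z / (1 + z)) U.
Proof.
move=> z1 z0 HU; rewrite /lrare -leqNgt inE => /leq_trans; apply.
rewrite leq_mul2l; apply/orP; right.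
pose f p := (line_value z (p, q), line_value z (p, q1)).
have f_inj : injective f.
  by move=> p p' [/(mulIf (invr_neq0 z1))/addIr].
rewrite /lcodeg -(card_imset _ f_inj); apply: subset_leq_card.
apply/subsetP=> _ /imsetP[p h0 ->]; move: h0; rewrite !inE => /andP[h h1].
rewrite !HU //= /line_value /= -mulrBl mulrAC; apply/eqP; congr (_ * _); ring.
Qed.

(** A sum p + z q equals (p - p1) + z (q - q1) + (p1 + z q1), which can be done with
    every good edge (p1, q1).  The three terms determine the sum, hence the chosen
    p and q, hence the edge. *)
Lemma card_sumset_dilate (z : F) (m : nat) A B (S DP DQ : {set F}) (E : {set F * F}) :
  (forall l, l \in E -> l.1 + z * l.2 \in S) ->
  (forall p q, p \in A -> q \in B ->
    (m <= 2 * #|[set l in E | ((p - l.1)%R \in DP) && ((q - l.2)%R \in DQ)]|)%N) ->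
  (#|sumset A (dilate z B)| * m <= 2 * (#|DP| * #|DQ| * #|S|))%N.
Proof.
move=> ES hm; pose T := sumset A (dilate z B).
pose rep s := odflt (0, 0) [pick u : F * F | [&& u.1 \in A, u.2 \in B & u.1 + z * u.2 == s]].
have repP s : s \in T -> [/\ (rep s).1 \in A, (rep s).2 \in B & (rep s).1 + z * (rep s).2 = s].
  move=> /imset2P[p _ pA /imsetP[q qB ->] ->]; rewrite /rep; case: pickP => [u /and3P[? ? /eqP]//|].
  by move=> /(_ (p, q)) /=; rewrite pA qB eqxx.
pose r s l := [&& s \in T, l \in E, (rep s).1 - l.1 \in DP & (rep s).2 - l.2 \in DQ].
pose Om := [set sl : F * (F * F) | r sl.1 sl.2].
have low : (#|T| * m <= 2 * #|Om|)%N.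
  rewrite /Om (card_pairs r) big_distrr /= -sum_nat_const.
  rewrite [leqRHS](bigID (mem T)) /=; apply: leq_trans (leq_addr _ _).
  apply: leq_sum => s sT; have [rA rB _] := repP s sT.
  apply: leq_trans (hm _ _ rA rB) _; rewrite leq_mul2l; apply/orP; right.
  by apply: subset_leq_card; apply/subsetP=> l; rewrite !inE /r sT.
apply: leq_trans low _; rewrite leq_mul2l; apply/orP; right.
pose f (sl : F * (F * F)) :=
  (((rep sl.1).1 - sl.2.1, (rep sl.1).2 - sl.2.2), sl.2.1 + z * sl.2.2).
rewrite -!cardsX -(@card_in_imset _ _ f Om).
  apply: subset_leq_card; apply/subsetP=> _ /imsetP[[s l] h ->].
  by move: h; rewrite !inE /r /= => /and4P[_ /ES -> -> ->].
move=> [s [p q]] [s' [p' q']]; rewrite !inE /r /= => /and4P[sT _ _ _] /and4P[s'T _ _ _] [e1 e2 e3].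
have [_ _ es] := repP s sT; have [_ _ es'] := repP s' s'T.
have es1 : s = s'.
  rewrite -es -es'.
  have E1 x y a b : x + z * y = (x - a) + z * (y - b) + (a + z * b) by ring.
  by rewrite (E1 _ _ p q) e1 e2 e3 -(E1 _ _ p' q').
by rewrite es1 in e1 e2 *; move/addrI/oppr_inj: e1 => ->; move/addrI/oppr_inj: e2 => ->.
Qed.

End Relation.

(** * Parameters outside of an affine copy of a subfield *)

Section Circles.
Variable F : finFieldType.
Implicit Types (U G X : {set F}).

Lemma line_valueB z z' (l : F * F) : 1 + z != 0 -> 1 + z' != 0 ->
  (line_value z l - line_value z' l) * ((1 + z) * (1 + z')) = (l.2 - l.1) * (z - z').
Proof. by move=> h h'; rewrite /line_value; field; rewrite h h'. Qed.

Lemma line_value_neq z z' (l : F * F) : 1 + z != 0 -> 1 + z' != 0 ->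
  l.1 != l.2 -> z != z' -> line_value z l != line_value z' l.
Proof.
move=> h h' nl nz; rewrite -subr_eq0; apply/eqP=> e.
have := line_valueB l h h'; rewrite e mul0r => /esym/eqP.
by rewrite mulf_eq0 !subr_eq0 eq_sym (negbTE nl) (negbTE nz).
Qed.

Lemma line_value_inj z z' (l m : F * F) : 1 + z != 0 -> 1 + z' != 0 -> z != z' ->
  line_value z l = line_value z m -> line_value z' l = line_value z' m -> l = m.
Proof.
move=> h h' nz /(mulIf (invr_neq0 h)) e /(mulIf (invr_neq0 h')) e'.
have e2 : l.2 = m.2.
  have nz' : z - z' != 0 by rewrite subr_eq0.
  apply: (mulfI nz'); apply: subr0_eq.
  have -> : (z - z') * l.2 - (z - z') * m.2 =
    (l.1 + z * l.2) - (l.1 + z' * l.2) - ((m.1 + z * m.2) - (m.1 + z' * m.2)) by ring.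
  by rewrite e e' subrr.
by move: e; rewrite e2 => /addIr; case: l m e2 {e'} => [a b] [c d] /= -> ->.
Qed.

(** Comparing the ratios of the differences of the values gives a relation
    g1 (1 + z1 x') = g2 (1 + z1 y') with g1, g2 in G; since z1 is not in G, the
    coefficients of 1 and z1 agree. *)
Lemma triple_params (G : {set F}) z1 (l m : F * F) x x' y y' t :
  GRing.divring_closed G -> z1 \notin G -> x \in G -> x' \in G -> y \in G -> y' \in G ->
  t \in G -> l.1 != l.2 -> m.1 != m.2 ->
  [/\ 1 + z1 * x != 0, 1 + z1 * x' != 0, 1 + z1 * y != 0, 1 + z1 * y' != 0 & 1 + z1 * t != 0] ->
  [/\ x != x', x != t & x' != t] -> [/\ y != y', y != t & y' != t] ->
  line_value (z1 * x) l = line_value (z1 * y) m ->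
  line_value (z1 * x') l = line_value (z1 * y') m ->
  line_value (z1 * t) l = line_value (z1 * t) m ->
  x = y /\ x' = y'.
Proof.
move=> [G1 GB GD] nz1 xG x'G yG y'G tG nl nm [hx hx' hy hy' ht] [nxx' nxt nx't] [nyy' nyt ny't].
have G0 : 0 \in G by rewrite -(subrr 1) GB.
have GV a : a \in G -> a^-1 \in G by move=> aG; rewrite -[a^-1]mul1r GD.
have GM a b : a \in G -> b \in G -> a * b \in G by move=> aG bG; rewrite -[b]invrK GD // GV.
have z0 : z1 != 0 by apply: contraNneq nz1 => ->.
move=> e e' et.
set A := line_value (z1 * x) l - line_value (z1 * x') l.
set B := line_value (z1 * x) l - line_value (z1 * t) l.
have nzm a b : a != b -> z1 * a != z1 * b by move=> nab; rewrite (inj_eq (mulfI z0)).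
have A0 : A != 0 by rewrite subr_eq0 line_value_neq // nzm.
have B0 : B != 0 by rewrite subr_eq0 line_value_neq // nzm.
have ex : A * ((z1 * x - z1 * t) * (1 + z1 * x')) = B * ((z1 * x - z1 * x') * (1 + z1 * t)).
  apply: (mulIf hx).
  transitivity (A * ((1 + z1 * x) * (1 + z1 * x')) * (z1 * x - z1 * t)); first by ring.
  rewrite line_valueB //.
  transitivity (B * ((1 + z1 * x) * (1 + z1 * t)) * (z1 * x - z1 * x')); last by ring.
  by rewrite line_valueB //; ring.
have ey : A * ((z1 * y - z1 * t) * (1 + z1 * y')) = B * ((z1 * y - z1 * y') * (1 + z1 * t)).
  apply: (mulIf hy); rewrite /A /B e e' et.
  set A' := (_ - _); set B' := (line_value _ _ - line_value (z1 * t) _).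
  transitivity (A' * ((1 + z1 * y) * (1 + z1 * y')) * (z1 * y - z1 * t)); first by ring.
  rewrite line_valueB //.
  transitivity (B' * ((1 + z1 * y) * (1 + z1 * t)) * (z1 * y - z1 * y')); last by ring.
  by rewrite line_valueB //; ring.
pose g1 := (x - t) * (y - y'); pose g2 := (y - t) * (x - x').
have key : g1 * (1 + z1 * x') = g2 * (1 + z1 * y').
  apply: (mulfI A0); apply: (mulfI B0); apply: (mulfI ht); apply: (mulfI z0); apply: (mulfI z0).
  transitivity ((A * ((z1 * x - z1 * t) * (1 + z1 * x'))) * (B * ((z1 * y - z1 * y') * (1 + z1 * t)))).
    by rewrite /g1; ring.
  by rewrite ex -ey /g2; ring.
have g1G : g1 \in G by apply: GM; apply: GB.
have g2G : g2 \in G by apply: GM; apply: GB.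
have lin : z1 * (g1 * x' - g2 * y') = g2 - g1.
  apply: subr0_eq; transitivity (g1 * (1 + z1 * x') - g2 * (1 + z1 * y')); first by ring.
  by rewrite key subrr.
have d0 : g1 * x' - g2 * y' = 0.
  apply/eqP; apply: contraNT nz1 => nd; rewrite -[z1](mulfK nd) lin.
  by apply: GD; apply: GB => //; apply: GM.
move: lin; rewrite d0 mulr0 => /esym/subr0_eq eg.
have g10 : g1 != 0 by rewrite mulf_neq0 // subr_eq0.
have ex' : x' = y' by apply: (mulfI g10); move/subr0_eq: d0; rewrite eg.
split=> //; have d : t - x' != 0 by rewrite subr_eq0 eq_sym.
apply: (mulIf d); apply: subr0_eq; transitivity (g1 - g2); last by rewrite eg subrr.
by rewrite /g1 /g2 -ex'; ring.
Qed.

(** A lower bound for the number of triples that is linear in h, so that it can be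
    summed over the lines. *)
Lemma hits_lower (h k : nat) : (16 <= k)%N ->
  (4 * h * k ^ 2 <= 256 * (h * ((h - 1) * (h - 2))) + k ^ 3)%N.
Proof.
move=> k16; have [hk|hk] := leqP (4 * h) k.
  by apply: leq_trans (leq_addl _ _); rewrite expnS leq_mul2r hk orbT.
have h1 : (k <= 8 * (h - 1))%N by lia.
have h2 : (k <= 8 * (h - 2))%N by lia.
have := leq_mul (leqnn (4 * h)) (leq_mul h1 h2).
by move: (h - 1)%N (h - 2)%N => a b; lia.
Qed.

Definition triples (T : finType) (S : {set T}) : {set T * (T * T)} :=
  [set w | [&& w.1 \in S, w.2.1 \in S :\ w.1 & w.2.2 \in S :\ w.1 :\ w.2.1]].

Lemma card_triples (T : finType) (S : {set T}) :
  #|triples S| = (#|S| * ((#|S| - 1) * (#|S| - 2)))%N.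
Proof.
rewrite (card_pairs (fun x (w : T * T) => [&& x \in S, w.1 \in S :\ x & w.2 \in S :\ x :\ w.1])).
rewrite (bigID (mem S)) /= [X in (_ + X)%N]big1 ?addn0 -?sum_nat_const; last first.
  by move=> x /negbTE nx; apply: eq_card0 => w; rewrite inE nx.
apply: eq_bigr => x xS; have cS : (#|S| = #|S :\ x|.+1)%N by rewrite (cardsD1 x S) xS.
have -> : [set y | [&& x \in S, y.1 \in S :\ x & y.2 \in S :\ x :\ y.1]] =
  [set y : T * T | (y.1 \in S :\ x) && (y.2 \in S :\ x :\ y.1)] by apply/setP=> w; rewrite !inE xS.
rewrite (card_pairs (fun a b => (a \in S :\ x) && (b \in S :\ x :\ a))).
rewrite (bigID (mem (S :\ x))) /= [X in (_ + X)%N]big1 ?addn0; last first.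
  by move=> y /negbTE ny; apply: eq_card0 => w; rewrite inE ny.
rewrite (eq_bigr (fun=> (#|S| - 2)%N)); first by rewrite sum_nat_const cS subn1.
move=> y yS.
have -> : [set b | (y \in S :\ x) && (b \in S :\ x :\ y)] = S :\ x :\ y.
  by apply/setP=> b; rewrite in_set yS.
by rewrite cS [in RHS](cardsD1 y (S :\ x)) yS add1n !subSS subn0.
Qed.

(** A line is met in many columns of X, hence in many triples of them.  By
    [triple_params] and [line_value_inj] the three values and the third parameter
    determine the line and the triple. *)
Lemma few_lines_off_affine (U G X : {set F}) (z1 : F) (E : {set F * F})
    (sel : F * F -> {set F}) (k : nat) :
  GRing.divring_closed G -> z1 != 0 -> z1 \notin G -> (forall z, z \in X -> z / z1 \in G) ->
  - 1 \notin X -> (forall l, l \in E -> l.1 != l.2) -> (16 <= k)%N ->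
  (forall l z, l \in E -> z \in sel l -> line_value z l \in U) ->
  (k * #|E| <= 2 * \sum_(z in X) #|fibre E sel z|)%N ->
  (#|E| * k ^ 3 <= 256 * (#|G| * #|U| ^ 3))%N.
Proof.
move=> GG z10 nz1 XG X1 En k16 selU sumX.
pose r l (w : F * (F * F)) := (l \in E) && (w \in triples (sel l :&: X)).
pose Om := [set lw : (F * F) * (F * (F * F)) | r lw.1 lw.2].
have low : (#|E| * k ^ 3 <= 256 * #|Om|)%N.
  have cOm : (#|Om| = \sum_(l in E) #|triples (sel l :&: X)|)%N.
    rewrite /Om (card_pairs r) [RHS]big_mkcond /=; apply: eq_bigr => l _.
    case: ifP => lE; first by apply: eq_card => w; rewrite inE /r lE.
    by apply: eq_card0 => w; rewrite inE /r lE.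
  have hits : (\sum_(l in E) #|sel l :&: X| = \sum_(z in X) #|fibre E sel z|)%N.
    rewrite -(sum_card_swap E X (fun l z => z \in sel l)).
    by apply: eq_bigr => l _; apply: eq_card => z; rewrite !inE andbC.
  have : (\sum_(l in E) 4 * #|sel l :&: X| * k ^ 2 <=
      \sum_(l in E) (256 * #|triples (sel l :&: X)| + k ^ 3))%N.
    by apply: leq_sum => l _; rewrite card_triples; apply: hits_lower.
  rewrite -big_distrl -big_distrr /= hits big_split /= -big_distrr /= -cOm sum_nat_const.
  have := leq_mul sumX (leqnn (k ^ 2)).
  by move: (\sum_(z in X) _)%N #|E| #|Om| => s e o; lia.
apply: leq_trans low _; rewrite leq_mul2l; apply/orP; right.
pose f (lw : (F * F) * (F * (F * F))) :=
  (lw.2.2.2 / z1, (line_value lw.2.1 lw.1, (line_value lw.2.2.1 lw.1, line_value lw.2.2.2 lw.1))).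
have memP l w : r l w -> [/\ l \in E, [/\ w.1 \in X, w.2.1 \in X & w.2.2 \in X],
    [/\ w.1 \in sel l, w.2.1 \in sel l & w.2.2 \in sel l]
    & [/\ w.1 != w.2.1, w.1 != w.2.2 & w.2.1 != w.2.2]].
  case: w => a [b c]; rewrite /r !inE /= => /and4P[-> /andP[-> ->] /and3P[n1 -> ->] /and4P[n2 n3 -> ->]].
  by rewrite eq_sym n1 eq_sym n3 eq_sym n2.
apply: (@leq_trans #|setX G (setX U (setX U U))|); last first.
  by rewrite !cardsX !expnS expn0 muln1.
rewrite -(@card_in_imset _ _ f Om).
  apply: subset_leq_card; apply/subsetP=> _ /imsetP[[l w] h ->].
  move: h; rewrite inE /= => /memP[lE [X1' X2 X3] [S1 S2 S3] _].
  by rewrite !inE /= XG // !selU.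
have X10 z : z \in X -> 1 + z != 0.
  by move=> zX; apply: contraNneq X1 => /eqP; rewrite addr_eq0 => /eqP->; rewrite opprK.
move=> [l [a [b c]]] [m [a' [b' c']]]; rewrite !inE /=.
move=> /memP[lE /= [aX bX cX] _ [nab nac nbc]] /memP[mE /= [a'X b'X c'X] _ [na'b' na'c' nb'c']].
move=> [/(mulIf (invr_neq0 z10)) ec e1 e2 e3].
rewrite -{}ec in c'X na'c' nb'c' e3 *.
have ez z : z1 * (z / z1) = z by rewrite mulrC divfK.
have nq u v : u != v -> u / z1 != v / z1 by rewrite (inj_eq (mulIf (invr_neq0 z10))).
have [ea eb] : a / z1 = a' / z1 /\ b / z1 = b' / z1.
  apply: (@triple_params G z1 l m _ _ _ _ (c / z1)); rewrite ?ez ?XG ?En //.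
  - by rewrite !X10.
  - by rewrite !nq.
  - by rewrite !nq.
move/(mulIf (invr_neq0 z10)): ea => ea; move/(mulIf (invr_neq0 z10)): eb => eb.
rewrite -{}ea -{}eb in e1 e2 *.
by rewrite (line_value_inj (X10 _ aX) (X10 _ bX) nab e1 e2).
Qed.
End Circles.

(** * Arithmetic of the bounds *)

Lemma leq_exp m1 m2 i : (m1 <= m2)%N -> (m1 ^ i <= m2 ^ i)%N.
Proof. by case: i => // i h; rewrite leq_exp2r. Qed.

Lemma cancel_size (k n b M c l x2 : nat) : (k <= n)%N -> (b <= n)%N -> (0 < x2)%N -> (k ^ 2 <= 4 * x2)%N ->
  (l * x2 <= c * (M ^ 11 * (x2 + b ^ 2)))%N ->
  (l * k ^ 2 <= 5 * c * (M ^ 11 * n ^ 2))%N.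
Proof.
move=> kn bn x0 kx h; rewrite -(leq_pmul2r x0).
have h1 := leq_mul h (leqnn (k ^ 2)).
have h2 : ((x2 + b ^ 2) * k ^ 2 <= 5 * n ^ 2 * x2)%N.
  have := leq_mul (leqnn x2) (leq_exp 2 kn); have := leq_mul (leq_exp 2 bn) kx.
  by rewrite mulnDl; lia.
have h3 := leq_mul (leqnn (c * M ^ 11)) h2.
apply: leq_trans (leq_trans (leq_trans _ h1) (leq_trans _ h3)) _; apply: eq_leq; ring.
Qed.

Section RichArithmetic.
Variables (f c2 a b e k n M : nat).
Hypotheses (a0 : (0 < a)%N) (b0 : (0 < b)%N).
Hypotheses (kn : (k <= n)%N) (en : (e <= n ^ 2)%N) (bn : (b <= n)%N).
Hypothesis hM : (M * (k * e ^ 5 * a * b) <= c2 * n ^ 14)%N.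
Hypotheses (ea : (e <= f * n * a)%N) (eb : (e <= f * n * b)%N).

Lemma degree_power i j : (e ^ (i + j) <= (f * n) ^ (i + j) * (a ^ i * b ^ j))%N.
Proof.
rewrite !expnD; apply: leq_trans (leq_mul (leq_exp i ea) (leq_exp j eb)) _.
by rewrite !(expnMn (f * n)); apply: eq_leq; ring.
Qed.

(** The exponents i and j are 8 and 4, or 7 and 5, for the two ways to leave the
    ratio set. *)
Lemma rich_bound_escape c i j : (i + j = 12)%N ->
  (a ^ i * b ^ j * k ^ 2 <= c * (M ^ 11 * n ^ 2))%N ->
  (e ^ 89 * k ^ 13 <= f ^ 34 * (c * c2 ^ 11) * n ^ 190)%N.
Proof.
move=> ij h; have h1 := leq_mul h (leqnn ((k * e ^ 5 * a * b) ^ 11)).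
have h2 := leq_exp 11 hM.
have h3 : (a ^ (i + 11) * b ^ (j + 11) * (e ^ 55 * k ^ 13) <= c * c2 ^ 11 * n ^ 156)%N.
  apply: (@leq_trans (c * n ^ 2 * (c2 * n ^ 14) ^ 11)%N); last first.
    by rewrite expnMn -expnM; apply: eq_leq; ring.
  apply: leq_trans (leq_mul (leqnn (c * n ^ 2)) h2).
  apply: leq_trans (leq_trans _ h1) _; last by rewrite (expnMn M); apply: eq_leq; ring.
  rewrite !(expnD a) !(expnD b) (expnMn (k * e ^ 5 * a)) (expnMn (k * e ^ 5)) (expnMn k) -expnM; apply: eq_leq.
  have -> : (e ^ 55 = e ^ (5 * 11))%N by [].
  by move: (a ^ i)%N (b ^ j)%N (e ^ (5 * 11))%N => u v w; ring.
have h4 := degree_power (i + 11) (j + 11).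
have E : (i + 11 + (j + 11) = 34)%N by rewrite addnACA ij.
rewrite E in h4.
apply: (@leq_trans (e ^ 34 * (e ^ 55 * k ^ 13))%N); first by rewrite mulnA -expnD.
apply: leq_trans (leq_mul h4 (leqnn _)) _; rewrite -mulnA.
apply: leq_trans (leq_mul (leqnn _) h3) _.
rewrite expnMn (_ : n ^ 190 = n ^ 34 * n ^ 156)%N; last by rewrite -expnD.
by move: (f ^ 34)%N (n ^ 34)%N (n ^ 156)%N => u v w; apply: eq_leq; ring.
Qed.

Lemma rich_bound_large_field c : (a ^ 3 * b ^ 2 <= c * M ^ 4)%N ->
  (e ^ 89 * k ^ 13 <= f ^ 13 * (c * c2 ^ 4) * n ^ 190)%N.
Proof.
move=> h; have h1 := leq_mul h (leqnn ((k * e ^ 5 * a * b) ^ 4)).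
have h2 := leq_exp 4 hM.
have h3 : (a ^ 7 * b ^ 6 * (e ^ 20 * k ^ 4) <= c * c2 ^ 4 * n ^ 56)%N.
  apply: (@leq_trans (c * (c2 * n ^ 14) ^ 4)%N); last first.
    by rewrite expnMn -expnM mulnA.
  apply: leq_trans (leq_mul (leqnn c) h2).
  apply: leq_trans (leq_trans _ h1) _; last by rewrite (expnMn M) mulnA.
  rewrite (expnMn (k * e ^ 5 * a)) (expnMn (k * e ^ 5)) (expnMn k) -expnM.
  by apply: eq_leq; ring.
have h4 := degree_power 7 6.
have h5 := leq_mul (leq_exp 56 en) (leq_exp 9 kn).
apply: (@leq_trans (e ^ (7 + 6) * (e ^ 20 * k ^ 4) * (e ^ 56 * k ^ 9))%N).
  by apply: eq_leq; rewrite (_ : e ^ 89 = e ^ (7 + 6) * e ^ 20 * e ^ 56)%N -?expnD //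
    (_ : k ^ 13 = k ^ 4 * k ^ 9)%N -?expnD //; ring.
apply: leq_trans (leq_mul (leq_mul h4 (leqnn _)) h5) _; rewrite -[X in (X * _)%N]mulnA.
apply: leq_trans (leq_mul (leq_mul (leqnn _) h3) (leqnn _)) _.
rewrite expnMn -expnM (_ : n ^ 190 = n ^ (7 + 6) * n ^ 56 * n ^ (2 * 56) * n ^ 9)%N; last by rewrite -!expnD.
by move: (f ^ _)%N (n ^ _)%N (n ^ _)%N => u v w; apply: eq_leq; ring.
Qed.

Lemma rich_bound_small_field c g : (a ^ 3 * g <= c * M ^ 4)%N ->
  (g * (e ^ 31 * k ^ 4) <= f ^ 11 * (c * c2 ^ 4) * n ^ 67)%N.
Proof.
move=> h; have h1 := leq_mul h (leqnn ((k * e ^ 5 * a * b) ^ 4)).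
have h2 := leq_exp 4 hM.
have h3 : (a ^ 7 * b ^ 4 * (g * (e ^ 20 * k ^ 4)) <= c * c2 ^ 4 * n ^ 56)%N.
  apply: (@leq_trans (c * (c2 * n ^ 14) ^ 4)%N); last first.
    by rewrite expnMn -expnM mulnA.
  apply: leq_trans (leq_mul (leqnn c) h2).
  apply: leq_trans (leq_trans _ h1) _; last by rewrite (expnMn M) mulnA.
  rewrite (expnMn (k * e ^ 5 * a)) (expnMn (k * e ^ 5)) (expnMn k) -expnM.
  by apply: eq_leq; ring.
have h4 := degree_power 7 4.
apply: (@leq_trans (e ^ (7 + 4) * (g * (e ^ 20 * k ^ 4)))%N).
  by apply: eq_leq; rewrite (_ : e ^ 31 = e ^ (7 + 4) * e ^ 20)%N -?expnD //; ring.
apply: leq_trans (leq_mul h4 (leqnn _)) _; rewrite -mulnA.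
apply: leq_trans (leq_mul (leqnn _) h3) _.
rewrite expnMn (_ : n ^ 67 = n ^ (7 + 4) * n ^ 56)%N; last by rewrite -expnD.
by move: (f ^ _)%N (n ^ _)%N => u v; apply: eq_leq; ring.
Qed.

Lemma rich_bound_off_affine c g e1 : (g * (e ^ 31 * k ^ 4) <= c * n ^ 67)%N ->
  (e1 * k ^ 3 <= 256 * (g * n ^ 3))%N -> (e * (a * b) <= 64 * n ^ 2 * e1)%N ->
  (e ^ 89 * k ^ 13 <= 256 * 64 * f ^ 2 * c * n ^ 190)%N.
Proof.
move=> hg h1 h2.
have h3 : (e ^ 3 <= 64 * f ^ 2 * n ^ 4 * e1)%N.
  have u1 := leq_mul (leqnn (f ^ 2 * n ^ 2)) h2.
  have u2 := leq_mul (leq_mul ea eb) (leqnn e).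
  apply: leq_trans (leq_trans (leq_trans _ u2) (leq_trans _ u1)) _; apply: eq_leq; ring.
have h4 := leq_mul (leq_mul h3 (leqnn (k ^ 3))) (leqnn (e ^ 31 * k ^ 4)).
have h5 := leq_mul h1 (leqnn (64 * f ^ 2 * n ^ 4 * (e ^ 31 * k ^ 4))).
have h6 := leq_mul hg (leqnn (256 * 64 * f ^ 2 * n ^ 7)).
have h7 : (e ^ 34 * k ^ 7 <= 256 * 64 * f ^ 2 * c * n ^ 74)%N.
  apply: leq_trans (leq_trans _ h4) _.
    by apply: eq_leq; rewrite (_ : e ^ 34 = e ^ 3 * e ^ 31)%N -?expnD //; ring.
  apply: leq_trans (leq_trans _ h5) _; first by apply: eq_leq; ring.
  apply: leq_trans (leq_trans _ h6) _; first by apply: eq_leq; ring.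
  have -> : (n ^ 74 = n ^ 67 * n ^ 7)%N by rewrite -expnD.
  by move: (n ^ 67)%N => u; apply: eq_leq; ring.
have h8 := leq_mul (leq_exp 55 en) (leq_exp 6 kn).
apply: (@leq_trans (e ^ 34 * k ^ 7 * (e ^ 55 * k ^ 6))%N).
  by apply: eq_leq; rewrite mulnACA -!expnD.
apply: leq_trans (leq_mul h7 h8) _.
rewrite -expnM (_ : n ^ 190 = n ^ 74 * (n ^ (2 * 55) * n ^ 6))%N; last by rewrite -!expnD.
by move: (n ^ 74)%N (n ^ (2 * 55))%N (n ^ 6)%N => u v w; apply: eq_leq; ring.
Qed.

End RichArithmetic.

(** * Rich pencils of lines *)

Lemma exists_subset_card (T : finType) (k : nat) (S : {set T}) : (k <= #|S|)%N ->
  exists2 S' : {set T}, S' \subset S & #|S'| = k.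
Proof.
move=> kS; exists [set x in take k (enum S)].
  by apply/subsetP=> x; rewrite inE => /mem_take; rewrite mem_enum.
rewrite cardsE; have /card_uniqP-> : uniq (take k (enum S)) by rewrite take_uniq ?enum_uniq.
by rewrite size_takel // -cardE.
Qed.

Section Core.
Variables (F : finFieldType) (U Z : {set F}) (H : {set F * F}) (zs : F) (k K C : nat).
Let n := #|U|.
Let e := #|H|.
Let c2 := (512 * K ^ 2)%N.
Let c3 := (2 * (2 ^ 7 * 8 ^ 4))%N.
Hypotheses (hK : K = (512 * 64)%N) (Zn : (#|Z| <= n)%N) (Z0 : 0 \notin Z) (Z1 : - 1 \notin Z).
Hypotheses (HU : H \subset setX U U) (Hne : forall l, l \in H -> l.1 != l.2).
Hypotheses (zs0 : zs != 0) (zs1 : 1 + zs != 0) (k16 : (16 <= k)%N) (kn : (k <= n)%N).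
Hypothesis Hzs : forall l, l \in H -> line_value zs l \in U.
Hypothesis Hk : forall l, l \in H -> (k <= #|[set z in Z | line_value z l \in U]|)%N.
Hypothesis C1 : (4 ^ 34 * (5 * (2 ^ 14 * 8 ^ 7) * c2 ^ 11) <= C)%N.
Hypothesis C2 : (4 ^ 34 * (5 * (2 ^ 14 * 8 ^ 5) * c2 ^ 11) <= C)%N.
Hypothesis C3 : (4 ^ 13 * (c3 * c2 ^ 4) <= C)%N.
Hypothesis C4 : (4 ^ 11 * (c3 * c2 ^ 4) <= C)%N.
Hypothesis C5 : (256 * 64 * 4 ^ 2 * (4 ^ 11 * (c3 * c2 ^ 4)) <= C)%N.

Lemma rich_pencils_bound : H != set0 ->
  [\/ (e ^ 89 * k ^ 13 <= C * n ^ 190)%N,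
      (#|F| * (e ^ 31 * k ^ 4) <= C * n ^ 67)%N
    | exists G : {set F}, [/\ proper_subfield G, (k <= 2 * #|Z :&: G|)%N &
        (#|G| * (e ^ 31 * k ^ 4) <= C * n ^ 67)%N]].
Proof.
move=> H0.
have e0 : (0 < e)%N by rewrite card_gt0.
have [l0' l0'H] := set0Pn _ H0.
have n0 : (0 < n)%N by apply: leq_trans kn; apply: leq_trans k16.
have en : (e <= n ^ 2)%N by rewrite (leq_trans (subset_leq_card HU)) // cardsX mulnn.
have [H' [H'H H'0 degr degl]] := prune (leqnn n) (leqnn n) HU H0.
have H'U := subset_trans H'H HU.
have [p0 [q0 /=]] := exists_neighbourhoods K (leqnn n) (leqnn n) H'U H'0 e0
  (subset_leq_card H'H) degr degl.
set E := middle_edges H' p0 q0; set P := lnbr H' q0; set Q := rnbr H' p0.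
set a := #|P|; set b := #|Q|; set e1 := #|E|.
set BP := (\sum_(l in E) #|_|)%N; set BQ := (\sum_(l in E) #|_|)%N => hmain.
have e1_gt0 : (0 < e1)%N.
  by case: posnP hmain => // ->; rewrite muln0.
have [l0 l0E] : exists l, l \in E by apply/card_gt0P.
have [l0H l0P l0Q] : [/\ l0 \in H', l0.1 \in P & l0.2 \in Q].
  by move: l0E; rewrite inE => /and3P[].
have ea : (e <= 4 * n * a)%N by apply: (degl l0.1); move: l0P; rewrite inE.
have eb : (e <= 4 * n * b)%N by apply: (degr _ l0.2); move: l0Q; rewrite inE.
have a0 : (0 < a)%N by apply/card_gt0P; exists l0.1.
have b0 : (0 < b)%N by apply/card_gt0P; exists l0.2.
have PU : P \subset U.
  by apply/subsetP=> p; rewrite inE => /(subsetP H'U); rewrite inE => /andP[].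
have QU : Q \subset U.
  by apply/subsetP=> q; rewrite inE => /(subsetP H'U); rewrite inE => /andP[].
have an : (a <= n)%N by apply: subset_leq_card.
have bn : (b <= n)%N by apply: subset_leq_card.
have hab : (e * (a * b) <= 64 * n ^ 2 * e1)%N.
  have e4 : (0 < 4 * e)%N by rewrite muln_gt0.
  rewrite -(leq_pmul2l e4); apply: leq_trans (leq_trans _ (ltnW hmain)) _.
    by apply: leq_trans (leq_addl _ _); apply: eq_leq; ring.
  by apply: eq_leq; ring.
(* 512 * 64 is the value of K: 64 comes from e <= 4 n c and the constant 256. *)
have bad_le B c : (e <= 4 * n * c)%N -> (16 * n ^ 3 * K * B <= 256 * n ^ 2 * e * e1)%N ->
    (512 * B <= c * e1)%N.
  move=> ec h; have n3 : (0 < 1024 * n ^ 3)%N by rewrite muln_gt0 expn_gt0 n0.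
  rewrite -(leq_pmul2l n3).
  apply: leq_trans (leq_trans _ h) _; first by rewrite hK; apply: eq_leq; ring.
  by apply: leq_trans (leq_mul (leq_mul (leqnn _) ec) (leqnn _)) _; apply: eq_leq; ring.
have hBP : (512 * BP <= a * e1)%N.
  apply: bad_le ea _; apply: leq_trans (ltnW hmain).
  by apply: leq_trans (leq_addr _ _); apply: leq_addr.
have hBQ : (512 * BQ <= b * e1)%N.
  apply: bad_le eb _; apply: leq_trans (ltnW hmain).
  by apply: leq_trans (leq_addr _ _); apply: leq_addl.
have EH l : l \in E -> l \in H by rewrite inE => /andP[/(subsetP H'H)].
(* Exactly k parameters for each edge, so that all edges weigh the same in the averages. *)
have /fin_all_exists[sel selP] l : exists S : {set F}, l \in E ->
    S \subset [set z in Z | line_value z l \in U] /\ #|S| = k.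
  have [lE|] := boolP (l \in E); last by exists set0.
  by have [S SS cS] := exists_subset_card (Hk (EH l lE)); exists S.
have selZ l : l \in E -> sel l \subset Z /\ #|sel l| = k.
  move=> /selP[s ->]; split=> //; apply: subset_trans s _.
  by apply/subsetP=> z; rewrite inE => /andP[].
have selU l z : l \in E -> z \in sel l -> line_value z l \in U.
  by move=> /selP[/subsetP s _] /s; rewrite inE => /andP[].
pose badP : rel F := rrare K n e H'; pose badQ : rel F := lrare K n e H'.
have [X [XZ kX sumX hX]] := popular_multipliers (badP := badP) (badQ := badQ)
  n0 e1_gt0 a0 b0 Zn selZ hBP hBQ.
pose gP := goodP E P badP sel; pose gQ := goodQ E Q badQ sel.
have fib0 z : z \in X -> (0 < #|fibre E sel z|)%N.
  move=> /hX[h _ _]; have ke : (0 < k * #|E|)%N by rewrite muln_gt0 e1_gt0 (leq_trans _ k16).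
  by have := leq_trans ke h; rewrite muln_gt0 => /andP[].
have nz z : z \in X -> z != 0 by move=> /(subsetP XZ) zZ; apply: contraNneq Z0 => <-.
have nz1 z : z \in X -> 1 + z != 0.
  move=> /(subsetP XZ) zZ; apply: contraNneq Z1 => /eqP.
  by rewrite addr_eq0 => /eqP->; rewrite opprK.
(* Each z in X keeps at least k e1 / (4 n) edges, and each of them represents p + z q. *)
have rel z : z \in X ->
    (#|sumset (gP z) (dilate z (gQ z))| * (k * e ^ 5 * a * b) <= c2 * n ^ 14)%N.
  move=> zX; set T := #|_|; set DP := popular_diffs K n e (1 + zs)^-1 U.
  set DQ := popular_diffs K n e (zs / (1 + zs)) U.
  have h1 : (T * #|fibre E sel z| <= 2 * (#|DP| * #|DQ| * #|dilate (1 + z)%R U|))%N.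
    apply: card_sumset_dilate (fibre E sel z) _ _.
      move=> l; rewrite inE => /andP[lE zl].
      rewrite -[_ + _](divfK (nz1 _ zX)) mulrC mem_dilate //; exact: selU zl.
    move=> p q pg qg; apply: leq_trans (card_good_edges pg qg) _.
    rewrite leq_mul2l; apply/orP; right; apply: subset_leq_card.
    apply/subsetP=> l; rewrite !inE => /andP[-> /andP[nP nQ]] /=.
    have HU' : forall l, l \in H' -> line_value zs l \in U.
      by move=> m /(subsetP H'H); apply: Hzs.
    have := common_right_popular zs1 zs0 HU' nP; rewrite inE => ->.
    by have := common_left_popular zs1 zs0 HU' nQ; rewrite inE => ->.
  rewrite card_dilate ?nz1 // -/n in h1.
  have hDP : (#|DP| * e ^ 2 <= K * n ^ 5)%N by apply: card_popular_diffs; rewrite ?invr_neq0.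
  have hDQ : (#|DQ| * e ^ 2 <= K * n ^ 5)%N.
    by apply: card_popular_diffs; rewrite ?mulf_neq0 ?invr_neq0.
  have [hf _ _] := hX z zX.
  have g1 := leq_mul hf (leqnn (T * e ^ 4)).
  have g2 := leq_mul h1 (leqnn (4 * n * e ^ 4)).
  have g3 := leq_mul (leq_mul hDP hDQ) (leqnn (8 * n ^ 2)).
  have g4 : (k * e1 * (T * e ^ 4) <= 8 * K ^ 2 * n ^ 12)%N.
    apply: leq_trans g1 _; apply: leq_trans (leq_trans _ g2) _; first by apply: eq_leq; ring.
    apply: leq_trans (leq_trans _ g3) _; first by apply: eq_leq; ring.
    by apply: eq_leq; ring.
  have g5 := leq_mul hab (leqnn (T * (k * e ^ 4))).
  apply: leq_trans (leq_trans _ g5) _; first by apply: eq_leq; ring.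
  apply: leq_trans (leq_trans _ (leq_mul (leqnn (64 * n ^ 2)) g4)) _.
    by apply: eq_leq; ring.
  by rewrite /c2; apply: eq_leq; ring.
(* The parameter x = 0 is added to X below, whence the first entry of the maximum. *)
pose M := maxn a (\max_(z in X) #|sumset (gP z) (dilate z (gQ z))|).
have hM : (M * (k * e ^ 5 * a * b) <= c2 * n ^ 14)%N.
  have max_ok x y : (x * (k * e ^ 5 * a * b) <= c2 * n ^ 14)%N ->
      (y * (k * e ^ 5 * a * b) <= c2 * n ^ 14)%N ->
      (maxn x y * (k * e ^ 5 * a * b) <= c2 * n ^ 14)%N by case: (leqP x y).
  apply: (max_ok); last by elim/big_ind: _ => //.
  apply: leq_trans (leq_mul an (leq_mul (leq_mul (leq_mul kn (leq_exp 5 en)) an) bn)) _.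
  apply: (@leq_trans (1 * n ^ 14)%N); first by rewrite -expnM; apply: eq_leq; ring.
  by rewrite leq_mul2r /c2 hK orbC.
have [z1 z1X] : exists z, z \in X.
  by apply/card_gt0P; move: kX; case: #|X| => //; rewrite muln0 leqNgt (leq_trans _ k16).
have z10 := nz _ z1X.
pose Y := dilate z1 Q; pose X' := 0 |: [set z / z1 | z in X].
pose Pf x := if x == 0 then P else gP (x * z1).
pose Yf x := if x == 0 then Y else dilate z1 (gQ (x * z1)).
have cY : #|Y| = b by apply: card_dilate.
have X'P x : x \in X' -> x != 0 -> x * z1 \in X.
  by rewrite !inE => /orP[->//|/imsetP[z zX ->] _]; rewrite divfK.
have P0 : P != set0 by rewrite -card_gt0.
have Y0 : Y != set0 by rewrite -card_gt0 cY.
have X'0 : 0 \in X' by rewrite !inE eqxx.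
have X'1 : 1 \in X' by rewrite !inE; apply/orP; right; apply/imsetP; exists z1; rewrite ?divff.
have PfP x : x \in X' -> (16 * #|P :\: Pf x| <= #|P|)%N.
  move=> xX'; rewrite /Pf; have [_|x0] := eqVneq x 0; first by rewrite setDv cards0.
  by have xX := X'P x xX' x0; have [_ h _] := hX _ xX; apply: card_goodP => //; apply: fib0.
have YfY x : x \in X' -> (16 * #|Y :\: Yf x| <= #|Y|)%N.
  move=> xX'; rewrite /Yf cY; have [_|x0] := eqVneq x 0; first by rewrite setDv cards0.
  have xX := X'P x xX' x0; have [_ _ h] := hX _ xX.
  apply: leq_trans (card_goodQ (fib0 _ xX) h); rewrite leq_mul2l /= -(card_dilate (Q :\: gQ (x * z1)) z10).
  apply: subset_leq_card; apply/subsetP=> _ /setDP[/imsetP[q qQ ->] nq].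
  by rewrite mem_dilate // inE qQ andbT; apply: contra nq => /(mem_dilate z1).
have PYM x : x \in X' -> (#|sumset (Pf x) (dilate x (Yf x))| <= M)%N.
  move=> xX'; rewrite /Pf /Yf /M; have [->|x0] := eqVneq x 0.
    apply: leq_trans (leq_maxl _ _); apply: subset_leq_card.
    by apply/subsetP=> _ /imset2P[p _ pP /imsetP[y _ ->] ->]; rewrite mul0r addr0.
  have xX := X'P x xX' x0; apply: leq_trans (leq_maxr _ _).
  apply: leq_trans (leq_bigmax_cond _ xX); apply: eq_leq; congr #|pred_of_set (sumset _ _)|.
  by rewrite /dilate -imset_comp; apply: eq_imset => q /=; rewrite mulrA.
have kX' : (k ^ 2 <= 4 * #|X'| ^ 2)%N.
  have -> : (4 * #|X'| ^ 2 = (2 * #|X'|) ^ 2)%N by rewrite expnMn.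
  apply: leq_exp.
  apply: leq_trans kX _; rewrite leq_mul2l /=.
  rewrite -(card_imset (mem X) (mulIf (invr_neq0 z10))); apply: subset_leq_card.
  by apply/subsetP=> x xz; rewrite inE xz orbT.
have X'2 : (0 < #|X'| ^ 2)%N by rewrite expn_gt0; apply/orP; left; apply/card_gt0P; exists 0.
have finish c : (c <= C)%N -> (e ^ 89 * k ^ 13 <= c * n ^ 190)%N ->
    (e ^ 89 * k ^ 13 <= C * n ^ 190)%N.
  by move=> cC h; apply: leq_trans h _; rewrite leq_mul2r cC orbT.
case: (pivot P0 Y0 X'0 X'1 PfP YfY PYM) => [|| [G [GF X'G]]]; rewrite cY -/a.
- move=> /(cancel_size kn bn X'2 kX') h; constructor 1.
  by apply: finish C1 _; have Q1 := (rich_bound_escape hM ea eb (erefl : (8 + 4 = 12)%N) h); exact: Q1.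
- move=> /(cancel_size kn bn X'2 kX') h; constructor 1.
  by apply: finish C2 _; have Q1 := (rich_bound_escape hM ea eb (erefl : (7 + 5 = 12)%N) h); exact: Q1.
move=> hG.
have G0 : (0 < #|G|)%N by apply/card_gt0P; exists 1; case: GF.
have [bG|Gb] := leqP (b ^ 2) #|G|.
  constructor 1; apply: finish C3 _; apply: (rich_bound_large_field kn en hM ea eb).
  rewrite -(leq_pmul2r G0); apply: leq_trans hG _.
  apply: leq_trans (leq_mul (leqnn _) (leq_mul (leqnn _) (leq_add (leqnn _) bG))) _.
  by rewrite /c3; apply: eq_leq; ring.
have hg : (#|G| * (e ^ 31 * k ^ 4) <= 4 ^ 11 * (c3 * c2 ^ 4) * n ^ 67)%N.
  apply: (rich_bound_small_field hM ea eb).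
  have b2 : (0 < b ^ 2)%N by rewrite expn_gt0 b0.
  rewrite -(leq_pmul2r b2); apply: leq_trans (leq_trans _ hG) _; first by apply: eq_leq; ring.
  apply: leq_trans (leq_mul (leqnn _) (leq_mul (leqnn _) (leq_add (ltnW Gb) (leqnn _)))) _.
  by rewrite /c3; apply: eq_leq; ring.
have hgC : (#|G| * (e ^ 31 * k ^ 4) <= C * n ^ 67)%N.
  by apply: leq_trans hg _; rewrite leq_mul2r C4 orbT.
have [GT|GT] := eqVneq G setT; first by constructor 2; rewrite -cardsT -GT.
have XG z : z \in X -> z / z1 \in G.
  by move=> zX; apply: (subsetP X'G); rewrite inE; apply/orP; right; apply/imsetP; exists z.
have [G1 GB GD] := GF.
(* The alternative decides whether the columns of X lie in an affine copy of G. *)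
have [z1G|z1G] := boolP (z1 \in G).
  constructor 3; exists G; split=> //; first by split=> //; rewrite properT.
  apply: leq_trans kX _; rewrite leq_mul2l /=; apply: subset_leq_card.
  apply/subsetP=> z zX; rewrite inE (subsetP XZ) //= -[z](divfK z10) -[X in _ * X]invrK.
  by rewrite GD ?XG // -[_^-1]mul1r GD.
constructor 1; apply: finish C5 _.
apply: (rich_bound_off_affine kn en ea eb hg _ hab).
apply: (few_lines_off_affine GF z10 z1G XG _ _ k16 selU sumX).
  by apply: contra Z1; apply: (subsetP XZ).
by move=> l /EH; apply: Hne.
Qed.
End Core.

Lemma upper_bound5 (a b c d f : nat) :
  exists C : nat, [/\ (a <= C)%N, (b <= C)%N, (c <= C)%N, (d <= C)%N & (f <= C)%N].
Proof. by exists (a + b + c + d + f)%N; split; lia. Qed.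

(** H is a set of lines which pass through U in the two base columns, in the column
    zs, and in at least k columns of Z. *)
Theorem rich_pencils : exists C : nat,
  forall (F : finFieldType) (U Z : {set F}) (H : {set F * F}) (zs : F) (k : nat),
  (#|Z| <= #|U|)%N -> 0 \notin Z -> - 1 \notin Z -> zs \in Z ->
  H \subset setX U U -> (forall l, l \in H -> l.1 != l.2) -> H != set0 ->
  (16 <= k)%N -> (forall l, l \in H -> line_value zs l \in U) ->
  (forall l, l \in H -> (k <= #|[set z in Z | line_value z l \in U]|)%N) ->
  [\/ (#|H| ^ 89 * k ^ 13 <= C * #|U| ^ 190)%N,
      (#|F| * (#|H| ^ 31 * k ^ 4) <= C * #|U| ^ 67)%N
    | exists G : {set F}, [/\ proper_subfield G, (k <= 2 * #|Z :&: G|)%N &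
        (#|G| * (#|H| ^ 31 * k ^ 4) <= C * #|U| ^ 67)%N]].
Proof.
have [K hK] : exists K, K = (512 * 64)%N by exists (512 * 64)%N.
pose c2 := (512 * K ^ 2)%N; pose c3 := (2 * (2 ^ 7 * 8 ^ 4))%N.
pose c4 := (4 ^ 11 * (c3 * c2 ^ 4))%N.
have [C [C1 C2 C3 C4 C5]] := upper_bound5 (4 ^ 34 * (5 * (2 ^ 14 * 8 ^ 7) * c2 ^ 11))
  (4 ^ 34 * (5 * (2 ^ 14 * 8 ^ 5) * c2 ^ 11)) (4 ^ 13 * (c3 * c2 ^ 4)) c4
  (256 * 64 * 4 ^ 2 * c4).
exists C.
move=> F U Z H zs k ZU Z0 Z1 zsZ HU Hne H0 k16 Hzs Hk.
have kn : (k <= #|U|)%N.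
  have [l lH] := set0Pn _ H0; apply: leq_trans (Hk l lH) (leq_trans _ ZU).
  by apply: subset_leq_card; apply/subsetP=> z; rewrite inE => /andP[].
have zs0 : zs != 0 by apply: contraNneq Z0 => <-.
have zs1 : 1 + zs != 0.
  by apply: contraNneq Z1 => /eqP; rewrite addr_eq0 => /eqP e; rewrite e opprK.
exact: (rich_pencils_bound hK ZU Z0 Z1 HU Hne zs0 zs1 k16 kn Hzs Hk C1 C2 C3 C4 C5 H0).
Qed.

(** * Two rich columns *)

Section Incidences.
Variable F : finFieldType.
Implicit Types (U B : {set F}) (s : F * F).

(** The line u1 = recip_line s u2 arises by eliminating w from u1 = s.1 - s.1^2 w and
    u2 = s.2 - s.2^2 w. *)
Definition recip_line s (t : F) : F := s.1 - (s.1 / s.2) ^+ 2 * (s.2 - t).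

Definition recip_pairs B : {set F * F} :=
  [set s in setX B B | [&& s.1 != 0, s.2 != 0 & s.1 != s.2]].

Definition hits U s : {set F} := [set t in U | recip_line s t \in U].

Definition incidences U B : nat := (\sum_(s in recip_pairs B) #|hits U s|)%N.

Lemma recip_lineB s t t' :
  recip_line s t - recip_line s t' = (s.1 / s.2) ^+ 2 * (t - t').
Proof. by rewrite /recip_line; ring. Qed.

Lemma recip_line_inj s : s.1 != 0 -> s.2 != 0 -> injective (recip_line s).
Proof.
move=> s1 s2 t t' /eqP; rewrite -subr_eq0 recip_lineB mulf_eq0 expf_eq0 /=.
by rewrite mulf_eq0 invr_eq0 (negbTE s1) (negbTE s2) /= subr_eq0 => /eqP.
Qed.

Definition pencil_param (t0 t1 t : F) : F := (t - t0) / (t1 - t).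

Lemma pencil_param1 t0 t1 t : t != t1 -> 1 + pencil_param t0 t1 t = (t1 - t0) / (t1 - t).
Proof.
move=> nt; have d : t1 - t != 0 by rewrite subr_eq0 eq_sym.
by rewrite /pencil_param; field.
Qed.

Lemma line_value_pencil s t0 t1 t : t0 != t1 -> t != t1 ->
  line_value (pencil_param t0 t1 t) (recip_line s t0, recip_line s t1) = recip_line s t.
Proof.
move=> n01 nt; rewrite /line_value pencil_param1 //= /pencil_param /recip_line.
have d : t1 - t != 0 by rewrite subr_eq0 eq_sym.
have d' : t1 - t0 != 0 by rewrite subr_eq0 eq_sym.
move: (_ ^+ 2) => m.
by field; rewrite d d'.
Qed.

Lemma pencil_param_inj t0 t1 t t' : t0 != t1 -> t != t1 -> t' != t1 ->
  pencil_param t0 t1 t = pencil_param t0 t1 t' -> t = t'.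
Proof.
move=> n01 nt nt' e.
have d : t1 - t != 0 by rewrite subr_eq0 eq_sym.
have d' : t1 - t' != 0 by rewrite subr_eq0 eq_sym.
have d0 : t1 - t0 != 0 by rewrite subr_eq0 eq_sym.
have : 1 + pencil_param t0 t1 t = 1 + pencil_param t0 t1 t' by rewrite e.
rewrite !pencil_param1 // => /(mulfI d0)/invr_inj/addrI/oppr_inj //.
Qed.

(** The slope of the line is the square of s.1/s.2, and its intercept is
    s.1 (1 - s.1/s.2). *)
Lemma recip_line_fibre (s s' : F * F) t0 t1 : t0 != t1 ->
  s.1 != 0 -> s.2 != 0 -> s.1 != s.2 -> s'.1 != 0 -> s'.2 != 0 -> s'.1 != s'.2 ->
  recip_line s t0 = recip_line s' t0 -> recip_line s t1 = recip_line s' t1 ->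
  (s.1 / s.2) ^+ 2 = (s'.1 / s'.2) ^+ 2 /\
  (s.1 / s.2 = s'.1 / s'.2 -> s = s').
Proof.
case: s s' => [a b] [a' b'] /= n01 a0 b0 nab a'0 b'0 na'b' e0 e1.
have em : (a / b) ^+ 2 = (a' / b') ^+ 2.
  have d : t0 - t1 != 0 by rewrite subr_eq0.
  by apply: (mulIf d); rewrite -[LHS](recip_lineB (a, b)) e0 e1 -[RHS](recip_lineB (a', b')).
split=> // er.
have ec : a * (1 - a / b) = a' * (1 - a' / b').
  move: e0; rewrite /recip_line /= -em => /eqP; rewrite -subr_eq0 => /eqP e0.
  apply: subr0_eq; rewrite -[RHS]e0 -er.
  have -> : b' = a' / (a / b) by rewrite er; field; rewrite a'0 b'0.
  by field; rewrite a0 b0.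
have nr : 1 - a / b != 0.
  by rewrite subr_eq0; apply: contra nab => /eqP e; rewrite -(divfK b0 a) -e mul1r.
have ea : a = a' by move: ec; rewrite -er => /(mulIf nr).
congr (_, _) => //; rewrite -ea in er; move: er => /(mulfI a0)/invr_inj //.
Qed.


Lemma exists_ge_average (T : finType) (A : {set T}) (f : T -> nat) : A != set0 ->
  exists2 x, x \in A & (\sum_(y in A) f y <= #|A| * f x)%N.
Proof.
move=> /set0Pn[x0 x0A]; case: (arg_maxnP f x0A) => x xA maxx; exists x => //.
by rewrite -sum_nat_const; apply: leq_sum => y; apply: maxx.
Qed.

Lemma card_offdiag (T : finType) (S : {set T}) :
  (#|[set tt in setX S S | tt.1 != tt.2]| + #|S| = #|S| ^ 2)%N.
Proof.
rewrite -mulnn -cardsX -(cardsID [set tt | tt.1 == tt.2] (setX S S)) addnC; congr (_ + _)%N.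
  rewrite -(@card_imset _ _ (fun x : T => (x, x))); last by move=> ? ? [].
  apply: eq_card => -[x y]; rewrite !inE /=; apply/imsetP/andP.
    by case=> z zS [-> ->]; rewrite zS.
  by case=> /andP[xS _] /eqP <-; exists x.
by apply: eq_card => -[x y]; rewrite !inE andbC.
Qed.

(** Lines with fewer than j hits contribute at most half of the incidences, and the
    pairs of columns hit by the others are counted by convexity.  A line comes from
    at most two pairs s. *)
Lemma two_rich_columns U B (j : nat) : (2 <= j)%N -> (0 < incidences U B)%N ->
  (2 * #|B| ^ 2 * j <= incidences U B)%N ->
  exists t0 t1 (G : {set F * F}), [/\ t0 \in U, t1 \in U, t0 != t1,
    (incidences U B ^ 2 <= 16 * #|B| ^ 2 * #|U| ^ 2 * #|G|)%N &
    forall l, l \in G -> exists s, [/\ s \in recip_pairs B, (j <= #|hits U s|)%N,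
      t0 \in hits U s, t1 \in hits U s & l = (recip_line s t0, recip_line s t1)]].
Proof.
move=> j2 I0 hj; set I := incidences U B in I0 hj *.
pose R := [set s in recip_pairs B | (j <= #|hits U s|)%N].
have RB : (#|recip_pairs B| <= #|B| ^ 2)%N.
  rewrite -mulnn -cardsX; apply: subset_leq_card; apply/subsetP=> s.
  by rewrite inE => /andP[].
have R_B : (#|R| <= #|B| ^ 2)%N.
  apply: leq_trans RB; apply: subset_leq_card; apply/subsetP=> s.
  by rewrite inE => /andP[].
have h1 : (I <= 2 * \sum_(s in R) #|hits U s|)%N.
  have : (I <= \sum_(s in R) #|hits U s| + #|B| ^ 2 * j)%N.
    rewrite /I /incidences (bigID (fun s => (j <= #|hits U s|)%N)) /= leq_add //.
      by apply: eq_leq; apply: eq_bigl => s; rewrite [RHS]in_set.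
    apply: leq_trans (leq_mul RB (leqnn j)); rewrite -sum_nat_const.
    rewrite [leqRHS](bigID (fun s => (j <= #|hits U s|)%N)) /=.
    apply: leq_trans (leq_addl _ _); apply: leq_sum => s /andP[_].
    by rewrite -ltnNge => /ltnW.
  by move: hj; lia.
pose D := [set tt in setX U U | tt.1 != tt.2].
pose r (s : F * F) (tt : F * F) := (tt.1 \in hits U s) && (tt.2 \in hits U s).
have h2 : (\sum_(s in R) #|hits U s| ^ 2 <= 2 * \sum_(s in R) #|[set tt in D | r s tt]|)%N.
  rewrite big_distrr /=; apply: leq_sum => s; rewrite inE => /andP[_ js].
  have := card_offdiag (hits U s).
  have -> : [set tt in setX (hits U s) (hits U s) | tt.1 != tt.2] = [set tt in D | r s tt].
    apply/setP=> -[t t']; rewrite !inE /r /= !inE.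
    by case: (t \in U); case: (t' \in U); rewrite ?andbF //= andbC.
  move: j2 js; move: #|hits U s| #|[set _ in _ | _]| => h m j2 js e.
  have := leq_mul (leq_trans j2 js) (leqnn h); rewrite mulnn; lia.
(* A line hitting two columns exists, since rich lines hit at least two. *)
have D0 : D != set0.
  apply: contraTneq I0 => D0; rewrite -leqNgt.
  apply: leq_trans h1 _; rewrite (_ : \sum_(s in R) _ = 0)%N ?muln0 //; apply/eqP.
  rewrite -leqn0; apply: leq_trans (leq_trans _ h2) _.
    by apply: leq_sum => s _; case: #|_| => // m; rewrite -mulnn leq_pmull.
  rewrite leqn0 muln_eq0 sum_nat_eq0; apply/orP; right; apply/forall_inP => s _.
  by rewrite D0 cards_eq0; apply/eqP/setP=> tt; rewrite !inE.
have [[t0 t1] /setIdP[/setXP[/= t0U t1U] n01] hmax] :=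
  exists_ge_average (fun tt => #|[set s in R | r s tt]|) D0.
rewrite -(sum_card_swap R D r) /= in hmax.
have DU : (#|D| <= #|U| ^ 2)%N.
  rewrite -mulnn -cardsX; apply: subset_leq_card; apply/subsetP=> tt.
  by rewrite inE => /andP[].
set m := #|[set s in R | _]| in hmax.
pose ends s := (recip_line s t0, recip_line s t1).
pose G := ends @: [set s in R | r s (t0, t1)].
have RP s : s \in R -> [/\ s.1 != 0, s.2 != 0 & s.1 != s.2].
  by rewrite !inE => /andP[/andP[_ /and3P[]]].
(* The slope determines s.1 / s.2 up to sign, and then the intercept determines s. *)
have mG : (m <= 2 * #|G|)%N.
  have mE : m = #|[set s in R | r s (t0, t1)]| by apply: eq_card => s; rewrite !in_set.
  rewrite mE (card_fibres [set s in R | r s (t0, t1)] ends).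
  rewrite (bigID (mem G)) /= [X in (_ + X)%N]big1 ?addn0 => [|l nl]; last first.
    apply: eq_card0 => s; rewrite in_set; apply/negP=> /andP[sR /eqP el].
    by case/negP: nl; rewrite -el imset_f.
  rewrite mulnC -sum_nat_const; apply: leq_sum => _ /imsetP[s0 /setIdP[/RP[a0 b0 n0] _] ->].
  pose c := s0.1 / s0.2; apply: (@leq_trans #|[set c; - c]|); last first.
    by rewrite cards2; case: (c != - c).
  set S := [set s in _ | _].
  have SP s : s \in S -> [/\ s.1 != 0, s.2 != 0, s.1 != s.2 & ends s = ends s0].
    by rewrite in_set => /andP[/setIdP[/RP[? ? ?] _] /eqP].
  rewrite -(@card_in_imset _ _ (fun s : F * F => s.1 / s.2) S).
    apply: subset_leq_card; apply/subsetP=> _ /imsetP[s /SP[a1 b1 n1 [e0 e1]] ->].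
    have [e2 _] := recip_line_fibre n01 a1 b1 n1 a0 b0 n0 e0 e1.
    by rewrite !inE -eqf_sqr e2.
  move=> s s' /SP[a1 b1 n1 es] /SP[a2 b2 n2 es'] e.
  have [e0 e1] : ends s = ends s' by rewrite es es'.
  by have [_] := recip_line_fibre n01 a1 b1 n1 a2 b2 n2 e0 e1; apply.
exists t0, t1, G; split=> //; last first.
  move=> _ /imsetP[s /setIdP[sR /andP[h0 h0']] ->]; exists s; split=> //.
  - by move: sR; rewrite in_set => /andP[].
  - by move: sR; rewrite in_set => /andP[].
have h3 := sum_sqr_le R (fun s => #|hits U s|).
have h4 := leq_mul h1 h1.
have h5 := leq_mul R_B (leq_trans h2 (leq_mul (leqnn 2) (leq_trans hmax (leq_mul DU mG)))).
have h6 := leq_mul (leqnn 4) (leq_trans h3 h5).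
rewrite -mulnn; apply: leq_trans h4 _; apply: leq_trans (leq_trans _ h6) _.
  by rewrite -mulnn; apply: eq_leq; ring.
by apply: eq_leq; ring.
Qed.

End Incidences.

(** * The incidence bound *)

Section IncidenceArithmetic.
Variables (s f I B n e k : nat).
Hypotheses (k0 : (0 < k)%N).
Hypothesis he : (k * I ^ 2 <= s * B ^ 2 * n ^ 3 * e)%N.
Hypothesis hk : (I <= f * B ^ 2 * k)%N.

(** e is the number of lines and k the number of columns that each of them hits. *)
Lemma incidence_arith i j l : (i + l = j)%N ->
  (I ^ (2 * i + j) <= s ^ i * f ^ j * (B ^ (2 * (i + j)) * n ^ (3 * i)) * (e ^ i * k ^ l))%N.
Proof.
move=> il; have k0' : (0 < k ^ i)%N by rewrite expn_gt0 k0.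
rewrite -(leq_pmul2l k0').
have h := leq_mul (leq_exp i he) (leq_exp j hk).
apply: leq_trans (leq_trans _ h) _.
  by rewrite expnMn -expnM -mulnA -expnD.
rewrite (expnMn (s * B ^ 2 * n ^ 3)) (expnMn (s * B ^ 2)) (expnMn s).
rewrite (expnMn (f * B ^ 2)) (expnMn f) -!expnM mulnDr (expnD B).
have -> : (k ^ j = k ^ i * k ^ l)%N by rewrite -il expnD.
move: (s ^ i)%N (f ^ j)%N (B ^ (2 * i))%N (B ^ (2 * j))%N (n ^ (3 * i))%N (e ^ i)%N
  (k ^ i)%N (k ^ l)%N => x1 x2 x3 x4 x5 x6 x7 x8; apply: eq_leq; ring.
Qed.

Lemma incidence_arith1 C : (e ^ 89 * k ^ 13 <= C * n ^ 190)%N ->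
  (I ^ 280 <= s ^ 89 * f ^ 102 * C * (B ^ 382 * n ^ 457))%N.
Proof.
move=> h; have := @incidence_arith 89 102 13 erefl.
have -> : (2 * 89 + 102 = 280)%N by [].
have -> : (2 * (89 + 102) = 382)%N by [].
move=> /leq_trans; apply; apply: leq_trans (leq_mul (leqnn _) h) _.
rewrite (_ : 457 = 3 * 89 + 190)%N // (expnD n).
by move: (s ^ 89)%N (f ^ 102)%N (B ^ 382)%N (n ^ (3 * 89))%N (n ^ 190)%N => x1 x2 x3 x4 x5;
  apply: eq_leq; ring.
Qed.

Lemma incidence_arith2 C g : (g * (e ^ 31 * k ^ 4) <= C * n ^ 67)%N ->
  (g * I ^ 97 <= s ^ 31 * f ^ 35 * C * (B ^ 132 * n ^ 160))%N.
Proof.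
move=> h; have := @incidence_arith 31 35 4 erefl.
have -> : (2 * 31 + 35 = 97)%N by [].
have -> : (2 * (31 + 35) = 132)%N by [].
move=> h1; apply: leq_trans (leq_mul (leqnn g) h1) _; rewrite mulnCA.
apply: leq_trans (leq_mul (leqnn _) h) _.
rewrite (_ : 160 = 3 * 31 + 67)%N // (expnD n).
by move: (s ^ 31)%N (f ^ 35)%N (B ^ 132)%N (n ^ (3 * 31))%N (n ^ 67)%N => x1 x2 x3 x4 x5;
  apply: eq_leq; ring.
Qed.

End IncidenceArithmetic.

Lemma upper_bound2 (a b : nat) : exists C : nat, (a <= C)%N /\ (b <= C)%N.
Proof. by exists (a + b)%N; split; lia. Qed.

Lemma subfield_closed (F : finFieldType) (G : {set F}) : GRing.divring_closed G ->
  [/\ 0 \in G, forall x y, x \in G -> y \in G -> x + y \in G &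
      forall x y, x \in G -> y \in G -> x / y \in G].
Proof.
case=> G1 GB GD; have G0 : 0 \in G by rewrite -(subrr 1) GB.
split=> // x y xG yG; have -> : x + y = x - (0 - y) by ring.
by rewrite !GB.
Qed.

Theorem incidence_bound : exists C : nat, forall (F : finFieldType) (U B : {set F}),
  let I := incidences U B in
  [\/ (I <= 36 * #|B| ^ 2)%N,
      (I ^ 280 <= C * (#|B| ^ 382 * #|U| ^ 457))%N,
      (#|F| * I ^ 97 <= C * (#|B| ^ 132 * #|U| ^ 160))%N
    | exists (G : {set F}) c d, [/\ proper_subfield G,
        (I <= 8 * #|B| ^ 2 * #|U :&: affine_image c d G|)%N &
        (#|G| * I ^ 97 <= C * (#|B| ^ 132 * #|U| ^ 160))%N]].
Proof.
have [C0 hC0] := rich_pencils.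
have [C [C1 C2]] := upper_bound2 (16 ^ 89 * 4 ^ 102 * C0) (16 ^ 31 * 4 ^ 35 * C0).
exists C => F U B I; pose j := (I %/ (2 * #|B| ^ 2))%N.
have [I36|I36] := leqP I (36 * #|B| ^ 2); first by constructor 1.
have B2 : (0 < #|B| ^ 2)%N.
  rewrite expn_gt0 orbF lt0n; apply: contraTneq I36 => B0.
  rewrite -leqNgt /I /incidences big1 // => s; rewrite !inE.
  by move/eqP: B0; rewrite cards_eq0 => /eqP->; rewrite inE.
have j18 : (18 <= j)%N.
  have d0 : (0 < 2 * #|B| ^ 2)%N by rewrite muln_gt0 B2.
  rewrite /j leq_divRL //; apply: leq_trans (ltnW I36).
  by apply: eq_leq; ring.
have jI : (2 * #|B| ^ 2 * j <= I)%N by rewrite mulnC; apply: leq_trunc_div.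
have Ij : (I <= 4 * #|B| ^ 2 * (j - 2))%N.
  have := ltn_ceil I (_ : 0 < 2 * #|B| ^ 2)%N; rewrite muln_gt0 B2 => /(_ isT).
  rewrite -/j => /ltnW h; apply: leq_trans h _.
  have h3 : (j.+1 <= 2 * (j - 2))%N by move: j18; lia.
  by apply: leq_trans (leq_mul h3 (leqnn _)) _; apply: eq_leq; ring.
have I0 : (0 < I)%N by apply: leq_ltn_trans I36.
have [t0 [t1 [Ga [t0U t1U n01 IG GaP]]]] := two_rich_columns (leq_trans (isT : 2 <= 18)%N j18) I0 jI.
pose Z := [set pencil_param t0 t1 t | t in U :\ t0 :\ t1].
have ZP z : z \in Z -> exists t, [/\ t \in U, t != t0, t != t1 & z = pencil_param t0 t1 t].
  by move=> /imsetP[t]; rewrite !inE => /and3P[h1 h0 tU] ->; exists t.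
have ZU : (#|Z| <= #|U|)%N.
  apply: leq_trans (leq_imset_card _ _) (subset_leq_card _).
  by apply/subsetP=> t; rewrite !inE => /and3P[].
have Z0 : 0 \notin Z.
  apply/negP=> /ZP[t [_ h0 h1 /esym/eqP]].
  by rewrite mulf_eq0 invr_eq0 !subr_eq0 (negbTE h0) eq_sym (negbTE h1).
have Z1 : - 1 \notin Z.
  apply/negP=> /ZP[t [_ h0 h1 e]]; have := pencil_param1 t0 h1.
  rewrite -e subrr => /esym/eqP; rewrite mulf_eq0 invr_eq0 !subr_eq0.
  by rewrite eq_sym (negbTE n01) eq_sym (negbTE h1).
have GaR l : l \in Ga -> (j - 2 <= #|[set z in Z | line_value z l \in U]|)%N /\ l.1 != l.2 /\
    l \in setX U U.
  move=> /GaP[s [sB js h0 h1 ->]]; have [s1 s2] : s.1 != 0 /\ s.2 != 0.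
    by move: sB; rewrite inE => /andP[_ /and3P[]].
  split; last first.
    rewrite /= (inj_eq (recip_line_inj s1 s2)) n01; split=> //.
    by move: h0 h1; rewrite !inE /= => /andP[_ ->] /andP[_ ->].
  apply: (@leq_trans #|hits U s :\ t0 :\ t1|).
    move: js; rewrite (cardsD1 t0) h0 (cardsD1 t1 (_ :\ t0)) !inE eq_sym n01.
    by move: h1; rewrite inE => -> ; rewrite /= addnA => h; rewrite leq_subLR.
  rewrite -(@card_in_imset _ _ (pencil_param t0 t1)); last first.
    move=> t t'; rewrite !inE => /and3P[n1 _ _] /and3P[n1' _ _].
    exact: pencil_param_inj.
  apply: subset_leq_card; apply/subsetP=> _ /imsetP[t ht ->].
  rewrite in_set; move: ht; rewrite !inE => /and4P[n1 n0 tU lU].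
  rewrite line_value_pencil // lU andbT; apply/imsetP; exists t => //.
  by rewrite !inE n1 n0.
have Ga0 : (0 < #|Ga|)%N.
  have : (0 < I ^ 2)%N by rewrite expn_gt0 I0.
  by move=> /leq_trans/(_ IG); rewrite muln_gt0 => /andP[].
have k16 : (16 <= j - 2)%N by move: j18; lia.
have Zn0 : Z != set0.
  have /card_gt0P[l lG] := Ga0; have [h _] := GaR l lG.
  rewrite -card_gt0; apply: leq_trans (leq_trans _ h) _; first by apply: leq_trans k16.
  by apply: subset_leq_card; apply/subsetP=> z; rewrite inE => /andP[].
have [zs zsZ hzs] := exists_ge_average (fun z => #|[set l in Ga | line_value z l \in U]|) Zn0.
pose H := [set l in Ga | line_value zs l \in U].
have kH : ((j - 2) * #|Ga| <= #|U| * #|H|)%N.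
  apply: leq_trans (leq_trans _ hzs) _; last by rewrite leq_mul2r ZU orbT.
  rewrite -(sum_card_swap Ga Z (fun l z => line_value z l \in U)) mulnC -sum_nat_const.
  by apply: leq_sum => l /GaR[].
have HGa l : l \in H -> l \in Ga by rewrite inE => /andP[].
have H0 : H != set0.
  have : (0 < (j - 2) * #|Ga|)%N by rewrite muln_gt0 Ga0 (leq_trans _ k16).
  by move=> /leq_trans/(_ kH); rewrite muln_gt0 => /andP[_]; rewrite card_gt0.
have k0 : (0 < j - 2)%N by apply: leq_trans k16.
have he : ((j - 2) * I ^ 2 <= 16 * #|B| ^ 2 * #|U| ^ 3 * #|H|)%N.
  apply: leq_trans (leq_mul (leqnn _) IG) _.
  apply: leq_trans (leq_trans _ (leq_mul (leqnn (16 * #|B| ^ 2 * #|U| ^ 2)) kH)) _.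
    by apply: eq_leq; ring.
  by apply: eq_leq; ring.
have HU : H \subset setX U U by apply/subsetP=> l /HGa/GaR[_ []].
have Hne l : l \in H -> l.1 != l.2 by move=> /HGa/GaR[_ []].
have Hzs l : l \in H -> line_value zs l \in U by rewrite inE => /andP[].
have Hk l : l \in H -> (j - 2 <= #|[set z in Z | line_value z l \in U]|)%N by move=> /HGa/GaR[].
case: (hC0 F U Z H zs (j - 2)%N ZU Z0 Z1 zsZ HU Hne H0 k16 Hzs Hk) => [h|h|[G [GF kG h]]].
- constructor 2; apply: leq_trans (incidence_arith1 k0 he Ij h) _.
  by rewrite leq_mul2r C1 orbT.
- constructor 3; apply: leq_trans (incidence_arith2 k0 he Ij h) _.
  by rewrite leq_mul2r C2 orbT.
constructor 4; exists G, (t1 - t0), t0; split=> //; last first.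
  apply: leq_trans (incidence_arith2 k0 he Ij h) _.
  by rewrite leq_mul2r C2 orbT.
apply: leq_trans Ij _.
apply: leq_trans (leq_mul (leqnn _) kG) _.
suff h' : (#|Z :&: G| <= #|U :&: affine_image (t1 - t0)%R t0 G|)%N.
  by apply: leq_trans (leq_trans _ (leq_mul (leqnn (8 * #|B| ^ 2)) h')) _ => //; apply: eq_leq; ring.
have [G0 GA GD] := subfield_closed GF.1.
have G1 : 1 \in G by case: GF => -[].
have n10 : t1 - t0 != 0 by rewrite subr_eq0 eq_sym.
(* The inverse of pencil_param; it maps G into an affine copy of G. *)
pose back z := (t1 - t0) * (z / (1 + z)) + t0.
have backK t : t != t1 -> back (pencil_param t0 t1 t) = t.
  move=> h1; have d : t1 - t != 0 by rewrite subr_eq0 eq_sym.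
  by rewrite /back pencil_param1 // /pencil_param; field; rewrite d n10.
rewrite -(@card_in_imset _ _ back (Z :&: G)).
  apply: subset_leq_card; apply/subsetP=> _ /imsetP[z /setIP[zZ zG] ->]; rewrite inE.
  apply/andP; split; first by have [t [tU _ h1 ->]] := ZP z zZ; rewrite backK.
  by apply: imset_f; apply: GD => //; apply: GA.
move=> z z' /setIP[/ZP[t [_ _ h1 ->]] _] /setIP[/ZP[t' [_ _ h1' ->]] _].
by rewrite !backK // => ->.
Qed.

(** * From energy to incidences *)

Section ReciprocalEnergy.
Variable F : finFieldType.
Implicit Types A B X Y : {set F}.

Lemma mem_invset A x : x \in A -> x != 0 -> x^-1 \in invset A.
Proof. by move=> xA x0; apply/imsetP; exists x => //; rewrite inE xA. Qed.

Lemma invsetP A y : reflect (y^-1 \in A /\ y != 0) (y \in invset A).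
Proof.
apply: (iffP imsetP) => [[x]|[yA y0]].
  by rewrite inE => /andP[xA x0] ->; rewrite invrK invr_eq0.
by exists y^-1; rewrite ?invrK // inE yA invr_eq0.
Qed.

Lemma invset0 A : 0 \notin invset A.
Proof. by apply/invsetP => -[_]; rewrite eqxx. Qed.

Lemma card_invset_le A : (#|invset A| <= #|A|)%N.
Proof.
apply: leq_trans (leq_imset_card _ _) (subset_leq_card _).
by apply/subsetP=> x; rewrite inE => /andP[].
Qed.

Lemma invsetK A : 0 \notin A -> invset (invset A) = A.
Proof.
move=> A0; apply/setP=> x; apply/invsetP/idP => [[/invsetP[]]|xA].
  by rewrite invrK.
have x0 : x != 0 by apply: contraNneq A0 => <-.
by split=> //; apply: mem_invset.
Qed.

Lemma card_invset A : 0 \notin A -> #|invset A| = #|A|.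
Proof.
by move=> A0; apply/eqP; rewrite eqn_leq card_invset_le -{1}(invsetK A0) card_invset_le.
Qed.

Lemma energy_cauchy_schwarz X Y :
  ((#|X| * #|Y|) ^ 2 <= #|sumset X Y| * additive_energy X Y)%N.
Proof.
pose f (u : F * F) := u.1 + u.2.
have := card_sqr_le_collisions f (setX X Y); rewrite cardsX => /leq_trans; apply.
apply: leq_mul.
  by apply: subset_leq_card; apply/subsetP=> _ /imsetP[[a b] /setXP[aX bY] ->]; rewrite mem_sumset.
pose g (x : (F * F) * (F * F)) := ((x.1.1, x.2.1), (x.1.2, x.2.2)).
rewrite -(@card_imset _ _ g); last by move=> [[a b] [c d]] [[a' b'] [c' d']] [-> -> -> ->].
apply: subset_leq_card; apply/subsetP=> _ /imsetP[[[a b] [c d]] h ->].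
by move: h; rewrite !inE /= => /and3P[/andP[-> ->] /andP[-> ->] ->].
Qed.

Lemma recip_sum (x y : F) : x != 0 -> y != 0 -> x + y != 0 ->
  (x^-1 + y^-1)^-1 = y - y ^+ 2 / (x + y).
Proof.
move=> x0 y0 xy0; have -> : x^-1 + y^-1 = (x + y) / (x * y) by field; rewrite x0 y0.
by rewrite invf_div; field.
Qed.

(** Solutions with both sums zero and solutions with y1 = y2 are set aside: in either
    case two of the four variables determine the others. *)
Lemma energy_le_incidences A B : 0 \notin A -> 0 \notin B ->
  (additive_energy (invset A) (invset B) <=
     incidences (invset (sumset A B)) (invset B) + 2 * (#|A| * #|B|))%N.
Proof.
move=> A0 B0; set X := invset A; set Y := invset B; set U := invset (sumset A B).
pose T0 : {set (F * F) * (F * F)} := [set t | [&& t.1.1 \in X, t.1.2 \in X, t.2.1 \in Y, t.2.2 \in Y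
        & t.1.1 + t.2.1 == t.1.2 + t.2.2]].
pose T1 := [set t in T0 | t.1.1 + t.2.1 == 0].
pose T2 := [set t in T0 | t.2.1 == t.2.2].
pose T3 := [set t in T0 | (t.1.1 + t.2.1 != 0) && (t.2.1 != t.2.2)].
have T0P a b c d : ((a, b), (c, d)) \in T0 ->
    [/\ a \in X, b \in X, c \in Y, d \in Y & a + c = b + d].
  by rewrite in_set => /and5P[? ? ? ? /eqP].
have cX : #|X| = #|A| by apply: card_invset.
have cY : #|Y| = #|B| by apply: card_invset.
have h1 : (#|T1| <= #|A| * #|B|)%N.
  rewrite -cX -cY -cardsX -(@card_in_imset _ _ (fun t : (F * F) * (F * F) => (t.1.1, t.2.2)) T1).
    apply: subset_leq_card; apply/subsetP=> _ /imsetP[[[a b] [c d]] h ->].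
    by move: h; rewrite !inE /= => /andP[/and5P[-> _ _ ->]].
  move=> [[a b] [c d]] [[a' b'] [c' d']]; rewrite !inE /=.
  move=> /andP[/and5P[_ _ _ _ /eqP e1] /eqP e2] /andP[/and5P[_ _ _ _ /eqP e1'] /eqP e2'] [ea ed].
  move: e1 e1'; rewrite e2 e2' => /esym/eqP; rewrite addr_eq0 => /eqP eb /esym/eqP.
  rewrite addr_eq0 => /eqP eb'; move/eqP: e2; rewrite addrC addr_eq0 => /eqP ec.
  move/eqP: e2'; rewrite addrC addr_eq0 => /eqP ec'.
  by rewrite eb eb' ec ec' ea ed.
have h2 : (#|T2| <= #|A| * #|B|)%N.
  rewrite -cX -cY -cardsX -(@card_in_imset _ _ (fun t : (F * F) * (F * F) => (t.1.1, t.2.2)) T2).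
    apply: subset_leq_card; apply/subsetP=> _ /imsetP[[[a b] [c d]] h ->].
    by move: h; rewrite !inE /= => /andP[/and5P[-> _ _ ->]].
  move=> [[a b] [c d]] [[a' b'] [c' d']]; rewrite !inE /=.
  move=> /andP[/and5P[_ _ _ _ /eqP e1] /eqP e2] /andP[/and5P[_ _ _ _ /eqP e1'] /eqP e2'] [ea ed].
  by move: e1 e1'; rewrite e2 e2' => /addIr <- /addIr <-; rewrite ea ed.
have h3 : (#|T3| <= incidences U Y)%N.
  pose r (s : F * F) t := (s \in recip_pairs Y) && (t \in hits U s).
  have -> : incidences U Y = #|[set w : (F * F) * F | r w.1 w.2]|.
    rewrite (card_pairs r) /incidences big_mkcond /=; apply: eq_bigr => s _.
    case: ifP => sY; first by apply: eq_card => t; rewrite [RHS]in_set /r sY.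
    by apply/esym/eq_card0 => t; rewrite in_set /r sY.
  pose u x y : F := (x^-1 + y^-1)^-1.
  have memU x y : x \in X -> y \in Y -> x + y != 0 -> u x y \in U.
    move=> /invsetP[xA x0] /invsetP[yB y0] xy0; apply: mem_invset; first exact: mem_sumset.
    have -> : x^-1 + y^-1 = (x + y) / (x * y) by field; rewrite x0 y0.
    by rewrite mulf_neq0 // invr_eq0 mulf_neq0.
  pose f (t : (F * F) * (F * F)) := (t.2, u t.1.2 t.2.2).
  rewrite -(@card_in_imset _ _ f T3).
    apply: subset_leq_card; apply/subsetP=> _ /imsetP[[[a b] [c d]] h ->].
    have [/T0P[aX bX cY' dY e] /andP[/= ac0 ncd]] := setIdP h.
    have [[_ a0] [_ b0] [_ c0] [_ d0]] : [/\ a^-1 \in A /\ a != 0, b^-1 \in A /\ b != 0,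
      c^-1 \in B /\ c != 0 & d^-1 \in B /\ d != 0] by split; apply/invsetP.
    have bd0 : b + d != 0 by rewrite -e.
    rewrite in_set /r in_set /= !inE /= cY' dY c0 d0 ncd memU //=.
    rewrite /recip_line /= /u recip_sum //.
    have -> : c - (c / d) ^+ 2 * (d - (d - d ^+ 2 / (b + d))) = (a^-1 + c^-1)^-1.
      by rewrite recip_sum // e; field; rewrite bd0 d0.
    exact: memU.
  move=> [[a b] [c d]] [[a' b'] [c' d']] /setIdP[/T0P[_ _ _ _ e] _] /setIdP[/T0P[_ _ _ _ e'] _].
  move=> [ec ed /invr_inj]; rewrite -ed => /addIr/invr_inj eb.
  by move: e e'; rewrite -ec -ed -eb => <- /addIr ->.
apply: (@leq_trans (#|T3| + (#|T1| + #|T2|))%N); last first.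
  by apply: leq_add => //; rewrite mul2n -addnn leq_add.
apply: leq_trans (leq_trans (leq_card_setU _ _) (leq_add (leqnn _) (leq_card_setU _ _))).
apply: subset_leq_card; apply/subsetP=> t tT; have tT0 : t \in T0 by [].
rewrite !in_setU [t \in T3]in_set [t \in T1]in_set [t \in T2]in_set tT0 /=.
by case: (_ == 0); case: (t.2.1 == t.2.2).
Qed.

End ReciprocalEnergy.

(** * Exponents *)

Section Logarithms.
Variable R : realType.
Implicit Types x y b s : R.

Lemma powR_expR x r : 0 < x -> x `^ r = expR (r * ln x).
Proof. by move=> x0; rewrite /powR gt_eqF. Qed.

Lemma le_expR_ln x y : 0 < x -> ln x <= y -> x <= expR y.
Proof. by move=> x0; rewrite -{2}(lnK x0) ler_expR. Qed.

Lemma ln_le x y : 0 < x -> x <= y -> ln x <= ln y.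
Proof. by move=> x0 xy; rewrite ler_ln ?posrE // (lt_le_trans x0). Qed.

Lemma ln_natX (g m I : nat) : (0 < g)%N -> (0 < I)%N ->
  ln ((g * I ^ m)%:R : R) = ln g%:R + m%:R * ln I%:R.
Proof.
move=> g0 I0; rewrite natrM natrX lnM ?posrE ?exprn_gt0 ?ltr0n //.
by rewrite lnXn ?ltr0n // mulr_natl.
Qed.

Lemma ln_monomial_bound (g m I C b i n s j : nat) :
  (0 < g)%N -> (0 < I)%N -> (0 < C)%N -> (0 < b)%N -> (0 < s)%N -> (n <= s)%N ->
  (g * I ^ m <= C * (b ^ i * n ^ j))%N ->
  ln g%:R + m%:R * ln I%:R <= ln C%:R + i%:R * ln b%:R + j%:R * ln s%:R :> R.
Proof.
move=> g0 I0 C0 b0 s0 ns h.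
have h' : (g * I ^ m <= C * b ^ i * s ^ j)%N.
  by apply: leq_trans h _; rewrite mulnA leq_mul2l leq_exp ?orbT.
rewrite -ln_natX //; apply: (@le_trans _ _ (ln ((C * b ^ i * s ^ j)%:R))).
  by apply: ln_le; rewrite ?ltr0n ?muln_gt0 ?g0 ?expn_gt0 ?I0 // ler_nat.
by rewrite ln_natX ?muln_gt0 ?C0 ?expn_gt0 ?b0 // ln_natX.
Qed.

Lemma ln_nat_ge0 (n : nat) : (0 < n)%N -> 0 <= ln (n%:R : R).
Proof. by move=> n0; rewrite ln_ge0 // ler1n. Qed.

End Logarithms.

(** In logarithms everything is linear: each alternative of [incidence_bound] bounds
    ln I by a combination of ln b, ln s and ln q, where 0 <= ln b <= ln s <= ln q. *)
Lemma energy_bound (R : realType) (K : R) : 0 < K -> exists2 C : R, 0 < C &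
  forall (F : finFieldType) (A B : {set F}),
    0 \notin A -> 0 \notin B -> (2 <= #|A|)%N -> (2 <= #|B|)%N ->
    subfield_sparse K A B ->
    (additive_energy (invset A) (invset B))%:R
    <= C * ((#|sumset A B|%:R `^ (173 / 104)
             + #|F|%:R `^ (- (1 / 285)) * #|sumset A B|%:R `^ (476 / 285))
            * #|B|%:R `^ (4 / 3)).
Proof.
move=> K0; have [C1 hC1] := incidence_bound.
pose C0 := C1.+1; pose K1 := K + 1.
have K1_ge1 : 1 <= K1 by rewrite /K1; lra.
pose c0 : R := ln 36%:R + ln C0%:R + 2 * ln K1 + 2 * ln 8%:R.
have l36 : 0 <= ln (36%:R : R) by apply: ln_nat_ge0.
have l8 : 0 <= ln (8%:R : R) by apply: ln_nat_ge0.
have lC : 0 <= ln (C0%:R : R) by apply: ln_nat_ge0.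
have lK : 0 <= ln K1 by apply: ln_ge0.
exists (expR c0 + 2); first by rewrite addr_gt0 ?expR_gt0.
move=> F A B A0 B0 A2 B2 sparse.
set S := sumset A B; set s := #|S|; set b := #|B|; set U := invset S.
have cB : #|invset B| = b by apply: card_invset.
have b0 : (0 < b)%N by apply: leq_trans B2.
have a0 : (0 < #|A|)%N by apply: leq_trans A2.
have bs : (b <= s)%N by rewrite /s /S sumsetC card_sumset_ge // -card_gt0.
have as_ : (#|A| <= s)%N by rewrite card_sumset_ge // -card_gt0.
have s0 : (0 < s)%N by apply: leq_trans bs.
have sq : (s <= #|F|)%N by apply: max_card.
have Us : (#|U| <= s)%N by apply: card_invset_le.
have q0 : (0 < #|F|)%N by apply: leq_trans sq.
have sR : 0 < (s%:R : R) by rewrite ltr0n.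
have bR : 0 < (b%:R : R) by rewrite ltr0n.
have qR : 0 < (#|F|%:R : R) by rewrite ltr0n.
pose be : R := ln b%:R; pose si : R := ln s%:R; pose th : R := ln #|F|%:R.
pose T1 := expR (173 / 104 * si + 4 / 3 * be).
pose T2 := expR (- (1 / 285) * th + 476 / 285 * si + 4 / 3 * be).
have -> : (s%:R `^ (173 / 104) + #|F|%:R `^ (- (1 / 285)) * s%:R `^ (476 / 285)) *
    b%:R `^ (4 / 3) = T1 + T2 by rewrite !powR_expR // /T1 /T2 !expRD mulrDl.
have be0 : 0 <= be by apply: ln_nat_ge0.
have bs' : be <= si by apply: ln_le; rewrite // ler_nat.
have st : si <= th by apply: ln_le; rewrite // ler_nat.
set I := incidences U (invset B).
have T1p : 0 < T1 by apply: expR_gt0.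
have T2p : 0 < T2 by apply: expR_gt0.
have hE : (additive_energy (invset A) (invset B))%:R <= I%:R + 2 * T1 :> R.
  apply: (@le_trans _ _ (I + 2 * (#|A| * #|B|))%:R).
    by rewrite ler_nat; apply: energy_le_incidences.
  rewrite natrD lerD2l natrM ler_wpM2l //.
  apply: (@le_trans _ _ (s * b)%:R); first by rewrite ler_nat leq_mul2r as_ orbT.
  have -> : (s * b)%:R = expR (si + be) :> R by rewrite natrM expRD /si /be !lnK.
  rewrite ler_expR; lra.
suff hI : I%:R <= expR c0 * (T1 + T2).
  apply: le_trans hE _; rewrite [leRHS]mulrDl lerD //; lra.
have target1 x : 0 < x -> ln x <= c0 + (173 / 104 * si + 4 / 3 * be) -> x <= expR c0 * (T1 + T2).
  move=> x0 h; apply: le_trans (le_expR_ln x0 h) _; rewrite expRD ler_wpM2l ?expR_ge0 //.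
  by rewrite -/T1; lra.
have target2 x : 0 < x -> ln x <= c0 + (- (1 / 285) * th + 476 / 285 * si + 4 / 3 * be) ->
    x <= expR c0 * (T1 + T2).
  move=> x0 h; apply: le_trans (le_expR_ln x0 h) _; rewrite expRD ler_wpM2l ?expR_ge0 //.
  by rewrite -/T2; lra.
have [I0|I0] := posnP I; first by rewrite I0 mulr_ge0 ?expR_ge0 ?addr_ge0 ?expR_ge0.
have IR : 0 < (I%:R : R) by rewrite ltr0n.
have C0' : (0 < C0)%N by [].
have wC g m X : (g * I ^ m <= C1 * X)%N -> (g * I ^ m <= C0 * X)%N.
  by move=> h; apply: leq_trans h _; rewrite leq_mul2r leqnSn orbT.
have := hC1 F U (invset B); rewrite /= cB -/I => -[h|h|h|[G [c [d [GF h1 h2]]]]].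
- apply: target1 => //; have := @ln_monomial_bound R 1 1 I 36 b 2 1 s 0.
  rewrite !mul1n !muln1 expn1 => /(_ isT I0 isT b0 s0 s0 h).
  rewrite ln1 -/be -/si /c0; lra.
- have h' : (1 * I ^ 280 <= C0 * (b ^ 382 * #|U| ^ 457))%N by apply: wC; rewrite mul1n.
  apply: target1 => //.
  have := @ln_monomial_bound R 1 280 I C0 b 382 #|U| s 457 isT I0 C0' b0 s0 Us h'.
  rewrite ln1 -/be -/si /c0; lra.
- apply: target2 => //; have := @ln_monomial_bound R #|F| 97 I C0 b 132 #|U| s 160
    q0 I0 C0' b0 s0 Us (wC _ _ _ h).
  rewrite -/be -/si -/th /c0; lra.
have g0 : (0 < #|G|)%N by apply/card_gt0P; exists 1; case: GF => -[].
have gR : 0 < (#|G|%:R : R) by rewrite ltr0n.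
apply: target1 => //; set u := #|_| in h1.
have u0 : (0 < u)%N by case: posnP h1 => // ->; rewrite muln0 leqn0 => /eqP I00; rewrite I00 in I0.
have uR : 0 < (u%:R : R) by rewrite ltr0n.
have lI : ln I%:R <= ln 8%:R + 2 * be + ln u%:R :> R.
  apply: (@le_trans _ _ (ln (8 * b ^ 2 * u)%:R)); first by apply: ln_le; rewrite // ler_nat.
  by rewrite !natrM !lnM ?posrE ?mulr_gt0 ?ltr0n // -/be; lra.
have lG := @ln_monomial_bound R #|G| 97 I C0 b 132 #|U| s 160 g0 I0 C0' b0 s0 Us (wC _ _ _ h2).
have := sparse G GF c d; rewrite -/S -/U -/u -/s => hu.
have {hu} hu : u%:R <= K1 * Num.max (#|G|%:R `^ (1 / 2)) (s%:R `^ (51 / 52)).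
  apply: le_trans hu _; rewrite ler_wpM2r //; last by rewrite /K1; lra.
  by rewrite le_max powR_ge0.
have K1R : 0 < K1 by lra.
have lu : ln u%:R <= ln K1 + Num.max (1 / 2 * ln #|G|%:R) (51 / 52 * si).
  have := ln_le uR hu; rewrite !powR_expR // -/si.
  have -> : Num.max (expR (1 / 2 * ln #|G|%:R)) (expR (51 / 52 * si)) =
      expR (Num.max (1 / 2 * ln #|G|%:R) (51 / 52 * si)).
    by rewrite /Num.max /Order.max ltr_expR; case: ifP.
  by rewrite lnM ?posrE ?expR_gt0 // expRK.
move: lG lu; rewrite -/be -/si /c0 /Num.max /Order.max; case: ifP => _ lG lu; lra.
Qed.

Lemma growth_bound_from_energy (R : realType) (C : R) : 0 < C -> exists2 C' : R, 0 < C' &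
  forall (F : finFieldType) (A : {set F}) (E : nat) (M : R),
    (0 < #|A|)%N -> 0 < M -> ((#|A| * #|A|) ^ 2)%:R <= M * E%:R :> R ->
    E%:R <= C * ((M `^ (173 / 104) + #|F|%:R `^ (- (1 / 285)) * M `^ (476 / 285))
                  * #|A|%:R `^ (4 / 3)) ->
    growth_bound R A <= C' * M.
Proof.
move=> C0; pose c : R := `|ln (2 * C)|.
have c0 : 0 <= c by apply: normr_ge0.
have lc : ln (2 * C) <= c by apply: ler_norm.
exists (expR c); first exact: expR_gt0.
move=> F A E M a0 M0 h1 h2.
have q0 : (0 < #|F|)%N by apply: leq_trans a0 (max_card _).
have aR : 0 < (#|A|%:R : R) by rewrite ltr0n.
have qR : 0 < (#|F|%:R : R) by rewrite ltr0n.
pose al : R := ln #|A|%:R; pose mu : R := ln M; pose th : R := ln #|F|%:R.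
pose T1 := expR (173 / 104 * mu + 4 / 3 * al).
pose T2 := expR (- (1 / 285) * th + 476 / 285 * mu + 4 / 3 * al).
have eT : (M `^ (173 / 104) + #|F|%:R `^ (- (1 / 285)) * M `^ (476 / 285))
    * #|A|%:R `^ (4 / 3) = T1 + T2 by rewrite !powR_expR // /T1 /T2 !expRD mulrDl.
have h3 : expR (4 * al) <= expR mu * (C * (T1 + T2)).
  have -> : expR (4 * al) = ((#|A| * #|A|) ^ 2)%:R.
    by rewrite expRM_natl /al lnK // natrX natrM -expr2 -exprM.
  rewrite -eT /mu lnK //; apply: le_trans h1 _; rewrite ler_wpM2l //; exact: ltW.
have C2 : 0 < 2 * C by rewrite mulr_gt0.
have h4 : expR (4 * al) <= expR (ln (2 * C) + mu + (173 / 104 * mu + 4 / 3 * al)) \/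
    expR (4 * al) <= expR (ln (2 * C) + mu + (- (1 / 285) * th + 476 / 285 * mu + 4 / 3 * al)).
  rewrite !(expRD (_ + mu)) -/T1 -/T2 (expRD (ln _)) lnK //.
  have p : 0 <= expR mu * C by rewrite mulr_ge0 ?expR_ge0 // ltW.
  have [T12|T21] := leP T1 T2; [right|left]; apply: le_trans h3 _.
    have -> : 2 * C * expR mu * T2 = expR mu * (C * (T2 + T2)) by ring.
    by rewrite !mulrA ler_wpM2l // lerD2r.
  have -> : 2 * C * expR mu * T1 = expR mu * (C * (T1 + T1)) by ring.
  by rewrite !mulrA ler_wpM2l // lerD2l ltW.
have -> : expR c * M = expR (c + mu) by rewrite expRD /mu lnK.
rewrite /growth_bound ge_min !powR_expR // -expRD -/al -/th !ler_expR.
case: h4; rewrite ler_expR => h; apply/orP; [left|right]; lra.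
Qed.

(** * Growth of sums of reciprocals *)

Lemma growth_sums (R : realType) (K : R) : 0 < K -> exists2 C : R, 0 < C &
  forall (F : finFieldType) (A : {set F}), 0 \notin A -> (2 <= #|A|)%N ->
    subfield_sparse K A A ->
    growth_bound R A <= C * Num.max #|sumset A A|%:R #|sumset (invset A) (invset A)|%:R.
Proof.
move=> K0; have [C1 C10 h1] := energy_bound K0.
have [C C0 h] := growth_bound_from_energy C10; exists C => // F A A0 A2 sp.
have a0 : (0 < #|A|)%N by apply: leq_trans A2.
set M := Num.max _ _.
have SM : #|sumset A A|%:R <= M by rewrite le_max lexx.
have S'M : #|sumset (invset A) (invset A)|%:R <= M by rewrite le_max lexx orbT.
have S0 : (0 : R) < #|sumset A A|%:R.
  by rewrite ltr0n (leq_trans a0) // card_sumset_ge // -card_gt0.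
have M0 : 0 < M by apply: lt_le_trans SM.
apply: (h F A (additive_energy (invset A) (invset A))) => //.
  have := energy_cauchy_schwarz (invset A) (invset A); rewrite card_invset // => hcs.
  apply: (@le_trans _ _ (#|sumset (invset A) (invset A)| * additive_energy (invset A) (invset A))%:R).
    by rewrite ler_nat.
  by rewrite natrM ler_wpM2r.
apply: le_trans (h1 F A A A0 A0 A2 A2 sp) _; rewrite ler_wpM2l ?(ltW C10) //.
have mono r : 0 <= r -> #|sumset A A|%:R `^ r <= M `^ r.
  by move=> r0; apply: ge0_ler_powR; rewrite // nnegrE ltW.
by rewrite ler_wpM2r ?powR_ge0 // lerD ?ler_wpM2l ?powR_ge0 // mono // divr_ge0.
Qed.

Lemma growth_reciprocal (R : realType) (K : R) : 0 < K -> exists2 C : R, 0 < C &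
  forall (F : finFieldType) (A : {set F}), 0 \notin A -> (2 <= #|A|)%N ->
    subfield_sparse K A (invset A) ->
    growth_bound R A <= C * #|sumset A (invset A)|%:R.
Proof.
move=> K0; have [C1 C10 h1] := energy_bound K0.
have [C C0 h] := growth_bound_from_energy C10; exists C => // F A A0 A2 sp.
have a0 : (0 < #|A|)%N by apply: leq_trans A2.
have S0 : (0 : R) < #|sumset A (invset A)|%:R.
  by rewrite ltr0n (leq_trans a0) // card_sumset_ge // -card_gt0 card_invset.
apply: (h F A (additive_energy (invset A) A)) => //.
  have := energy_cauchy_schwarz (invset A) A.
  by rewrite card_invset // sumsetC -natrM ler_nat.
have := h1 F A (invset A) A0 (invset0 A) A2; rewrite card_invset // invsetK //.
by apply.
Qed.

(** Suppose that |A + B| < |A|^(1 + 1/831).  If |A| is below the gap, then |A + B| is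
    at most |G|^(1/2); if it is above, then |G| is at most |A|^(51/52). *)
Lemma gap_dichotomy (R : realType) (F : finFieldType) (A B : {set F}) :
  (0 < #|A|)%N -> (0 < #|B|)%N ->
  (forall G : {set F}, proper_subfield G ->
     (#|A|%:R : R) \notin
       `](#|G|%:R `^ (1 / 2 - 1 / 1664)), (#|G|%:R `^ (1 + 1 / 51))[) ->
  growth_bound R A <= #|sumset A B|%:R \/ subfield_sparse (1 : R) A B.
Proof.
move=> a0 b0 gap; set s := #|sumset A B|.
have as_ : (#|A| <= s)%N by rewrite card_sumset_ge // -card_gt0.
have s0 : (0 < s)%N by apply: leq_trans as_.
have aR : 0 < (#|A|%:R : R) by rewrite ltr0n.
have sR : 0 < (s%:R : R) by rewrite ltr0n.
have las : ln #|A|%:R <= ln s%:R :> R by apply: ln_le; rewrite // ler_nat.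
have [big|small] := leP (#|A|%:R `^ (1 + 1 / 831)) (s%:R : R).
  by left; rewrite /growth_bound ge_min big.
right=> G GF c d; rewrite mul1r -/s.
have g0 : (0 < #|G|)%N by apply/card_gt0P; exists 1; case: GF => -[].
have gR : 0 < (#|G|%:R : R) by rewrite ltr0n.
have ls : ln s%:R <= (1 + 1 / 831) * ln #|A|%:R :> R.
  by rewrite -[leRHS]expRK -powR_expR // ln_le // ltW.
have := gap G GF; rewrite in_itv /= negb_and -!leNgt le_max => /orP[hA|hA]; apply/orP.
  left; apply: (@le_trans _ _ s%:R).
    rewrite ler_nat; apply: leq_trans (subset_leq_card (subsetIl _ _)) _.
    exact: card_invset_le.
  rewrite powR_expR //; apply: le_expR_ln => //.
  have := ln_le aR hA; rewrite powR_expR // expRK; lra.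
right; apply: (@le_trans _ _ #|G|%:R).
  rewrite ler_nat; apply: leq_trans (subset_leq_card (subsetIr _ _)) _.
  exact: leq_imset_card.
rewrite powR_expR //; apply: le_expR_ln => //.
have hG : 0 < #|G|%:R `^ (1 + 1 / 51) :> R by apply: powR_gt0.
have := ln_le hG hA; rewrite powR_expR // expRK; lra.
Qed.

Theorem corollary5 (R : realType) :
  [/\ (forall K : R, 0 < K -> exists2 C : R, 0 < C &
        forall (F : finFieldType) (A B : {set F}),
          0 \notin A -> 0 \notin B -> (2 <= #|A|)%N -> (2 <= #|B|)%N ->
          subfield_sparse K A B ->
          (additive_energy (invset A) (invset B))%:R
          <= C * ((#|sumset A B|%:R `^ (173 / 104)
                   + #|F|%:R `^ (- (1 / 285))
                     * #|sumset A B|%:R `^ (476 / 285))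
                  * #|B|%:R `^ (4 / 3))),
      (forall K : R, 0 < K -> exists2 C : R, 0 < C &
        forall (F : finFieldType) (A : {set F}),
          0 \notin A -> (2 <= #|A|)%N ->
          subfield_sparse K A A ->
          growth_bound R A
          <= C * Num.max #|sumset A A|%:R
                         #|sumset (invset A) (invset A)|%:R),
      (forall K : R, 0 < K -> exists2 C : R, 0 < C &
        forall (F : finFieldType) (A : {set F}),
          0 \notin A -> (2 <= #|A|)%N ->
          subfield_sparse K A (invset A) ->
          growth_bound R A <= C * #|sumset A (invset A)|%:R)
    & (exists2 C : R, 0 < C &
        forall (F : finFieldType) (A : {set F}),
          0 \notin A -> (2 <= #|A|)%N ->
          (forall G : {set F}, proper_subfield G ->
             (#|A|%:R : R) \notin
               `](#|G|%:R `^ (1 / 2 - 1 / 1664)), (#|G|%:R `^ (1 + 1 / 51))[) ->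
          growth_bound R A
          <= C * Num.max #|sumset A A|%:R
                         #|sumset (invset A) (invset A)|%:R
          /\ growth_bound R A <= C * #|sumset A (invset A)|%:R)].
Proof.
split; [exact: energy_bound | exact: growth_sums | exact: growth_reciprocal |].
have [C2 C20 h2] := growth_sums (@ltr01 R).
have [C3 C30 h3] := growth_reciprocal (@ltr01 R).
exists (1 + C2 + C3); first by rewrite !addr_gt0.
move=> F A A0 A2 gap; have a0 : (0 < #|A|)%N by apply: leq_trans A2.
have a'0 : (0 < #|invset A|)%N by rewrite card_invset.
have wide c x y : 0 <= x -> x <= y -> 0 <= c -> c <= 1 + C2 + C3 -> c * x <= (1 + C2 + C3) * y.
  by move=> x0 xy c0 cC; apply: ler_pM.
have C2' := ltW C20; have C3' := ltW C30.
split.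
  have M0 : (0 : R) <= Num.max #|sumset A A|%:R #|sumset (invset A) (invset A)|%:R.
    by rewrite le_max ler0n.
  have [big|sp] := gap_dichotomy a0 a0 gap.
    apply: le_trans big _; rewrite -[leLHS]mul1r; apply: wide => //.
      by rewrite le_max lexx.
    by rewrite -addrA lerDl addr_ge0.
  apply: le_trans (h2 F A A0 A2 sp) _; apply: wide => //; lra.
have [big|sp] := gap_dichotomy a0 a'0 gap.
  apply: le_trans big _; rewrite -[leLHS]mul1r; apply: wide => //.
  by rewrite -addrA lerDl addr_ge0.
apply: le_trans (h3 F A A0 A2 sp) _; apply: wide => //; lra.
Qed.
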